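(* Assume that: (i) for every $\Lambda\subset\{1,\dots,d\}$ and all $x,x'\in\mathbb{Z}^{\Lambda,d}_+$ there is a finite sequence $z_0,\dots,z_k\in\mathbb{Z}^{\Lambda,d}_+$ with $z_0=x$, $z_k=x'$ and $\mu(z_j-z_{j-1})>0$ for all $j=1,\dots,k$; (ii) the function $\varphi(a)=\sum_{z\in\mathbb{Z}^d}\mu(z)\exp(a\cdot z)$ is finite in a neighborhood of the set $D=\{a\in\mathbb{R}^d:\varphi(a)\le 1\}$; (iii) $M=\sum_{x\in\mathbb{Z}^d}\mu(x)\,x\neq 0$. Let $q\in\mathbb{R}^d$ with $|q|=1$ have strictly positive coordinates. Then: (1) the function $h_q(x)=\exp(a(q)\cdot x)-\mathbb{E}_x\bigl(\exp(a(q)\cdot S(\tau)),\ \tau<\infty\bigr)$, $x\in\mathbb{Z}^d_+$, is strictly positive and harmonic for the Markov chain $(Z(t))$; (2) any sequence $x_n\in\mathbb{Z}^d_+$ with $\lim_n|x_n|=\infty$ and $\lim_n x_n/|x_n|=q$ is fundamental for $(Z(t))$, and for any $x\in\mathbb{Z}^d_+$, $$\lim_n\frac{G(x,x_n)}{G(x_0,x_n)}=\frac{h_q(x)}{h_q(x_0)}.$$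
   Context: $d\ge1$, $\mu$ is a probability measure on $\mathbb{Z}^d$, $|\cdot|$ is the Euclidean norm, $x^i$ is the $i$-th coordinate of $x$. $\mathbb{Z}^d_+=\{x\in\mathbb{Z}^d:x^i>0\ \forall i\}$ and, for $\Lambda\subset\{1,\dots,d\}$, $\mathbb{Z}^{\Lambda,d}_+=\{x\in\mathbb{Z}^d:x^i>0\ \forall i\in\Lambda\}$. $(S(t))_{t\in\mathbb{N}}$ is the random walk on $\mathbb{Z}^d$ with transition probabilities $p(x,x')=\mu(x'-x)$, with $\mathbb{P}_x,\mathbb{E}_x$ referring to $S(0)=x$; $\mathbb{E}_x(Y,A)=\mathbb{E}_x(Y\mathbf 1_A)$; $\tau=\inf\{n\ge0:S^j(n)\le0\text{ for some }j\in\{1,\dots,d\}\}$. $(Z(t))$ is the substochastic Markov chain on $\mathbb{Z}^d_+$ with transition matrix $(\mu(x'-x))_{x,x'\in\mathbb{Z}^d_+}$ ($S(t)$ killed at $\tau$), with Green function $G(x,x')=\sum_{t\ge0}\mathbb{P}_x(S(t)=x',\ \tau>t)$. A function $h$ is harmonic for $(Z(t))$ if $\sum_{x'\in\mathbb{Z}^d_+}\mu(x'-x)h(x')=h(x)$ for all $x\in\mathbb{Z}^d_+$. $x_0\in\mathbb{Z}^d_+$ is a fixed reference point; a sequence $x_n\in\mathbb{Z}^d_+$ with $|x_n|\to\infty$ is fundamental for $(Z(t))$ if $G(x,x_n)/G(x_0,x_n)$ converges for every $x\in\mathbb{Z}^d_+$. Under (i)-(iii) the set $D$ is compact and strictly convex,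 $\nabla\varphi$ does not vanish on $\partial D=\{a:\varphi(a)=1\}$, and $a\mapsto\nabla\varphi(a)/|\nabla\varphi(a)|$ is a homeomorphism from $\partial D$ onto the unit sphere of $\mathbb{R}^d$; $q\mapsto a(q)$ denotes its inverse, i.e. $a(q)$ is the unique point of $\partial D$ with $\nabla\varphi(a(q))/|\nabla\varphi(a(q))|=q$. *)

(* Defs.v *)
(* Points of Z^d are row vectors 'rV[int]_d, and points of
   R^d are row vectors 'rV[R]_d, whose library topology is the usual one; the
   library norm on 'rV[R]_d is the sup norm, hence the explicit Euclidean norm
   below. *)
From HB Require Import structures.
From mathcomp Require Import all_boot all_order all_algebra.
From mathcomp Require Import all_classical all_reals all_analysis.

Set Implicit Arguments.
Unset Strict Implicit.
Unset Printing Implicit Defensive.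

Import Order.TTheory GRing.Theory Num.Theory.
Import numFieldNormedType.Exports.

Local Open Scope classical_set_scope.
Local Open Scope ring_scope.

Section lattice.
Context {R : realType} {d : nat}.
Implicit Types (x y z : 'rV[int]_d) (a v q : 'rV[R]_d).

Definition dot a v : R := \sum_(i < d) a 0 i * v 0 i.

Definition enorm v : R := Num.sqrt (\sum_(i < d) v 0 i ^+ 2).

Definition zvec x : 'rV[R]_d := map_mx intr x.

Definition orthant (L : {set 'I_d}) : pred 'rV[int]_d :=
  fun x => [forall i in L, 0 < x 0 i].

Definition pos_orthant : set 'rV[int]_d := [set x | forall i, 0 < x 0 i].

(* Sum over A of a real family, as the difference of the sums of the positive
   and negative parts; it is the usual sum when the family is absolutely
   summable. *)
Definition zsum (A : set 'rV[int]_d) (f : 'rV[int]_d -> R) : R :=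
  let g := fun z => (f z)%:E in
  fine (\esum_(z in A) (g^\+ z)%E - \esum_(z in A) (g^\- z)%E).

Section jump_law.
Variable mu : 'rV[int]_d -> R.

(* A probability measure on the countable set Z^d is given by its values on
   points. *)
Definition is_prob : Prop :=
  (forall z, 0 <= mu z) /\ \esum_(z in [set: 'rV[int]_d]) (mu z)%:E = 1%E.

Definition irreducible_on (L : {set 'I_d}) : Prop :=
  forall x x', orthant L x -> orthant L x' ->
    exists s : seq 'rV[int]_d,
      [/\ path (fun y z => 0 < mu (z - y)) x s,
          all (orthant L) s & last x s = x'].

Definition phi a : \bar R :=
  (\esum_(z in [set: 'rV[int]_d]) (mu z * expR (dot a (zvec z)))%:E)%E.

Definition Dset : set 'rV[R]_d := [set a | (phi a <= 1)%E].

Definition finite_near_Dset : Prop :=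
  exists U : set 'rV[R]_d,
    [/\ open U, Dset `<=` U & forall a, U a -> (phi a < +oo)%E].

Definition drift : 'rV[R]_d :=
  \row_(i < d) zsum [set: 'rV[int]_d] (fun z => mu z * (z 0 i)%:~R).

(* Under [finite_near_Dset], phi is finite, and smooth, around every point where the
   gradient is considered, so that neither [fine] nor the total operator 'D_v
   returns a default value there. *)
Definition grad_phi a : 'rV[R]_d :=
  \row_(i < d) 'D_(delta_mx 0 i) (fun b : 'rV[R]_d => fine (phi b)) a.

(* The inverse, at the unit vector q, of the map sending a point of
   {phi = 1} to its normalized gradient; existence and uniqueness of the
   selected point hold under the assumptions of the theorem. *)
Definition a_of q : 'rV[R]_d :=
  xget 0 [set a | phi a = 1%E /\ (enorm (grad_phi a))^-1 *: grad_phi a = q].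

Definition harmonic_killed (h : 'rV[int]_d -> R) : Prop :=
  forall x, pos_orthant x ->
    summable pos_orthant (fun x' => (mu (x' - x) * h x')%:E) /\
    zsum pos_orthant (fun x' => mu (x' - x) * h x') = h x.

End jump_law.

Section walk.
Context {dO : measure_display} {Om : measurableType dO}.
Variable P : 'rV[int]_d -> probability Om R.
Variable S : nat -> Om -> 'rV[int]_d.

(* Under each P x, (S n)_n is a Markov chain started at x with transition
   probabilities p(y, y') = mu (y' - y). As Z^d is countable, measurability
   of the preimages of points is measurability for its discrete
   sigma-algebra. *)
Definition random_walk (mu : 'rV[int]_d -> R) : Prop :=
  (forall n z, measurable [set w | S n w = z]) /\
  (forall x n (z : nat -> 'rV[int]_d),
     P x [set w | forall k, (k <= n)%N -> S k w = z k] =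
     ((z 0%N == x)%:R * \prod_(k < n) mu (z k.+1 - z k))%:E).

Definition exited (w : Om) : pred nat :=
  fun n => [exists j : 'I_d, S n w 0 j <= 0].

(* [None] stands for infinity. *)
Definition tau (w : Om) : option nat :=
  if pselect (exists n, exited w n) is left ex then Some (ex_minn ex) else None.

Definition tau_gt (t : nat) (w : Om) : bool :=
  if tau w is Some n then (t < n)%N else true.

Definition exit_expectation a x : \bar R :=
  (\int[P x]_w
     (if tau w is Some n then (expR (dot a (zvec (S n w))))%:E else 0))%E.

(* For a = a(q), exp(a . S(n)) is a nonnegative martingale, so the expectation
   is at most exp(a . x) and [fine] is harmless. *)
Definition h_ (mu : 'rV[int]_d -> R) q x : R :=
  expR (dot (a_of mu q) (zvec x)) - fine (exit_expectation (a_of mu q) x).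

Definition green x x' : \bar R :=
  (\sum_(0 <= t <oo) P x [set w | S t w = x' /\ tau_gt t w])%E.

(* In the theorem the walk has nonzero drift, hence is transient: green x x' is finite, and
   it is positive by irreducibility. *)
Definition green_ratio x0 x x' : R :=
  fine (green x x') / fine (green x0 x').

Definition fundamental x0 (u : nat -> 'rV[int]_d) : Prop :=
  [/\ forall n, pos_orthant (u n),
      enorm (zvec (u n)) @[n --> \oo] --> +oo &
      forall x, pos_orthant x ->
        cvgn (fun n => green_ratio x0 x (u n))].

End walk.

End lattice.

(* Main.v *)
(** Put a = a(q) and tilt: m(z) = mu(z) exp(a . z) is a probability, and its
    drift grad phi(a) is a positive multiple of q, hence points into the
    orthant; h_q(x) becomes exp(a . x) P~_x(tau = oo), and
    G(x,y) = exp(a . (x - y)) K(x,y), with K the killed Green function of the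
    tilted walk.  The first exit decomposition
    K(x,y) = G~(y - x) - sum_b P~_x(S(tau) = b) G~(y - b) reduces (2) to
    G~(y - b) / G~(y) --> 1 for y near the ray along q, with a domination
    exp(s|b|) uniform in b for arbitrarily small s, since exit points have an
    exponential moment.

    This ratio limit needs no local limit theorem.  Fix e with v = m(e) > 0 and
    let c(n,j,y) be the mass of the n-step paths to y with exactly j steps e.
    Then (j+1) c(n+1,j+1,y+e) = (n+1) v c(n,j,y), so that
    c(n+1,j+1,y+e) <= K c(n,j,y) when v(n+1) <= K(j+1).  For K > 1 the other
    terms form an atypically low number of steps e: by Chernoff they are at
    most a convolution power of a measure of mass < 1, even after a further
    small exponential tilt, so their sum decays exponentially in |y|, whereas
    by the weak law of large numbers G~(y) >= exp(-eta |y|) near the ray for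
    every eta > 0.  Irreducibility then passes from e to unit vectors.

    Existence of a(q): a maximizer a of a . q on the compact set {phi <= 1}
    satisfies the multiplier rule by second-order expansion of phi; grad phi(a)
    cannot vanish, since otherwise 0 would also be a minimizer of phi and the
    drift would be 0. *)
Require Import Defs.
From HB Require Import structures.
From mathcomp Require Import all_boot all_order all_algebra.
From mathcomp Require Import all_classical all_reals all_analysis.
From mathcomp Require Import measurable_realfun ring lra zify.

Set Implicit Arguments.
Unset Strict Implicit.
Unset Printing Implicit Defensive.

Import Order.TTheory GRing.Theory Num.Theory.
Import numFieldNormedType.Exports.

Local Open Scope classical_set_scope.
Local Open Scope ring_scope.

(** * Sums of nonnegative families *)

(** Deleting a step relates time n + 1 at y + e to time n at y. Summation over n absorbs this change
    of time, so periodicity of the walk causes no difficulty; a limit at fixed times would see it.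
    The comparison gives only upper bounds G~(y + e) <= K G~(y) + error. The reverse bounds come
    from the opposite direction: by irreducibility on all of Z^d, both e_i and -e_i are sums of
    steps. The error has to be compared with G~(y), whose exact order is never computed; this is why
    the lower bound is wanted at every exponential rate. The same competition settles the far exit
    points: when |b| exceeds a fixed fraction of |y|, the weight exp(s|b|) outgrows both 1 / G~(y)
    and a crude bound on G~(y - b). Besides irreducibility and total mass 1, the tilted law enters
    through a quadratic upper bound of its Laplace transform along each coordinate axis. Masses are
    sums in [0, +oo], so that sums may be exchanged freely; identities are stated additively, and
    finiteness is proved where a subtraction occurs. *)

Ltac nonneg := repeat (intros; match goal with
  | |- is_true (@Order.le _ _ _ (mule _ _)) => apply: mule_ge0
  | |- is_true (@Order.le _ _ _ (_%:E)%E) => rewrite lee_fin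
  | |- _ => first [done | solve [auto] ]
  end).

Section esum_extra.
Context {R : realType}.
Implicit Types T : choiceType.
Local Open Scope ereal_scope.

(** One inequality is seen on finite subsums. For finite positive [c] the other follows by applying
    it with 1/c; for c = +oo a single nonzero term makes the left side infinite. *)
Lemma esumZl T (A : set T) (c : \bar R) (f : T -> \bar R) :
  0 <= c -> (forall t, 0 <= f t) ->
  \esum_(t in A) (c * f t) = c * \esum_(t in A) f t.
Proof.
move=> c0 f0.
have le (b : \bar R) (g : T -> \bar R) : 0 <= b -> (forall t, 0 <= g t) ->
    \esum_(t in A) (b * g t) <= b * \esum_(t in A) g t.
  move=> b0 g0; apply: ge_ereal_sup => _ [F [Ffin FA] <-].
  rewrite -ge0_mule_fsumr//; apply: lee_pmul => //.
    by apply: fsume_ge0.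
  by apply: ereal_sup_ubound; exists F.
apply/eqP; rewrite eq_le le//=.
have [->|cneq0] := eqVneq c 0; first by rewrite mul0e esum_ge0// => t _; rewrite mul0e.
have cgt0 : 0 < c by rewrite lt_def cneq0.
move: c0 cneq0 cgt0; case: c => [r| |]//.
- move=> r0 rneq0 rgt0.
  have rE : r != 0%R by [].
  have -> : \esum_(t in A) f t = \esum_(t in A) ((r^-1)%:E * (r%:E * f t)).
    by apply: eq_esum => t _; rewrite muleA -EFinM mulVf// mul1e.
  apply: (@le_trans _ _ (r%:E * ((r^-1)%:E * \esum_(t in A) (r%:E * f t)))).
    apply: lee_wpmul2l => //; apply: le; first by rewrite lee_fin invr_ge0.
    by move=> t; rewrite mule_ge0.
  by rewrite muleA -EFinM divff// mul1e.
- move=> _ _ _.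
  have [[t [At ft]]|none] := pselect (exists t, A t /\ f t != 0); last first.
    rewrite [X in _ * X]esum1 ?mule0.
      by apply: esum_ge0 => t _; rewrite mule_ge0.
    by move=> t At; apply/eqP; apply/negPn/negP => ft; apply: none; exists t.
  have -> : \esum_(i in A) (+oo * f i) = +oo; last by rewrite leey.
  apply/eqP; rewrite eq_le leey/=.
  apply: (esum_ge (x := +oo)).
  exists [set t]; first by split => // _ ->.
  by rewrite fsbig_set1 gt0_mulye// lt_def ft f0.
Qed.

Lemma esumZr T (A : set T) (c : \bar R) (f : T -> \bar R) :
  0 <= c -> (forall t, 0 <= f t) ->
  \esum_(t in A) (f t * c) = (\esum_(t in A) f t) * c.
Proof. by move=> c0 f0; rewrite muleC -esumZl//; apply: eq_esum => t _; rewrite muleC. Qed.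

Lemma esum_exchange T1 T2 (f : T1 -> T2 -> \bar R) :
  (forall s t, 0 <= f s t) ->
  \esum_(s in setT) \esum_(t in setT) f s t =
  \esum_(t in setT) \esum_(s in setT) f s t.
Proof.
move=> f0.
rewrite (@esum_esum R T1 T2 setT (fun=> setT))//.
rewrite (@esum_esum R T2 T1 setT (fun=> setT))//.
apply: (@reindex_esum R _ _ _ _ (fun u : T2 * T1 => (u.2, u.1))).
split => //.
  by move=> [a b] [c e] _ _ [-> ->].
by move=> [a b] _; exists (b, a).
Qed.

Lemma esum_supp1 T (f : T -> \bar R) a :
  (forall t, t != a -> f t = 0) -> 0 <= f a -> \esum_(t in setT) f t = f a.
Proof.
move=> f0 fa; rewrite -(esum_set1 fa) (esum_mkcond [set a]); apply: eq_esum => t _.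
case: ifPn => //; rewrite notin_setE/= => /eqP; exact: f0.
Qed.

Lemma esum_bij T1 T2 (h : T1 -> T2) (g : T2 -> T1) (f : T2 -> \bar R) :
  cancel h g -> cancel g h -> (forall t, 0 <= f t) ->
  \esum_(t in setT) f (h t) = \esum_(t in setT) f t.
Proof.
move=> hK gK f0; rewrite (@reindex_esum _ _ _ setT setT h)//.
split => //; first by move=> a b _ _; exact: (can_inj hK).
by move=> t _; exists (g t).
Qed.

Lemma ler_esumT T (f : T -> \bar R) a : (forall t, 0 <= f t) ->
  f a <= \esum_(t in setT) f t.
Proof.
move=> f0; rewrite -(esum_set1 (f0 a)) (esum_mkcond [set a]).
by apply: le_esum => t _; case: ifP.
Qed.

Lemma esumT_le T (f g : T -> \bar R) : (forall t, f t <= g t) ->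
  \esum_(t in setT) f t <= \esum_(t in setT) g t.
Proof. by move=> fg; apply: le_esum => t _. Qed.

Lemma esumT_eq T (f g : T -> \bar R) : (forall t, f t = g t) ->
  \esum_(t in setT) f t = \esum_(t in setT) g t.
Proof. by move=> fg; apply: eq_esum => t _. Qed.

Lemma esum_nat_recl (f : nat -> \bar R) : (forall n, 0 <= f n) ->
  \esum_(n in setT) f n = f 0%N + \esum_(n in setT) f n.+1.
Proof.
move=> f0; rewrite -[LHS]nneseries_esumT// -[X in _ + X]nneseries_esumT//.
rewrite (nneseries_split 0%N 1%N)// add0n big_nat1; congr (_ + _).
by rewrite -(nneseries_addn 1%N)//; apply: eq_eseriesr => i _; rewrite addn1.
Qed.

Lemma esum_geometric (r : R) : (0 <= r)%R -> (r < 1)%R ->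
  \esum_(n in setT) ((r ^+ n)%:E) = ((1 - r)^-1)%:E.
Proof.
move=> r0 r1; rewrite -nneseries_esumT//; last by move=> n; rewrite lee_fin exprn_ge0.
have := @cvg_geometric_series R 1 r.
rewrite ger0_norm// => /(_ r1) cv.
transitivity (limn (fun n => (series (geometric 1 r) n)%:E)).
  congr (lim (_ @ \oo)); apply/funext => n /=.
  by rewrite /series/= sumEFin; congr (_%:E); apply: eq_bigr => i _; rewrite mul1r.
by apply/cvg_lim => //; apply: cvg_EFin; [exact: nearW|rewrite div1r in cv].
Qed.

End esum_extra.

(** * Convolution powers and Green functions *)

Section convolution.
Context {R : realType} {V : zmodType}.
Implicit Types (m : V -> R) (f : V -> \bar R) (w z e : V).
Local Open Scope ereal_scope.

Definition conv m f w : \bar R := \esum_(z in setT) ((m z)%:E * f (w - z)%R).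

Fixpoint cpow m n : V -> \bar R :=
  if n is n'.+1 then conv m (cpow m n') else fun w => (w == 0%R)%:R%:E.

Definition cgreen m w : \bar R := \esum_(n in setT) cpow m n w.

Lemma conv_ge0 m f w : (forall z, 0 <= m z)%R -> (forall z, 0 <= f z) ->
  0 <= conv m f w.
Proof. by move=> m0 f0; apply: esum_ge0 => z _; rewrite mule_ge0// lee_fin. Qed.

Lemma cpow_ge0 m n w : (forall z, 0 <= m z)%R -> 0 <= cpow m n w.
Proof.
move=> m0; elim: n w => [|n ih] w /=; first by rewrite lee_fin ler0n.
exact: conv_ge0.
Qed.

Lemma cgreen_ge0 m w : (forall z, 0 <= m z)%R -> 0 <= cgreen m w.
Proof. by move=> m0; apply: esum_ge0 => n _; exact: cpow_ge0. Qed.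

Lemma esum_subr f z : (forall w, 0 <= f w) ->
  \esum_(w in setT) f (w - z)%R = \esum_(w in setT) f w.
Proof.
move=> f0; apply: (@esum_bij R V V (fun w => (w - z)%R) (fun w => (w + z)%R)) => //.
  by move=> w; rewrite subrK.
by move=> w; rewrite addrK.
Qed.

(** [chi] is a multiplicative character, later an exponential: this is the Laplace transform of the
    n-step law, which turns convolution into a product. *)
Lemma cpow_mass m (chi : V -> R) n : (forall z, 0 <= m z)%R ->
  (forall z, 0 <= chi z)%R -> chi 0%R = 1%R ->
  (forall x y, chi (x + y) = chi x * chi y)%R ->
  \esum_(w in setT) (cpow m n w * (chi w)%:E) =
  (\esum_(z in setT) (m z * chi z)%:E) ^+ n.
Proof.
move=> m0 chi0 chi1 chiD.
have mchi z : 0 <= (m z * chi z)%:E by rewrite lee_fin mulr_ge0.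
elim: n => [|n ih].
  rewrite (@esum_supp1 _ _ _ 0%R) /=.
  - by rewrite eqxx chi1 mul1e.
  - by move=> t /negPf ->; rewrite mul0e.
  - by rewrite eqxx chi1 mul1e.
have c0 w : 0 <= cpow m n w by exact: cpow_ge0.
rewrite expeS -ih -esumZr//; last first.
  by apply: esum_ge0 => w _; rewrite mule_ge0// lee_fin.
transitivity (\esum_(w in setT) \esum_(z in setT)
   ((m z * chi z)%:E * (cpow m n (w - z)%R * (chi (w - z)%R)%:E))).
  apply: esumT_eq => w; rewrite -esumZr ?lee_fin//; last first.
    by move=> z; rewrite mule_ge0// lee_fin.
  apply: esumT_eq => z.
  have -> : chi w = (chi z * chi (w - z))%R by rewrite -chiD addrC subrK.
  by rewrite !EFinM -!muleA; congr (_ * _); rewrite muleCA.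
rewrite esum_exchange; last by move=> w z; rewrite !mule_ge0// lee_fin.
apply: esumT_eq => z.
rewrite esumZl//; last by move=> w; rewrite mule_ge0// lee_fin.
congr (_ * _); apply: (@esum_subr (fun w => cpow m n w * (chi w)%:E)).
by move=> w; rewrite mule_ge0// lee_fin.
Qed.

Lemma cpow_mass_le m (chi : V -> R) n r : (forall z, 0 <= m z)%R ->
  (forall z, 0 <= chi z)%R -> chi 0%R = 1%R ->
  (forall x y, chi (x + y) = chi x * chi y)%R ->
  \esum_(z in setT) (m z * chi z)%:E <= r%:E ->
  \esum_(w in setT) (cpow m n w * (chi w)%:E) <= (r ^+ n)%:E.
Proof.
move=> m0 chi0 chi1 chiD mr; rewrite cpow_mass// EFin_expe.
have s0 : 0 <= \esum_(z in setT) (m z * chi z)%:E.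
  by apply: esum_ge0 => z _; rewrite lee_fin mulr_ge0.
elim: n => [//|n ih]; rewrite !expeS; apply: lee_pmul => //.
by rewrite expe_ge0.
Qed.

Lemma cgreen_mass_sum_le m (chi : V -> R) r : (forall z, 0 <= m z)%R ->
  (forall z, 0 <= chi z)%R -> chi 0%R = 1%R ->
  (forall x y, chi (x + y) = chi x * chi y)%R ->
  \esum_(z in setT) (m z * chi z)%:E <= r%:E -> (r < 1)%R ->
  \esum_(w in setT) (cgreen m w * (chi w)%:E) <= (1 - r)^-1%:E.
Proof.
move=> m0 chi0 chi1 chiD mr r1.
have r0 : (0 <= r)%R.
  by rewrite -lee_fin (le_trans _ mr)// esum_ge0// => z _; rewrite lee_fin mulr_ge0.
have c0 n w : 0 <= cpow m n w by exact: cpow_ge0.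
rewrite (eq_esum (b := fun w => \esum_(n in setT) (cpow m n w * (chi w)%:E))); last first.
  by move=> w _; rewrite esumZr ?lee_fin.
rewrite esum_exchange; last by move=> w n; rewrite mule_ge0 ?lee_fin.
by rewrite -esum_geometric//; apply: esumT_le => n; exact: cpow_mass_le.
Qed.

(** Keeping one term of the sum turns a tilted mass below 1 into a pointwise exponential bound. *)
Lemma cgreen_mass_le m (chi : V -> R) r w : (forall z, 0 <= m z)%R ->
  (forall z, 0 <= chi z)%R -> chi 0%R = 1%R ->
  (forall x y, chi (x + y) = chi x * chi y)%R ->
  \esum_(z in setT) (m z * chi z)%:E <= r%:E -> (r < 1)%R ->
  cgreen m w * (chi w)%:E <= (1 - r)^-1%:E.
Proof.
move=> m0 chi0 chi1 chiD mr r1.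
apply: le_trans (cgreen_mass_sum_le m0 chi0 chi1 chiD mr r1).
apply: (@ler_esumT R V (fun w => cgreen m w * (chi w)%:E)) => z.
by rewrite mule_ge0 ?lee_fin// cgreen_ge0.
Qed.

Lemma cgreen_step m w : (forall z, 0 <= m z)%R ->
  cgreen m w = (w == 0%R)%:R%:E + conv m (cgreen m) w.
Proof.
move=> m0; rewrite /cgreen esum_nat_recl/=; last by move=> n; exact: cpow_ge0.
congr (_ + _); rewrite /conv esum_exchange; last first.
  by move=> n z; rewrite mule_ge0 ?lee_fin ?cpow_ge0.
by apply: esumT_eq => z; rewrite esumZl ?lee_fin// => n; exact: cpow_ge0.
Qed.

Lemma conv_cgreen_le m w : (forall z, 0 <= m z)%R ->
  conv m (cgreen m) w <= cgreen m w.
Proof. by move=> m0; rewrite [leRHS]cgreen_step// leeDr// lee_fin ler0n. Qed.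

Lemma cgreen_shift_ge m w e : (forall z, 0 <= m z)%R ->
  (m e)%:E * cgreen m w <= cgreen m (w + e)%R.
Proof.
move=> m0; apply: le_trans (conv_cgreen_le _ m0).
rewrite -{1}(addrK e w).
apply: (@ler_esumT R V (fun z => (m z)%:E * cgreen m (w + e - z)%R)) => z.
by rewrite mule_ge0 ?lee_fin// cgreen_ge0.
Qed.

Lemma cgreen0_ge1 m : (forall z, 0 <= m z)%R -> 1 <= cgreen m 0%R.
Proof.
move=> m0; rewrite cgreen_step// eqxx leeDl// conv_ge0// => z.
exact: cgreen_ge0.
Qed.

(** The left side counts the visits to [w] from time [n] on. It lets a lower bound start from the
    typical position at time [n]. *)
Lemma cpow_cgreen_le m n w : (forall z, 0 <= m z)%R ->
  \esum_(z in setT) (cpow m n z * cgreen m (w - z)%R) <= cgreen m w.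
Proof.
move=> m0; have G0 z : 0 <= cgreen m z by exact: cgreen_ge0.
elim: n w => [|n ih] w.
  rewrite (@esum_supp1 _ _ _ 0%R)/=.
  - by rewrite eqxx mul1e subr0.
  - by move=> t /negPf ->; rewrite mul0e.
  - by rewrite eqxx mul1e.
have c0 z : 0 <= cpow m n z by exact: cpow_ge0.
apply: le_trans (conv_cgreen_le _ m0).
rewrite (_ : \esum_(z in setT) _ = \esum_(z in setT) \esum_(x in setT)
   ((m x)%:E * (cpow m n (z - x)%R * cgreen m (w - z)%R))); last first.
  apply: esumT_eq => z /=; rewrite /conv -esumZr//.
    by apply: esumT_eq => x; rewrite muleA.
  by move=> x; rewrite mule_ge0 ?lee_fin.
rewrite esum_exchange; last by move=> z x; rewrite !mule_ge0 ?lee_fin.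
apply: esumT_le => x.
rewrite esumZl ?lee_fin//; last by move=> z; rewrite mule_ge0.
apply: lee_wpmul2l; rewrite ?lee_fin//.
apply: le_trans (ih (w - x)%R).
rewrite -(@esum_subr (fun z => cpow m n z * cgreen m (w - x - z)%R) x); last first.
  by move=> z; rewrite mule_ge0.
apply: esumT_le => z; rewrite (_ : (w - x - (z - x) = w - z)%R)//.
by rewrite opprB addrA subrK.
Qed.

End convolution.

(** * Counting the occurrences of a fixed step *)

Section ratio.
Context {R : realType} {V : zmodType}.
Variables (m : V -> R) (e : V).
Hypothesis m0 : forall z, (0 <= m z)%R.
Implicit Types (f : V -> \bar R) (w z : V).
Local Open Scope ereal_scope.

Let rho z : R := if z == e then 0%R else m z.

Let rho0 z : (0 <= rho z)%R. Proof. by rewrite /rho; case: ifP. Qed.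

(* The mass of the n-step paths from 0 to w with exactly j steps equal to e. *)
Fixpoint cnt n j w : \bar R :=
  if n is n'.+1 then
    (if j is j'.+1 then (m e)%:E * cnt n' j' (w - e)%R else 0)
    + conv rho (cnt n' j) w
  else ((j == 0%N) && (w == 0%R))%:R%:E.

Lemma cnt_ge0 n j w : 0 <= cnt n j w.
Proof.
elim: n j w => [|n ih] j w /=; first by rewrite lee_fin ler0n.
rewrite adde_ge0//; last exact: conv_ge0.
by case: j => // j; rewrite mule_ge0 ?lee_fin.
Qed.

(** A weight [c] per step and [s] per step [e] turn the generating function of [cnt] in j into a
    convolution power, to which the mass bounds apply; this replaces binomial estimates. *)
Definition reweight (c s : R) z : R := (c * (if z == e then s * m e else m z))%R.

Lemma reweight_ge0 c s z : (0 <= c)%R -> (0 <= s)%R -> (0 <= reweight c s z)%R.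
Proof. by move=> c0 s0; rewrite /reweight mulr_ge0//; case: ifP => _; rewrite ?mulr_ge0. Qed.

Lemma conv_reweight c s f w : (0 <= c)%R -> (0 <= s)%R -> (forall z, 0 <= f z) ->
  conv (reweight c s) f w = (c * s * m e)%:E * f (w - e)%R + c%:E * conv rho f w.
Proof.
move=> c0 s0 f0; rewrite -esumZl ?lee_fin//; last first.
  by move=> z; rewrite mule_ge0 ?lee_fin.
rewrite (_ : _ * f (w - e)%R = \esum_(z in setT)
    (if z == e then (c * s * m e)%:E * f (w - z)%R else 0)).
  rewrite -esumD; last 2 first.
  - by move=> z _; case: ifP => //; rewrite mule_ge0 ?lee_fin ?mulr_ge0.
  - by move=> z _; rewrite !mule_ge0 ?lee_fin.
  apply: esumT_eq => z; rewrite /reweight /rho; case: ifPn => [/eqP ->|_].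
    by rewrite mul0e mule0 adde0 mulrA.
  by rewrite add0e EFinM muleA.
rewrite (@esum_supp1 _ _ _ e) ?eqxx// => [t /negPf ->//|].
by rewrite mule_ge0 ?lee_fin ?mulr_ge0.
Qed.

Lemma cnt_sum c s n w : (0 <= c)%R -> (0 <= s)%R ->
  \esum_(j in setT) ((c ^+ n * s ^+ j)%:E * cnt n j w) = cpow (reweight c s) n w.
Proof.
move=> c0 s0; elim: n w => [|n ih] w.
  rewrite (@esum_supp1 _ _ _ 0%N)/=.
  - by rewrite mulr1 mul1e.
  - by move=> [|j]//= _; rewrite mule0.
  - by rewrite mule_ge0 ?lee_fin ?mulr1 ?ler0n.
have cs0 k j : (0 <= c ^+ k * s ^+ j)%R by rewrite mulr_ge0// exprn_ge0.
rewrite [RHS]/= conv_reweight//; last first.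
  by move=> z; apply: cpow_ge0 => x; exact: reweight_ge0.
rewrite (_ : \esum_(j in setT) _ = \esum_(j in setT)
    ((if j is j'.+1 then (c ^+ n.+1 * s ^+ j)%:E * ((m e)%:E * cnt n j' (w - e)%R) else 0)
     + c%:E * \esum_(z in setT) ((rho z)%:E * ((c ^+ n * s ^+ j)%:E * cnt n j (w - z)%R)))); last first.
  apply: esumT_eq => j; rewrite [cnt n.+1 _ _]/=.
  rewrite ge0_muleDr ?conv_ge0//; [|by move: j => [|j]; rewrite ?mule_ge0 ?lee_fin ?cnt_ge0|by move=> z; exact: cnt_ge0].
  congr (_ + _); first by case: j => [|j] //; rewrite mule0.
  rewrite -!esumZl ?lee_fin//; last 2 first.
  - by move=> z; rewrite !mule_ge0 ?lee_fin ?cnt_ge0.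
  - by move=> z; rewrite !mule_ge0 ?lee_fin ?cnt_ge0.
  apply: esumT_eq => z; rewrite exprS -mulrA EFinM -!muleA.
  by congr (_ * _); rewrite muleCA.
rewrite esumD; last 2 first.
- by move=> [|j] _ //; rewrite !mule_ge0 ?lee_fin ?cnt_ge0.
- by move=> j _; rewrite mule_ge0 ?lee_fin// esum_ge0// => z _; rewrite !mule_ge0 ?lee_fin ?cnt_ge0.
congr (_ + _).
  rewrite esum_nat_recl; last by move=> [|j] //; rewrite !mule_ge0 ?lee_fin ?cnt_ge0.
  rewrite add0e -ih -esumZl; last 2 first.
  - by rewrite lee_fin !mulr_ge0.
  - by move=> j; rewrite !mule_ge0 ?lee_fin ?cnt_ge0.
  apply: esumT_eq => j; rewrite !muleA -!EFinM; congr (_%:E * _).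
  by rewrite !exprS; ring.
rewrite esumZl ?lee_fin//; last first.
  by move=> j; rewrite esum_ge0// => z _; rewrite !mule_ge0 ?lee_fin ?cnt_ge0.
congr (_ * _); rewrite esum_exchange; last by move=> j z; rewrite !mule_ge0 ?lee_fin ?cnt_ge0.
apply: esumT_eq => z; rewrite esumZl ?lee_fin//; last first.
  by move=> j; rewrite !mule_ge0 ?lee_fin ?cnt_ge0.
by rewrite ih.
Qed.

(* Mark one of the steps e of a path and delete it. *)
Lemma cnt_rec n j w :
  j.+1%:R%:E * cnt n.+1 j.+1 w = n.+1%:R%:E * ((m e)%:E * cnt n j (w - e)%R).
Proof.
have N0 k : 0 <= k%:R%:E :> \bar R by rewrite lee_fin ler0n.
have NS k (x : \bar R) : 0 <= x -> k.+1%:R%:E * x = x + k%:R%:E * x.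
  by move=> x0; rewrite -natr1 EFinD ge0_muleDl// mul1e addeC.
elim: n j w => [|n ih] j w.
  have -> : cnt 1 j.+1 w = (m e)%:E * cnt 0 j (w - e)%R.
    by rewrite /= /conv esum1 ?adde0// => z _; rewrite mule0.
  by case: j => [//|j]; rewrite /= !mule0.
have ih0 n' j' z : 0 <= cnt n' j' z by exact: cnt_ge0.
set X := cnt n.+1 j (w - e)%R.
have -> : cnt n.+2 j.+1 w = (m e)%:E * X + conv rho (cnt n.+1 j.+1) w by [].
rewrite ge0_muleDr//; [|by rewrite mule_ge0 ?lee_fin//; exact: ih0|exact: conv_ge0].
(* [Y] and [C] are the parts of [X] whose next step is, respectively is not, [e]. The induction
   hypothesis produces (n+1) Y from j X and (n+1) m(e) C from the other paths; together they are
   (n+1) m(e) X, and one more copy of m(e) X is left over. *)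
pose C := conv rho (cnt n j) (w - e)%R.
pose Y := if j is j'.+1 then (m e)%:E * cnt n j' (w - e - e)%R else 0.
have XE : X = Y + C by [].
have Y0 : 0 <= Y by rewrite /Y; case: (j) => // j'; rewrite mule_ge0 ?lee_fin.
have C0 : 0 <= C by exact: conv_ge0.
have X0 : 0 <= X by rewrite XE adde_ge0.
have jX : j%:R%:E * X = n.+1%:R%:E * Y.
  by rewrite /X /Y; case: (j) => [|j']; [rewrite mul0e mule0|rewrite ih].
have -> : j.+1%:R%:E * conv rho (cnt n.+1 j.+1) w = n.+1%:R%:E * ((m e)%:E * C).
  rewrite /C /conv -!esumZl; [|by nonneg..].
  apply: esumT_eq => z; rewrite muleCA ih (addrAC w) !muleA; congr (_ * _).
  by rewrite -!EFinM; congr (_%:E); ring.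
have mX0 : 0 <= (m e)%:E * X by nonneg.
rewrite (NS j)// (muleCA j%:R%:E) jX (muleCA (m e)%:E).
rewrite -addeA -ge0_muleDr; [|by nonneg..].
by rewrite -ge0_muleDr; [rewrite -XE [RHS]NS|nonneg..].
Qed.

Lemma cnt_shift_le (K : R) n j w : (n.+1%:R * m e <= K * j.+1%:R)%R ->
  cnt n.+1 j.+1 (w + e)%R <= K%:E * cnt n j w.
Proof.
move=> le.
have jn0 : j.+1%:R != 0%R :> R by rewrite pnatr_eq0.
rewrite -[leLHS]mul1e -(mulVf jn0) EFinM -muleA cnt_rec addrK.
rewrite !muleA -!EFinM; apply: lee_wpmul2r; first exact: cnt_ge0.
by rewrite lee_fin -mulrA ler_pdivrMl ?ltr0n// (mulrC _ K).
Qed.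

Lemma reweight1 : reweight 1 1 = m.
Proof.
by apply/funext => z; rewrite /reweight !mul1r; case: eqP => [->|].
Qed.

(* The second summand bounds the paths with j steps e where K j < (m e) n: on
   them the weight exp(eta (m e) n - eta K j) of the reweighted power is at
   least 1. *)
Lemma cpow_ratio (K eta : R) n w : (0 <= K)%R -> (0 <= eta)%R ->
  cpow m n.+1 (w + e)%R <= K%:E * cpow m n w +
   cpow (reweight (expR (eta * m e)) (expR (- eta * K))) n.+1 (w + e)%R.
Proof.
move=> K0 eta0; set c := expR (eta * m e); set s := expR _.
have c0 : (0 <= c)%R by exact: expR_ge0.
have s0 : (0 <= s)%R by exact: expR_ge0.
rewrite -[in cpow m n w]reweight1 -{1}reweight1 -!cnt_sum ?ler01//.
have ct0 n' j' z : 0 <= cnt n' j' z by exact: cnt_ge0.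
have cs0 k j : (0 <= c ^+ k * s ^+ j)%R by rewrite mulr_ge0// exprn_ge0.
have one k j : (1 ^+ k * 1 ^+ j = 1 :> R)%R by rewrite !expr1n mulr1.
rewrite (eq_esum (b := fun j => cnt n.+1 j (w + e)%R)); last first.
  by move=> j _; rewrite one mul1e.
rewrite [in K%:E * _](eq_esum (b := fun j => cnt n j w)); last first.
  by move=> j _; rewrite one mul1e.
have bad k j : (j%:R * K <= k%:R * m e)%R -> (1 <= c ^+ k * s ^+ j)%R.
  move=> le; rewrite -!expRM_natl -expRD -[leLHS]expR0 ler_expR.
  have -> : (k%:R * (eta * m e) + j%:R * (- eta * K) = eta * (k%:R * m e - j%:R * K))%R by ring.
  by rewrite mulr_ge0// subr_ge0.
rewrite -esumZl ?lee_fin// esum_nat_recl// [X in _ <= _ + X]esum_nat_recl; last first.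
  by move=> j; rewrite mule_ge0 ?lee_fin.
(* Paths with j = 0 have no step [e] to delete, but they are always atypical and go to the
   reweighted sum. *)
rewrite [leRHS]addeCA; apply: leeD.
  rewrite -[leLHS]mul1e; apply: lee_wpmul2r => //; rewrite lee_fin bad//.
  by rewrite mul0r mulr_ge0.
rewrite -esumD//; last 2 first.
- by move=> j _; rewrite mule_ge0 ?lee_fin.
- by move=> j _; rewrite mule_ge0 ?lee_fin.
apply: esumT_le => j.
have [le|/ltW le] := lerP (n.+1%:R * m e) (K * j.+1%:R).
  by apply: (le_trans (cnt_shift_le _ le)); rewrite leeDl// mule_ge0 ?lee_fin.
rewrite -[leLHS]add0e; apply: leeD; first by rewrite mule_ge0 ?lee_fin.
rewrite -[leLHS]mul1e; apply: lee_wpmul2r => //; rewrite lee_fin bad//.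
by rewrite mulrC.
Qed.

Lemma cgreen_ratio (K eta : R) w : (0 <= K)%R -> (0 <= eta)%R ->
  cgreen m (w + e)%R <= K%:E * cgreen m w +
    cgreen (reweight (expR (eta * m e)) (expR (- eta * K))) (w + e)%R.
Proof.
move=> K0 eta0; set lam := reweight _ _.
have lam0 z : (0 <= lam z)%R by apply: reweight_ge0; exact: expR_ge0.
have c0 n z : 0 <= cpow m n z by exact: cpow_ge0.
have l0 n z : 0 <= cpow lam n z by exact: cpow_ge0.
rewrite /cgreen esum_nat_recl// [X in _ <= _ + X]esum_nat_recl//.
(* The time-0 term has no predecessor; it equals the time-0 term of the reweighted Green
   function. *)
rewrite [leRHS]addeCA; apply: leeD => //.
rewrite -esumZl ?lee_fin// -esumD//; last by move=> n _; rewrite mule_ge0 ?lee_fin.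
by apply: esumT_le => n; exact: cpow_ratio.
Qed.

End ratio.

(** * Killed walks *)

Lemma esum_nat_shift (R : realType) (f : nat -> \bar R) s : (forall n, 0 <= f n)%E ->
  (\esum_(t in setT) (if (s < t)%N then f (t - s.+1)%N else 0) =
   \esum_(t in setT) f t)%E.
Proof.
move=> f0; elim: s => [|s ih].
  rewrite esum_nat_recl; last by move=> [|n] //=.
  by rewrite add0e; apply: esumT_eq => t; rewrite subn1.
rewrite esum_nat_recl; last by move=> n; case: ifP.
by rewrite add0e -ih; apply: esumT_eq => t; rewrite ltnS subSS.
Qed.

Section killed.
Context {R : realType} {V : zmodType}.
Variables (m : V -> R) (A : pred V).
Hypothesis m0 : forall z, (0 <= m z)%R.
Implicit Types (x y z b : V).
Local Open Scope ereal_scope.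

(* Points visited at times 1, .., t are required to lie in A, the starting point
   is not. *)
Fixpoint kpow t x y : \bar R :=
  if t is t'.+1 then
    \esum_(z in setT) (if A z then (m (z - x))%:E * kpow t' z y else 0)
  else (x == y)%:R%:E.

(* Exit at time t + 1. *)
Definition kexit t x b : \bar R :=
  if A b then 0 else \esum_(y in setT) (kpow t x y * (m (b - y))%:E).

Definition kgreen x y : \bar R := \esum_(t in setT) kpow t x y.

Definition exit_law x b : \bar R := \esum_(t in setT) kexit t x b.

Definition exit_prob x : \bar R := \esum_(b in setT) exit_law x b.

Let m0E z : 0 <= (m z)%:E. Proof. by rewrite lee_fin. Qed.

Lemma kpow_ge0 t x y : 0 <= kpow t x y.
Proof.
elim: t x => [|t ih] x /=; first by rewrite lee_fin ler0n.
by apply: esum_ge0 => z _; case: ifP => // _; rewrite mule_ge0.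
Qed.

Lemma kexit_ge0 t x b : 0 <= kexit t x b.
Proof.
rewrite /kexit; case: ifP => // _; apply: esum_ge0 => y _.
by rewrite mule_ge0// kpow_ge0.
Qed.

Lemma kgreen_ge0 x y : 0 <= kgreen x y.
Proof. by apply: esum_ge0 => t _; exact: kpow_ge0. Qed.

Lemma exit_law_ge0 x b : 0 <= exit_law x b.
Proof. by apply: esum_ge0 => t _; exact: kexit_ge0. Qed.

Lemma exit_prob_ge0 x : 0 <= exit_prob x.
Proof. by apply: esum_ge0 => b _; exact: exit_law_ge0. Qed.

Lemma exit_law_in x b : A b -> exit_law x b = 0.
Proof. by move=> Ab; rewrite /exit_law esum1// => t _; rewrite /kexit Ab. Qed.

Lemma esum_from_start x (f : V -> \bar R) : (forall z, 0 <= f z) ->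
  \esum_(y in setT) ((x == y)%:R%:E * f y) = f x.
Proof.
move=> f0; rewrite (@esum_supp1 _ _ _ x) ?eqxx ?mul1e//.
by move=> y; rewrite eq_sym => /negPf ->; rewrite mul0e.
Qed.

(** Last-step decomposition, the form in which the Markov property of the walk delivers these
    masses; [kpow] itself unfolds the first step. *)
Lemma kpow_forward t x y : kpow t.+1 x y =
  if A y then \esum_(z in setT) (kpow t x z * (m (y - z))%:E) else 0.
Proof.
elim: t x => [|t ih] x.
  rewrite [LHS]/=.
  transitivity (\esum_(z in setT) ((y == z)%:R%:E * (if A z then (m (z - x))%:E else 0))).
    by apply: esumT_eq => z; rewrite eq_sym muleC; case: ifP; rewrite ?mule0.
  rewrite (@esum_from_start y (fun z => if A z then (m (z - x))%:E else 0)); last first.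
    by move=> z; case: ifP.
  by case: ifP => // _; rewrite [RHS]esum_from_start.
have k0 t' x' y' : 0 <= kpow t' x' y' by exact: kpow_ge0.
have -> : kpow t.+2 x y = \esum_(z in setT) (if A z then (m (z - x))%:E * kpow t.+1 z y else 0) by [].
case: ifPn => Ay; last first.
  by rewrite esum1// => z _; rewrite ih (negPf Ay) mule0; case: ifP.
transitivity (\esum_(z in setT) \esum_(w in setT)
   (if A z then (m (z - x))%:E * (kpow t z w * (m (y - w))%:E) else 0)).
  apply: esumT_eq => z; case: ifP => Az; last by rewrite esum1.
  by rewrite ih Ay esumZl// => w; rewrite mule_ge0.
rewrite esum_exchange; last by move=> z w; case: ifP => // _; rewrite !mule_ge0.
apply: esumT_eq => w; rewrite [kpow t.+1 x w]/= -esumZr//; last first.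
  by move=> z; case: ifP => // _; rewrite mule_ge0.
by apply: esumT_eq => z; case: ifP; rewrite ?mul0e// muleA.
Qed.

Lemma kexit0 x b : kexit 0 x b = if A b then 0 else (m (b - x))%:E.
Proof. by rewrite /kexit; case: ifP => // _; rewrite [LHS]esum_from_start. Qed.

Lemma kexitS t x b : kexit t.+1 x b =
  \esum_(z in setT) (if A z then (m (z - x))%:E * kexit t z b else 0).
Proof.
have k0 t' x' y' : 0 <= kpow t' x' y' by exact: kpow_ge0.
rewrite /kexit; case: ifP => Ab; first by rewrite esum1// => z _; rewrite mule0; case: ifP.
transitivity (\esum_(y in setT) \esum_(z in setT)
   (if A z then (m (z - x))%:E * (kpow t z y * (m (b - y))%:E) else 0)).
  apply: esumT_eq => y; rewrite [kpow t.+1 x y]/= -esumZr//; last first.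
    by move=> z; case: ifP => // _; rewrite mule_ge0.
  by apply: esumT_eq => z; case: ifP; rewrite ?mul0e// muleA.
rewrite esum_exchange; last by move=> z w; case: ifP => // _; rewrite !mule_ge0.
apply: esumT_eq => z; case: ifP => Az; last by rewrite esum1.
by rewrite esumZl// => w; rewrite mule_ge0.
Qed.

(** A path of length t either stays in [A], or exits at some time s + 1 <= t at a point b and moves
    freely afterwards. The induction splits off the first step: a step outside [A] is the exit with
    s = 0, a step inside shifts s by one. *)
Lemma first_exit t x y : cpow m t (y - x)%R = kpow t x y +
  \esum_(b in setT) \esum_(s in setT)
    (if (s < t)%N then kexit s x b * cpow m (t - s.+1) (y - b)%R else 0).
Proof.
have c0 t' w : 0 <= cpow m t' w by exact: cpow_ge0.
have k0 t' x' y' : 0 <= kpow t' x' y' by exact: kpow_ge0.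
have e0 t' x' y' : 0 <= kexit t' x' y' by exact: kexit_ge0.
have T0 t' x' b s : 0 <= (if (s < t')%N then kexit s x' b * cpow m (t' - s.+1) (y - b)%R else 0).
  by case: ifP => // _; rewrite mule_ge0.
elim: t x => [|t ih] x.
  rewrite esum1 ?adde0; last by move=> b _; rewrite esum1.
  by rewrite /= subr_eq0 eq_sym.
have -> : cpow m t.+1 (y - x)%R = \esum_(z in setT) ((m (z - x))%:E * cpow m t (y - z)%R).
  rewrite /= /conv -[LHS](@esum_subr _ _ (fun w => (m w)%:E * cpow m t (y - x - w)%R) x); last first.
    by move=> w; rewrite mule_ge0.
  by apply: esumT_eq => z; rewrite opprB addrA subrK.
transitivity (\esum_(z in setT) ((if A z then (m (z - x))%:E * kpow t z y else 0)
  + (kexit 0 x z * cpow m t (y - z)%R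
  + (if A z then (m (z - x))%:E * (\esum_(b in setT) \esum_(s in setT)
    (if (s < t)%N then kexit s z b * cpow m (t - s.+1) (y - b)%R else 0)) else 0)))).
  apply: esumT_eq => z; rewrite kexit0; case: ifP => Az; last by rewrite add0e adde0.
  rewrite mul0e add0e -ge0_muleDr -?ih//.
  by apply: esum_ge0 => b _; apply: esum_ge0 => s _.
have ES0 z : 0 <= \esum_(b in setT) \esum_(s in setT)
    (if (s < t)%N then kexit s z b * cpow m (t - s.+1) (y - b)%R else 0).
  by apply: esum_ge0 => b _; apply: esum_ge0 => s _.
rewrite esumD; last 2 first.
- by move=> z _; case: ifP => // _; rewrite mule_ge0.
- by move=> z _; rewrite adde_ge0 ?mule_ge0//; case: ifP => // _; rewrite mule_ge0.
congr (_ + _).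
rewrite esumD; last 2 first.
- by move=> z _; rewrite mule_ge0.
- by move=> z _; case: ifP => // _; rewrite mule_ge0.
transitivity (\esum_(b in setT) (kexit 0 x b * cpow m t (y - b)%R +
   \esum_(s in setT) (if (s < t)%N then kexit s.+1 x b * cpow m (t - s.+1) (y - b)%R else 0))); last first.
  apply: esumT_eq => b; rewrite [RHS]esum_nat_recl//= subn1; congr (_ + _).
rewrite esumD; last 2 first.
- by move=> z _; rewrite mule_ge0.
- by move=> b _; apply: esum_ge0 => s _; case: ifP => // _; rewrite mule_ge0.
congr (_ + _).
transitivity (\esum_(z in setT) \esum_(b in setT) \esum_(s in setT)
   (if A z then (m (z - x))%:E *
     (if (s < t)%N then kexit s z b * cpow m (t - s.+1) (y - b)%R else 0) else 0)).
  apply: esumT_eq => z; case: ifP => Az; last by rewrite esum1// => b _; rewrite esum1.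
  rewrite -esumZl//; last by move=> b; apply: esum_ge0 => s _.
  by apply: esumT_eq => b; rewrite esumZl.
have TT0 z b s : 0 <= (if A z then (m (z - x))%:E *
     (if (s < t)%N then kexit s z b * cpow m (t - s.+1) (y - b)%R else 0) else 0).
  by case: ifP => // _; rewrite mule_ge0.
rewrite esum_exchange; last by move=> z b; apply: esum_ge0 => s _.
apply: esumT_eq => b; rewrite esum_exchange//.
apply: esumT_eq => s; case: ifP => st; last by rewrite esum1// => z _; rewrite mule0; case: ifP.
rewrite kexitS -esumZr//; last by move=> z; case: ifP => // _; rewrite mule_ge0.
by apply: esumT_eq => z; case: ifP; rewrite ?mul0e// muleA.
Qed.

Lemma cgreen_first_exit x y : cgreen m (y - x)%R = kgreen x y +
  \esum_(b in setT) (exit_law x b * cgreen m (y - b)%R).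
Proof.
have c0 t' w : 0 <= cpow m t' w by exact: cpow_ge0.
have k0 t' x' y' : 0 <= kpow t' x' y' by exact: kpow_ge0.
have e0 t' x' y' : 0 <= kexit t' x' y' by exact: kexit_ge0.
have T0 t' b s : 0 <= (if (s < t')%N then kexit s x b * cpow m (t' - s.+1) (y - b)%R else 0).
  by case: ifP => // _; rewrite mule_ge0.
rewrite /cgreen (esumT_eq (fun t => first_exit t x y)) esumD//; last first.
  by move=> t _; apply: esum_ge0 => b _; apply: esum_ge0.
congr (_ + _); rewrite esum_exchange; last by move=> t b; apply: esum_ge0.
apply: esumT_eq => b; rewrite esum_exchange//.
rewrite /exit_law -esumZr//; last by apply: esum_ge0.
apply: esumT_eq => s; rewrite -esumZl//.
rewrite -(@esum_nat_shift _ (fun t => kexit s x b * cpow m t (y - b)%R) s)//.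
by move=> t; rewrite mule_ge0.
Qed.

Lemma kgreen_le_cgreen x y : kgreen x y <= cgreen m (y - x)%R.
Proof.
rewrite cgreen_first_exit leeDl// esum_ge0// => b _.
by rewrite mule_ge0 ?exit_law_ge0// cgreen_ge0.
Qed.

(** The exit point is in particular visited, and the Green function at 0 is at least 1. *)
Lemma exit_law_le_cgreen x b : exit_law x b <= cgreen m (b - x)%R.
Proof.
apply: (@le_trans _ _ (exit_law x b * cgreen m 0%R)).
  by rewrite -[leLHS]mule1; apply: lee_wpmul2l; rewrite ?exit_law_ge0// cgreen0_ge1.
have f0 b' : 0 <= exit_law x b' * cgreen m (b - b')%R.
  by rewrite mule_ge0 ?exit_law_ge0// cgreen_ge0.
rewrite cgreen_first_exit -[leLHS]add0e; apply: leeD; first exact: kgreen_ge0.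
by apply: le_trans (ler_esumT b f0); rewrite subrr.
Qed.

Lemma exit_law_step x b : exit_law x b = (if A b then 0 else (m (b - x))%:E) +
  \esum_(z in setT) (if A z then (m (z - x))%:E * exit_law z b else 0).
Proof.
have e0 t' x' y' : 0 <= kexit t' x' y' by exact: kexit_ge0.
rewrite {1}/exit_law esum_nat_recl// kexit0; congr (_ + _).
rewrite (esumT_eq (fun t => kexitS t x b)) esum_exchange; last first.
  by move=> t z; case: ifP => // _; rewrite mule_ge0.
apply: esumT_eq => z; case: ifP => Az; last by rewrite esum1.
by rewrite esumZl.
Qed.

Lemma exit_prob_step x : exit_prob x =
  \esum_(z in setT) ((m (z - x))%:E * (if A z then exit_prob z else 1)).
Proof.
have e0 z b : 0 <= exit_law z b by exact: exit_law_ge0.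
rewrite {1}/exit_prob (esumT_eq (fun b => exit_law_step x b)) esumD; last 2 first.
- by move=> b _; case: ifP.
- by move=> b _; apply: esum_ge0 => z _; case: ifP => // _; rewrite mule_ge0.
rewrite esum_exchange; last by move=> b z; case: ifP => // _; rewrite mule_ge0.
rewrite -esumD; last 2 first.
- by move=> b _; case: ifP.
- by move=> b _; apply: esum_ge0 => z _; case: ifP => // _; rewrite mule_ge0.
apply: esumT_eq => z; case: ifP => Az; last by rewrite esum1// adde0 mule1.
by rewrite add0e esumZl.
Qed.

(** The fixed-point equation [exit_prob_step] alone does not exclude the value +oo, so the exits
    before time n are bounded by induction on n. *)
Lemma exit_prob_le1 x : \esum_(z in setT) (m z)%:E = 1 -> exit_prob x <= 1.
Proof.
move=> m1; pose e s x := \esum_(b in setT) kexit s x b.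
have e0 s z : 0 <= e s z by apply: esum_ge0 => b _; exact: kexit_ge0.
have eS s z : e s.+1 z = \esum_(w in setT) (if A w then (m (w - z))%:E * e s w else 0).
  rewrite /e (esumT_eq (fun b => kexitS s z b)) esum_exchange; last first.
    by move=> b w; case: ifP => // _; rewrite mule_ge0 ?kexit_ge0.
  apply: esumT_eq => w; case: ifP => Aw; last by rewrite esum1.
  by rewrite esumZl// => b; exact: kexit_ge0.
have S1 n z : \sum_(0 <= s < n) e s z <= 1.
  elim: n z => [|n ih] z; first by rewrite big_nil.
  rewrite big_nat_recl//=.
  rewrite (eq_bigr (fun s => \esum_(w in setT) (if A w then (m (w - z))%:E * e s w else 0))); last first.
    by move=> s _; rewrite eS.
  rewrite -esum_sum; last by move=> w s _ _; case: ifP => // _; rewrite mule_ge0.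
  rewrite {1}/e -esumD; last 2 first.
  - by move=> w _; exact: kexit_ge0.
  - by move=> w _; apply: sume_ge0 => s _; case: ifP => // _; rewrite mule_ge0.
  rewrite -m1 -(@esum_subr _ _ (fun w => (m w)%:E) z)//.
  apply: esumT_le => w; rewrite kexit0; case: ifP => Aw.
    rewrite add0e -ge0_sume_distrr//.
    by rewrite -[leRHS]mule1; apply: lee_wpmul2l.
  by rewrite big1// adde0.
rewrite /exit_prob esum_exchange; last by move=> b s; exact: kexit_ge0.
rewrite -nneseries_esumT//; last by move=> s; exact: e0.
apply: lime_le; first by apply: is_cvg_nneseries => s _ _; exact: e0.
by apply: nearW => n; exact: S1.
Qed.

End killed.

(** * Walks drifting into the orthant *)

Section small_large.
Context {R : realType}.

Lemma expR_ge1 (x : R) : 0 <= x -> 1 <= expR x.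
Proof. by move=> x0; rewrite -expR0 ler_expR. Qed.

Lemma exists_small (D gap s0 : R) : 0 < gap -> 0 < s0 ->
  exists s : R, [/\ 0 < s, s <= s0 & s * D < gap].
Proof.
move=> gap0 s00; pose s := Num.min s0 (gap / (2 * (`|D| + 1))).
have D1 : 0 < 2 * (`|D| + 1) by rewrite mulr_gt0// ltr_pwDr.
have s_gt0 : 0 < s by rewrite lt_min s00 divr_gt0.
exists s; split => //; first by rewrite ge_min lexx.
have : s * (2 * (`|D| + 1)) <= gap by rewrite -ler_pdivlMr// ge_min lexx orbT.
have : s * D <= s * `|D| by rewrite ler_pM2l// ler_norm.
have := mulr_ge0 (ltW s_gt0) (normr_ge0 D).
by rewrite !mulrDr; lra.
Qed.

Lemma exists_exp_large (C gap a : R) : 0 < gap -> 0 < a ->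
  exists N : R, 0 < N /\ forall L, N <= L -> C <= gap * expR (a * L).
Proof.
move=> gap0 a0; exists (`|C| / (gap * a) + 1); split.
  by rewrite ltr_wpDl// divr_ge0// mulr_ge0 ?ltW.
move=> L NL.
have : `|C| <= gap * a * L.
  rewrite -ler_pdivrMl ?mulr_gt0// mulrC (le_trans _ NL)// lerDl//.
have : gap * (1 + a * L) <= gap * expR (a * L) by rewrite ler_pM2l// expR_ge1Dx.
have := ler_norm C.
rewrite mulrDr mulr1 mulrA; lra.
Qed.

Lemma exists_pos_lower (I : finType) (f : I -> R) : (forall i, 0 < f i) ->
  exists c : R, [/\ 0 < c, c <= 1 & forall i, c <= f i].
Proof.
move=> f0; exists (\big[Order.min/1]_i f i); split.
- by apply/bigmin_gtP; split => // i _.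
- exact: bigmin_le_id.
- by move=> i; exact: bigmin_le_cond.
Qed.

End small_large.

(** * Lattice paths made of unit vectors *)

Section lattice_l1.
Context {d : nat}.
Implicit Types w y : 'rV[int]_d.

Definition l1 w : nat := (\sum_i absz (w 0%R i))%N.

Definition uvec (b : bool) (i : 'I_d) : 'rV[int]_d :=
  (if b then -1 else 1) *: delta_mx 0 i.

(** Every [w] is reached from 0 by unit steps that each increase the l1 norm, so a hypothesis valid
    on a ball holds along the whole path. *)
Lemma l1_ind (P : 'rV[int]_d -> Prop) : P 0 ->
  (forall w b i, l1 (w + uvec b i) = (l1 w).+1 -> P w -> P (w + uvec b i)) ->
  forall w, P w.
Proof.
move=> P0 PS w; move nE : (l1 w) => n; elim: n w nE => [|n ih] w nE.
  suff -> : w = 0 by [].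
  apply/rowP => i; rewrite mxE; apply/eqP; rewrite -absz_eq0.
  by move/eqP: nE; rewrite sum_nat_eq0 => /forallP/(_ i).
have [i wi] : exists i, w 0 i != 0.
  apply/existsP; rewrite -negb_forall; apply/negP => /forallP w0.
  by move: nE; rewrite /l1 big1// => i _; rewrite (eqP (w0 i)).
pose b := (w 0 i < 0)%R.
have eqw : w = (w - uvec b i) + uvec b i by rewrite subrK.
have l1w : l1 w = (l1 (w - uvec b i)).+1.
  rewrite /l1 (bigD1 i)//= [in RHS](bigD1 i)//=.
  rewrite (eq_bigr (fun j => absz ((w - uvec b i)%R 0%R j))) => [|j ji].
    by rewrite !mxE !eqxx/= /b; case: ltP => h; move: wi h; lia.
  by rewrite !mxE (negPf ji)/= mulr0 subr0.
rewrite eqw; apply: PS; first by rewrite -eqw.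
by apply: ih; move: nE; rewrite l1w => -[].
Qed.

Lemma absz_le_l1 w i : (absz (w 0%R i) <= l1 w)%N.
Proof. by rewrite /l1 (bigD1 i)//= leq_addr. Qed.

Lemma l1N w : l1 (- w) = l1 w.
Proof. by apply: eq_bigr => i _; rewrite !mxE abszN. Qed.

Lemma norm_coord_le_l1 (R : realType) w i : `|(w 0 i)%:~R| <= (l1 w)%:R :> R.
Proof. by rewrite -intr_norm -abszE -[_%:~R]/(absz (w 0%R i))%:R ler_nat absz_le_l1. Qed.

Lemma l1_le (R : realType) w (c : R) :
  (forall i, `|(w 0 i)%:~R| <= c) -> (l1 w)%:R <= d%:R * c.
Proof.
move=> wc; rewrite natr_sum mulr_natl -[d in leRHS]card_ord -sumr_const.
apply: ler_sum => i _; apply: le_trans (wc i).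
by rewrite -intr_norm -abszE.
Qed.

End lattice_l1.

(** * Bounds on the Green function of a walk with drift *)

Section drifting_walk.
Context {R : realType} {d : nat}.
Variables (m : 'rV[int]_d -> R) (i0 : 'I_d) (kap C s0 : R) (q : 'I_d -> R).
Hypothesis m0 : forall z, 0 <= m z.
Hypothesis m1 : \esum_(z in setT) (m z)%:E = 1%E.
Hypothesis kap0 : 0 < kap.
Hypothesis C0 : 0 <= C.
Hypothesis s00 : 0 < s0.
Hypothesis q0 : forall i, 0 < q i.
Hypothesis q1 : forall i, q i <= 1.

Definition axis (s : R) (i : 'I_d) (z : 'rV[int]_d) : R := expR (s * (z 0 i)%:~R).

(** The quantitative input on the law: the linear term says that the drift is [kap] times [q], the
    quadratic one replaces second moments. *)
Hypothesis mgf : forall i s, `|s| <= s0 ->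
  (\esum_(z in setT) (m z * axis s i z)%:E <=
     (1 + s * (kap * q i) + C * s ^+ 2)%:E)%E.
Hypothesis irr : forall b i, exists s,
  path (fun y z => 0 < m (z - y)) 0 s /\ last 0 s = uvec b i.

Lemma axis_ge0 s i z : 0 <= axis s i z. Proof. exact: expR_ge0. Qed.
Lemma axis0 s i : axis s i 0 = 1.
Proof. by rewrite /axis mxE mulr0 expR0. Qed.
Lemma axisD s i x y : axis s i (x + y) = axis s i x * axis s i y.
Proof. by rewrite /axis mxE rmorphD mulrDr expRD. Qed.

(** Positivity of the drift enters here: for a small negative exponent the quadratic term is at most
    half of the linear one, so the mass falls below 1 by an amount linear in [r]. *)
Lemma mgf_neg : exists r0 c : R, [/\ 0 < r0, r0 <= s0, 0 < c & forall i r, 0 < r <= r0 ->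
  (\esum_(z in setT) (m z * axis (- r) i z)%:E <= (1 - c * r)%:E)%E].
Proof.
have [qm [qm0 _ qmle]] := exists_pos_lower q0.
have gap : 0 < kap * (qm / 2) by rewrite !mulr_gt0// invr_gt0.
have [r0 [r00 r0s r0C]] := exists_small C gap s00.
exists r0, (kap * qm / 2); split => //; first by rewrite divr_gt0// mulr_gt0.
move=> i r /andP[rgt0 rle].
have rs : `|- r| <= s0 by rewrite normrN gtr0_norm// (le_trans rle).
apply: (le_trans (mgf i rs)); rewrite lee_fin sqrrN expr2.
have h1 : r * C <= r0 * C by rewrite ler_wpM2r.
have h2 : r * (kap * qm) <= r * (kap * q i) by rewrite !ler_pM2l.
have h3 : r * (r * C) <= r * (kap * (qm * 2^-1)).
  by rewrite ler_pM2l// ltW// (le_lt_trans h1).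
lra.
Qed.

(** This is also transience, since it makes the Green function finite. The rate [r] can be taken
    arbitrarily small at the price of [D]. *)
Lemma cgreen_le_axis : exists r0 : R, 0 < r0 /\ forall r, 0 < r <= r0 ->
  exists D : R, 0 < D /\ forall w i, (cgreen m w <= (D * axis r i w)%:E)%E.
Proof.
have [r0 [c [r00 _ c0 h]]] := mgf_neg.
exists r0; split => // r /andP[rgt0 rle]; exists (c * r)^-1; split.
  by rewrite invr_gt0 mulr_gt0.
move=> w i.
have := @cgreen_mass_le R _ m (axis (- r) i) (1 - c * r) w m0 (axis_ge0 _ _) (axis0 _ _)
  (axisD _ _) (h i r _) _.
rewrite rgt0 rle => /(_ isT); rewrite subKr gtrBl mulr_gt0// => /(_ isT) le.
have axisN : axis (- r) i w * axis r i w = 1.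
  by rewrite /axis -expRD mulNr addNr expR0.
rewrite -[leLHS]mule1 -axisN EFinM muleA EFinM.
by apply: lee_wpmul2r; rewrite ?lee_fin ?axis_ge0.
Qed.

Definition G w : R := fine (cgreen m w).

Lemma cgreenE w : cgreen m w = (G w)%:E.
Proof.
have [r0 [r00 h]] := cgreen_le_axis.
have [D [_ /(_ w i0) le]] := h r0 (introT andP (conj r00 (lexx _))).
rewrite fineK// ge0_fin_numE ?cgreen_ge0//.
by apply: (le_lt_trans le); rewrite ltry.
Qed.

Lemma G_ge0 w : 0 <= G w.
Proof. by rewrite -lee_fin -cgreenE cgreen_ge0. Qed.

Lemma G_le_axis : exists r0 : R, 0 < r0 /\ forall r, 0 < r <= r0 ->
  exists D : R, 0 < D /\ forall w i, G w <= D * axis r i w.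
Proof.
have [r0 [r00 h]] := cgreen_le_axis; exists r0; split => // r /h[D [D0 le]].
by exists D; split => // w i; rewrite -lee_fin -cgreenE.
Qed.

Lemma G_shift w e : m e * G w <= G (w + e).
Proof. by rewrite -lee_fin EFinM -!cgreenE cgreen_shift_ge. Qed.

Lemma G_path s : path (fun y z => 0 < m (z - y)) 0 s ->
  exists k : R, 0 < k /\ forall w, k * G w <= G (w + last 0 s).
Proof.
suff: forall y, path (fun y z => 0 < m (z - y)) y s ->
  exists k : R, 0 < k /\ forall w, k * G (w + y) <= G (w + last y s).
  by move=> h /(h 0)[k [k0 hk]]; exists k; split => // w; have := hk w; rewrite addr0.
elim: s => [|x s ih] y /=; first by exists 1; split => // w; rewrite mul1r.
move=> /andP[mx /ih[k [k0 h]]]; exists (k * m (x - y)); split; first by rewrite mulr_gt0.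
move=> w; apply: le_trans (h w); rewrite -mulrA ler_pM2l//.
by apply: (le_trans (G_shift _ _)); rewrite -addrA (addrC y) subrK.
Qed.

Lemma G_unit_steps : exists k : R, [/\ 0 < k, k <= 1 & forall w b i, k * G w <= G (w + uvec b i)].
Proof.
have h (p : bool * 'I_d) : exists k : R, 0 < k /\ forall w, k * G w <= G (w + uvec p.1 p.2).
  by have [s [ps <-]] := irr p.1 p.2; exact: G_path.
have [f fP] := choice h.
have [k [k0 k1 kf]] := exists_pos_lower (fun p => (fP p).1).
exists k; split => // w b i; apply: le_trans ((fP (b, i)).2 w).
by rewrite ler_wpM2r// ?G_ge0.
Qed.

(** A crude loss per unit of distance; it is applied only across gaps that are a small fraction of
    L. *)
Lemma G_lower_l1 : exists k : R, [/\ 0 < k, k <= 1 & forall w, k ^+ l1 w <= G w].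
Proof.
have [k [k0 k1 h]] := G_unit_steps; exists k; split => //.
apply: l1_ind => [|w b i -> kw].
  have -> : l1 (0 : 'rV[int]_d) = 0%N by rewrite /l1 big1// => i _; rewrite mxE.
  by rewrite expr0 -lee_fin -cgreenE cgreen0_ge1.
by apply: le_trans (h w b i); rewrite exprS ler_pM2l.
Qed.

Lemma G_gt0 w : 0 < G w.
Proof.
by have [k [k0 _ h]] := G_lower_l1; apply: lt_le_trans (h w); rewrite exprn_gt0.
Qed.

Lemma cpow_total n : \esum_(z in setT) cpow m n z = 1%E.
Proof.
have := @cpow_mass R _ m (fun=> 1) n m0 (fun=> ler01) erefl.
rewrite mulr1 => /(_ (fun _ _ => erefl)).
rewrite (_ : \esum_(z in setT) (m z * 1)%:E = 1%E); last first.
  by rewrite -m1; apply: esumT_eq => z; rewrite mulr1.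
rewrite -[(1 ^+ n)%E]EFin_expe expr1n => <-; by apply: esumT_eq => z; rewrite mule1.
Qed.

Definition in_box (t : nat) (eps : R) (z : 'rV[int]_d) : bool :=
  [forall i, `|(z 0 i)%:~R - t%:R * (kap * q i)| <= eps * t%:R].

(** Chernoff bounds in the 2d signed coordinate directions: the complement of the box has mass at
    most 2d exp(-a t). *)
Lemma wlln (eps : R) : 0 < eps -> exists t0 : R, forall t, t0 <= t%:R ->
  ((2^-1)%:E <= \esum_(z in setT) (if in_box t eps z then cpow m t z else 0))%E.
Proof.
move=> eps0; have [s [sgt0 ss0 sC]] := exists_small C eps0 s00.
(* The Chernoff exponent: the deviation gains s eps per unit of time, the quadratic term of [mgf]
   loses C s^2. *)
pose a := s * (eps - s * C).
have a0 : 0 < a by rewrite mulr_gt0// subr_gt0.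
(* 4 d <= exp(a t) makes the 2 d tails together at most 1/2. *)
have [N [N0 hN]] := exists_exp_large (4 * d%:R) ltr01 a0.
exists N => t /hN; rewrite mul1r => ht.
pose sg (b : bool) : R := if b then - s else s.
(* Normalized so that the weight [axis] times [cst] is at least 1 outside the box on the side [p],
   which makes the union bound pointwise. *)
pose cst (p : bool * 'I_d) : R :=
  expR (- (sg p.1 * (t%:R * (kap * q p.2))) - s * eps * t%:R).
have c0 z : (0 <= cpow m t z)%E by exact: cpow_ge0.
set P := (X in (_ <= X)%E).
have bound p : (\esum_(z in setT) (cpow m t z * (axis (sg p.1) p.2 z * cst p)%:E) <=
    (expR (- a * t%:R))%:E)%E.
  have nsg : `|sg p.1| <= s0 by rewrite /sg; case: p.1; rewrite ?normrN gtr0_norm.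
  have sg2 : sg p.1 ^+ 2 = s ^+ 2 by rewrite /sg; case: p.1; rewrite ?sqrrN.
  pose u := sg p.1 * (kap * q p.2) + C * s ^+ 2.
  have mu : (\esum_(z in setT) (m z * axis (sg p.1) p.2 z)%:E <= (expR u)%:E)%E.
    apply: (le_trans (mgf p.2 nsg)); rewrite lee_fin sg2 -addrA.
    exact: expR_ge1Dx.
  have := cpow_mass_le t m0 (axis_ge0 _ _) (axis0 _ _) (axisD _ _) mu.
  rewrite -expRM_natl => le.
  rewrite (eq_esum (b := fun z => (cpow m t z * (axis (sg p.1) p.2 z)%:E * (cst p)%:E)%E)); last first.
    by move=> z _; rewrite EFinM muleA.
  rewrite esumZr ?lee_fin ?expR_ge0//; last by move=> z; rewrite mule_ge0// lee_fin axis_ge0.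
  apply: (@le_trans _ _ ((expR (t%:R * u))%:E * (cst p)%:E)%E).
    by apply: lee_wpmul2r; rewrite ?lee_fin ?expR_ge0.
  rewrite -EFinM lee_fin /cst -expRD ler_expR /u /a.
  by rewrite le_eqVlt; apply/orP; left; apply/eqP; ring.
have le1 : (1 <= P + \sum_(p : bool * 'I_d) (expR (- a * t%:R))%:E)%E.
  rewrite -(cpow_total t).
  apply: (@le_trans _ _ (P + \sum_(p : bool * 'I_d) \esum_(z in setT)
    (cpow m t z * (axis (sg p.1) p.2 z * cst p)%:E))%E); last first.
    by apply: leeD => //; apply: lee_sum => p _; exact: bound.
  rewrite -esum_sum; last by move=> z p _ _; rewrite mule_ge0// lee_fin mulr_ge0 ?expR_ge0.
  have nn2 z : (0 <= \sum_(p : bool * 'I_d) cpow m t z * (axis (sg p.1) p.2 z * cst p)%:E)%E.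
    by apply: sume_ge0 => p _; rewrite mule_ge0// lee_fin mulr_ge0 ?expR_ge0.
  rewrite -esumD//; last by move=> z _; case: ifP.
  apply: esumT_le => z; case: ifPn => [_|]; first by rewrite leeDl.
  rewrite negb_forall => /existsP[i]; rewrite -ltNge => far; rewrite add0e.
  pose p : bool * 'I_d := ((z 0 i)%:~R - t%:R * (kap * q i) < 0, i).
  rewrite (bigD1 p)//= -[leLHS]adde0; apply: leeD; last first.
    by apply: sume_ge0 => p' _; rewrite mule_ge0// lee_fin mulr_ge0 ?expR_ge0.
  rewrite -[leLHS]mule1; apply: lee_wpmul2l => //.
  rewrite lee_fin /axis /cst -expRD -[leLHS]expR0 ler_expR /p/= /sg.
  case: (ltP ((z 0 i)%:~R - t%:R * (kap * q i)) 0) far => h.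
    rewrite ltr0_norm// -(ltr_pM2l sgt0); lra.
  rewrite ger0_norm// -(ltr_pM2l sgt0); lra.
move: le1; rewrite sumEFin sumr_const card_prod card_bool card_ord.
set e := expR _ *+ _.
have e_le : e <= 2^-1.
  rewrite /e -(mulr_natl (expR _)) natrM mulNr expRN ler_pdivrMr ?expR_gt0//.
  lra.
rewrite -leeBlDr// => le; apply: le_trans le.
by rewrite -EFinB lee_fin; lra.
Qed.

Definition near_ray (dl L : R) (y : 'rV[int]_d) : Prop :=
  forall i, `|(y 0 i)%:~R - L * q i| <= dl * L.

Lemma near_ray_le dl dl' L y : 0 <= L -> dl <= dl' -> near_ray dl L y -> near_ray dl' L y.
Proof. by move=> L0 le h i; apply: le_trans (h i) _; rewrite ler_wpM2r. Qed.

Lemma near_ray_add dl dl' L y w : near_ray dl L y -> (l1 w)%:R <= dl' * L ->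
  near_ray (dl + dl') L (y + w).
Proof.
move=> h wL i; rewrite mxE rmorphD/= addrAC mulrDl.
apply: (le_trans (ler_normD _ _)); apply: lerD; first exact: h.
exact: le_trans (norm_coord_le_l1 _ _ _) wL.
Qed.

(** At a time t close to L / kap the walk is near L q with probability at least 1/2, hence at a
    distance of order rho L from y; the crude bound [G_lower_l1] covers this gap. *)
Lemma G_lower_ray (eta : R) : 0 < eta -> exists dl N : R, [/\ 0 < dl, 0 < N &
  forall L y, N <= L -> near_ray dl L y -> expR (- eta * L) <= G y].
Proof.
move=> eta0; have [k [k0 k1 hk]] := G_lower_l1.
pose kk := - ln k.
have kk0 : 0 <= kk by rewrite oppr_ge0 ln_le0.
have kE : k = expR (- kk) by rewrite opprK lnK.
have eta20 : 0 < eta / 2 by rewrite divr_gt0.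
(* A coordinate of y - z is at most 3 rho L: one rho L each for y, for z and for the rounding of t.
   This explains d * 3. *)
have [rho [rho0 _ hrho]] := exists_small (kk * (d%:R * 3)) eta20 ltr01.
have [t0 ht0] := wlln (mulr_gt0 rho0 kap0).
have [N1 [N10 hN1]] := exists_exp_large 2 ltr01 eta20.
(* In turn: exp(eta L / 2) >= 2 absorbs the probability 1/2, the rounding error [kap] is at most rho
   L, and t >= t0. *)
pose N := Num.max N1 (Num.max (kap / rho) ((`|t0| + 1) * kap)).
have N0 : 0 < N by rewrite !lt_max N10.
exists rho, N; split => // L y; rewrite !ge_max => /and3P[NL1 NL2 NL3] near_y.
have L0 : 0 < L by rewrite (lt_le_trans N10).
pose t := Num.truncn (L / kap).
have Lk0 : 0 <= L / kap by rewrite divr_ge0 ?ltW.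
have /andP[tle tgt] : t%:R <= L / kap < t.+1%:R by rewrite truncn_itv.
have tk : t%:R * kap <= L by rewrite -ler_pdivlMr.
have tk2 : L < t%:R * kap + kap by move: tgt; rewrite ltr_pdivrMr// -natr1 mulrDl mul1r.
have rL : kap <= rho * L by rewrite -ler_pdivrMl// mulrC.
have tt0 : t0 <= t%:R.
  have h1 : `|t0| + 1 < t.+1%:R by rewrite (le_lt_trans _ tgt)// ler_pdivlMr.
  by move: h1 (ler_norm t0); rewrite -natr1; lra.
rewrite -lee_fin -cgreenE.
apply: le_trans (cpow_cgreen_le t y m0).
apply: (@le_trans _ _ (\esum_(z in setT) ((if in_box t (rho * kap) z then cpow m t z else 0) *
    (expR (- (eta / 2) * L))%:E))%E).
  rewrite esumZr ?lee_fin ?expR_ge0//; last by move=> z; case: ifP => // _; exact: cpow_ge0.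
  apply: (@le_trans _ _ ((2^-1)%:E * (expR (- (eta / 2) * L))%:E)%E); last first.
    by apply: lee_wpmul2r; rewrite ?lee_fin ?expR_ge0//; exact: ht0.
  rewrite -EFinM lee_fin.
  have -> : - eta * L = - (eta / 2) * L - eta / 2 * L by field.
  rewrite expRD mulrC ler_wpM2r ?expR_ge0//.
  by rewrite expRN lef_pV2 ?posrE ?expR_gt0//; have := hN1 _ NL1; rewrite mul1r.
apply: esumT_le => z; case: ifPn => [/forallP zb|_]; last first.
  by rewrite mul0e mule_ge0 ?cpow_ge0// cgreen_ge0.
apply: lee_wpmul2l; first exact: cpow_ge0.
rewrite cgreenE lee_fin; apply: le_trans (hk _).
rewrite kE -expRM_natl ler_expR.
have : (l1 (y - z))%:R <= d%:R * (3 * rho * L).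
  apply: l1_le => i; rewrite !mxE rmorphD rmorphN/=.
  have h1 := near_y i; have h2 := zb i.
  have h3 : rho * (t%:R * kap) <= rho * L by rewrite ler_pM2l.
  have h4 : `|L * q i - t%:R * (kap * q i)| <= kap.
    have -> : L * q i - t%:R * (kap * q i) = (L - t%:R * kap) * q i by ring.
    rewrite ger0_norm; last by rewrite mulr_ge0 ?subr_ge0// ltW.
    rewrite -[leRHS]mulr1; apply: ler_pM => //; [by rewrite subr_ge0|exact: ltW|lra].
  move: h1 h2 h4; rewrite !ler_norml => /andP[? ?] /andP[? ?] /andP[? ?].
  by apply/andP; split; lra.
move=> le.
have : kk * (l1 (y - z))%:R <= kk * (d%:R * (3 * rho * L)) by rewrite ler_wpM2l.
have : rho * (kk * (d%:R * 3)) * L <= eta / 2 * L by rewrite ler_pM2r// ltW.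
lra.
Qed.

(* P holds near infinity along the ray R_+ q: as dl decreases, the aperture of
   the cone around the ray shrinks while the required distance 1/dl grows. *)
Definition along_ray (P : R -> 'rV[int]_d -> Prop) : Prop := exists dl : R,
  0 < dl /\ forall L y, 1 <= dl * L -> near_ray dl L y -> P L y.

Lemma along_rayI (dl N : R) P : 0 < dl -> 0 < N ->
  (forall L y, N <= L -> near_ray dl L y -> P L y) -> along_ray P.
Proof.
move=> dl0 N0 h; exists (Num.min dl N^-1); split.
  by rewrite lt_min dl0 invr_gt0.
move=> L y mL near_y.
have L0 : 0 < L.
  have : 0 < Num.min dl N^-1 by rewrite lt_min dl0 invr_gt0.
  by move=> /pmulr_rgt0 <-; rewrite (lt_le_trans _ mL).
apply: h; last by apply: near_ray_le near_y; [exact: ltW|rewrite ge_min lexx].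
rewrite -[leLHS]mulr1 -ler_pdivlMl//; apply: (le_trans mL).
by rewrite ler_pM2r// ge_min lexx orbT.
Qed.

Lemma along_ray_imp P Q : (forall L y, 0 < L -> P L y -> Q L y) ->
  along_ray P -> along_ray Q.
Proof.
move=> PQ [dl [dl0 h]]; exists dl; split => // L y dL near_y.
apply: PQ (h _ _ dL near_y).
by rewrite -(pmulr_rgt0 _ dl0) (lt_le_trans _ dL).
Qed.

Lemma along_ray_le dl dl' L y (P : R -> 'rV[int]_d -> Prop) : 0 < dl -> dl <= dl' ->
  (forall L y, 1 <= dl' * L -> near_ray dl' L y -> P L y) ->
  1 <= dl * L -> near_ray dl L y -> P L y.
Proof.
move=> dl0 le h dL near_y.
have L0 : 0 < L by rewrite -(pmulr_rgt0 _ dl0) (lt_le_trans _ dL).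
apply: h; last by apply: near_ray_le near_y; [exact: ltW|].
by apply: (le_trans dL); rewrite ler_pM2r.
Qed.

Lemma along_ray_forall (I : finType) (P : I -> R -> 'rV[int]_d -> Prop) :
  (forall i, along_ray (P i)) -> along_ray (fun L y => forall i, P i L y).
Proof.
move=> h; have [f fP] := choice h.
have [dl [dl0 _ dlf]] := exists_pos_lower (fun i => (fP i).1).
exists dl; split => // L y dL near_y i.
exact: (along_ray_le dl0 (dlf i) (fP i).2).
Qed.

Lemma along_ray_and P Q : along_ray P -> along_ray Q ->
  along_ray (fun L y => P L y /\ Q L y).
Proof.
move=> hP hQ.
have [|dl [dl0 h]] := @along_ray_forall bool (fun b => if b then P else Q).
  by case.
exists dl; split => // L y dL near_y.
have hb := h L y dL near_y.
by split; [exact: (hb true)|exact: (hb false)].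
Qed.

Lemma along_ray_large (C1 gap a : R) : 0 < gap -> 0 < a ->
  along_ray (fun L _ => C1 <= gap * expR (a * L)).
Proof.
move=> gap0 a0; have [N [N0 h]] := exists_exp_large C1 gap0 a0.
by apply: (along_rayI ltr01 N0) => L y /h.
Qed.

Lemma along_ray_near dl : 0 < dl -> along_ray (near_ray dl).
Proof. by move=> dl0; apply: (along_rayI dl0 ltr01). Qed.

(** Halving the aperture leaves room for shifts of length a fixed fraction of L, and not only for
    bounded shifts. *)
Lemma along_ray_shift P : along_ray P -> exists dl : R, 0 < dl /\
  along_ray (fun L y => forall w, (l1 w)%:R <= dl * L -> P L (y + w)).
Proof.
move=> [dl [dl0 h]]; exists (dl / 2); split; first by rewrite divr_gt0.
exists (dl / 2); split; first by rewrite divr_gt0.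
move=> L y dL near_y w wL.
have L0 : 0 < L.
  have : 0 < dl / 2 by rewrite divr_gt0.
  by move=> /pmulr_rgt0 <-; rewrite (lt_le_trans _ dL).
apply: h; last by rewrite (splitr dl); exact: near_ray_add.
by apply: (le_trans dL); rewrite ler_pM2r//; lra.
Qed.

(** * Ratios of the Green function near the ray *)

Lemma G_lower_along (eta : R) : 0 < eta ->
  along_ray (fun L y => expR (- eta * L) <= G y).
Proof. by move=> /G_lower_ray[dl [N [dl0 N0 h]]]; exact: along_rayI h. Qed.

(** The upper half of G(y + e) / G(y) --> 1. It is stable under addition of shifts; the lower half
    for e is the upper half for -e. *)
Definition tame (e : 'rV[int]_d) : Prop := forall eps : R, 0 < eps ->
  along_ray (fun L y => G (y + e) <= expR eps * G y).

Lemma tame0 : tame 0.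
Proof.
move=> eps eps0; apply: (along_rayI ltr01 ltr01) => L y _ _.
by rewrite addr0 ler_peMl ?G_ge0// expR_ge1// ltW.
Qed.

Lemma tameD e f : tame e -> tame f -> tame (e + f).
Proof.
move=> he hf eps eps0; have eps20 : 0 < eps / 2 by rewrite divr_gt0.
have [dl [dl0 hs]] := along_ray_shift (hf _ eps20).
have hL : along_ray (fun L _ => (l1 e)%:R <= dl * L).
  have N0 : 0 < (l1 e)%:R / dl + 1 by rewrite ltr_wpDl// divr_ge0// ltW.
  apply: (along_rayI ltr01 N0) => L y NL _.
  by rewrite mulrC -ler_pdivrMr// (le_trans _ NL)// lerDl.
apply: along_ray_imp (along_ray_and (along_ray_and (he _ eps20) hs) hL).
move=> L y _ [[h1 h2] h3]; rewrite addrA.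
apply: (le_trans (h2 e h3)).
have -> : expR eps = expR (eps / 2) * expR (eps / 2) by rewrite -expRD -splitr.
rewrite -mulrA; by rewrite ler_pM2l ?expR_gt0.
Qed.

(** [K] lies strictly between 1 and exp(eps): the excess over 1 makes the atypical paths
    exponentially rare, and the gap to exp(eps) leaves room for them. The tilt [s] along axis [i0]
    converts a mass below 1 into decay in y. *)
Lemma tame_step e : 0 < m e -> tame e.
Proof.
move=> v0 eps eps0; set v := m e in v0 *.
pose K := expR (eps / 2).
have K1 : 1 < K by rewrite -expR0 ltr_expR divr_gt0.
have K0 : 0 < K by rewrite (lt_trans ltr01).
have gap0 : 0 < expR eps - K by rewrite subr_gt0 ltr_expR ltr_pdivrMr// ltr_pMr// ltr1n.
(* The condition for a mass below 1 is sig < 1 - eta. Since sig <= 1 / (1 + eta K), it holds because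
   (1 - eta)(1 + eta K) = 1 + (K - 1)^2 / (4 K) for this [eta]. *)
pose eta := (K - 1) / (2 * K).
have eta0 : 0 < eta by rewrite divr_gt0 ?subr_gt0// mulr_gt0.
pose c := expR (eta * v); pose sig := expR (- eta * K).
have c0 : 0 < c by exact: expR_gt0.
have sig0 : 0 < sig by exact: expR_gt0.
have sig1 : sig < 1 - eta.
  have etaK : eta * K = (K - 1) / 2 by rewrite /eta; field; rewrite gt_eqF.
  have : sig <= (1 + eta * K)^-1.
    rewrite /sig mulNr expRN lef_pV2 ?posrE ?expR_gt0//; last by rewrite etaK; lra.
    exact: expR_ge1Dx.
  move=> /le_lt_trans; apply; rewrite etaK -[ltLHS]mul1r ltr_pdivrMr; last by lra.
  have -> : (1 - eta) * (1 + (K - 1) / 2) = 1 + (K - 1) ^+ 2 / (4 * K).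
    by rewrite /eta; field; rewrite gt_eqF.
  rewrite ltrDl; apply: divr_gt0; last by rewrite mulr_gt0.
  by rewrite exprn_gt0// subr_gt0.
(* f0 is the mass of the reweighted measure; the tilt s below keeps it < 1 *)
pose f0 := c * (1 - (1 - sig) * v).
have f01 : f0 < 1.
  apply: (@le_lt_trans _ _ (c * expR (- ((1 - sig) * v)))).
    by rewrite ler_pM2l// expR_ge1Dx.
  rewrite /c -expRD -[ltRHS]expR0 ltr_expR.
  have : 0 < (1 - eta - sig) * v by rewrite mulr_gt0// subr_gt0.
  lra.
pose ei : R := `|(e 0 i0)%:~R|.
(* [D] bounds the change of mass per unit of [s], with s^2 <= s; its last term comes from exp(s
   e_i0) >= 1 - s |e_i0|. *)
pose D := c * (kap * q i0 + C + (1 - sig) * v * ei).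
have min0 : 0 < Num.min s0 1 by rewrite lt_min s00 ltr01.
have gapf : 0 < 1 - f0 by rewrite subr_gt0.
have [s [sgt0]] := exists_small D gapf min0.
rewrite le_min => /andP[ss0 s1] sD.
pose lam := reweight m e c sig.
have lam0 z : 0 <= lam z by apply: reweight_ge0; rewrite // ltW.
pose r := f0 + s * D.
have r1 : r < 1 by rewrite /r; lra.
have vsig0 : 0 < (1 - sig) * v by rewrite mulr_gt0// subr_gt0; lra.
have lam_mass : (\esum_(z in setT) (lam z * axis s i0 z)%:E <= r%:E)%E.
  have cv0 : 0 <= c * ((1 - sig) * v) by apply: mulr_ge0; exact: ltW.
  (* The reweighted measure is c m minus an atom at [e]; the atom is added on the left to avoid a
     difference of sums. *)
  have eqm : (\esum_(z in setT) (lam z * axis s i0 z)%:E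
     + (c * ((1 - sig) * v) * axis s i0 e)%:E =
     c%:E * \esum_(z in setT) (m z * axis s i0 z)%:E)%E.
    rewrite -esumZl ?lee_fin ?(ltW c0)//; last by move=> z; rewrite lee_fin mulr_ge0 ?axis_ge0.
    rewrite (_ : (c * ((1 - sig) * v) * axis s i0 e)%:E = \esum_(z in setT)
      (if z == e then (c * ((1 - sig) * v) * axis s i0 z)%:E else 0)%E); last first.
      rewrite (@esum_supp1 _ _ _ e) ?eqxx// => [t /negPf ->//|].
      by rewrite lee_fin mulr_ge0 ?axis_ge0.
    rewrite -esumD; last 2 first.
    - by move=> z _; rewrite lee_fin mulr_ge0 ?axis_ge0.
    - by move=> z _; case: ifP => // _; rewrite lee_fin mulr_ge0 ?axis_ge0.
    apply: esumT_eq => z; rewrite /lam /reweight; case: ifPn => [/eqP ->|_].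
      by rewrite -EFinD -EFinM; congr (_%:E); rewrite -/v; ring.
    by rewrite adde0 -EFinM mulrA.
  have ns : `|s| <= s0 by rewrite gtr0_norm.
  have le : (\esum_(z in setT) (lam z * axis s i0 z)%:E
     + (c * ((1 - sig) * v) * axis s i0 e)%:E <= (c * (1 + s * (kap * q i0) + C * s ^+ 2))%:E)%E.
    by rewrite eqm EFinM; apply: lee_wpmul2l; rewrite ?lee_fin ?(ltW c0)//; exact: mgf.
  have le2 : 1 - s * ei <= axis s i0 e.
    apply: le_trans (expR_ge1Dx _).
    by rewrite lerD2l -mulrN ler_pM2l// lerNl /ei -normrN ler_norm.
  move: le; rewrite -leeBrDr// => /le_trans; apply.
  rewrite -EFinB lee_fin /r /D /f0 expr2.
  have h1 : (c * ((1 - sig) * v)) * (1 - s * ei) <= c * ((1 - sig) * v) * axis s i0 e.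
    by rewrite ler_wpM2l// mulr_ge0// ltW.
  have h2 : c * (C * (s * s)) <= c * (C * s).
    by rewrite ler_wpM2l ?(ltW c0)// ler_wpM2l// ler_piMl// ltW.
  lra.
pose C1 := (1 - r)^-1 / axis s i0 e.
(* Near the ray y_i0 >= L q_i0 / 2, so the tilt gains exp(2 a L); the lower bound on G(y) costs
   exp(a L) and the remaining exp(a L) absorbs [C1]. *)
pose a := s * q i0 / 4.
have a0 : 0 < a by rewrite divr_gt0// mulr_gt0.
have q20 : 0 < q i0 / 2 by rewrite divr_gt0.
apply: along_ray_imp (along_ray_and (along_ray_and (G_lower_along a0)
  (along_ray_large C1 gap0 a0)) (along_ray_near q20)).
move=> L y L0 [[hG hL] hnear].
have := @cgreen_ratio R _ m e m0 K eta y (ltW K0) (ltW eta0).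
rewrite -/lam !cgreenE => le.
rewrite -lee_fin; apply: (le_trans le).
have ax0 w : 0 < axis s i0 w by exact: expR_gt0.
have h1 : (cgreen lam (y + e) <= (C1 * (axis s i0 y)^-1)%:E)%E.
  have := cgreen_mass_le (y + e) lam0 (axis_ge0 _ _) (axis0 _ _) (axisD _ _) lam_mass r1.
  rewrite axisD -lee_pdivlMr ?mulr_gt0// -EFinM.
  by move=> /le_trans; apply; rewrite lee_fin /C1 invfM mulrA mulrAC.
apply: (@le_trans _ _ (K%:E * (G y)%:E + ((expR eps - K) * G y)%:E)%E); last first.
  by rewrite -EFinM -EFinD lee_fin; lra.
apply: leeD => //; apply: (le_trans h1); rewrite lee_fin.
apply: (@le_trans _ _ ((expR eps - K) * expR (- a * L))); last by rewrite ler_pM2l.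
have : axis s i0 y >= expR (2 * (a * L)).
  rewrite /axis ler_expR /a.
  have := hnear i0; rewrite ler_norml => /andP[+ _] => h.
  have : s * (q i0 / 2 * L) <= s * (y 0 i0)%:~R by rewrite ler_pM2l//; lra.
  by move=> /(le_trans _); apply; rewrite le_eqVlt; apply/orP; left; apply/eqP; field.
move=> ax; rewrite ler_pdivrMr//.
apply: (@le_trans _ _ ((expR eps - K) * expR (- a * L) * expR (2 * (a * L)))).
  rewrite -mulrA -expRD.
  by have -> : - a * L + 2 * (a * L) = a * L by ring.
by rewrite ler_wpM2l// mulr_ge0 ?expR_ge0// ltW.
Qed.

Lemma tame_unit b i : tame (uvec b i).
Proof.
have [s [ps <-]] := irr b i.
suff: forall y, path (fun y z => 0 < m (z - y)) y s -> tame y -> tame (last y s).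
  by move=> h; apply: h => //; exact: tame0.
elim: s {ps} => [//|x s ih] y /= /andP[mx ps] ty; apply: ih => //.
by rewrite -(subrK y x) addrC; apply: tameD => //; exact: tame_step.
Qed.

Lemma uvecN b (i : 'I_d) : uvec (~~ b) i = - uvec b i.
Proof. by rewrite /uvec; case: b; rewrite /= ?scaleN1r ?scale1r ?opprK. Qed.

(** Induction along a monotone unit path from 0 to w. The second inequality steps back from the new
    point by the opposite unit vector. *)
Lemma G_local (beta : R) : 0 < beta -> exists dl : R, 0 < dl /\
  along_ray (fun L y => forall w, (l1 w)%:R <= dl * L ->
     G (y + w) <= expR (beta * (l1 w)%:R) * G y /\
     G y <= expR (beta * (l1 w)%:R) * G (y + w)).
Proof.
move=> beta0.
have := @along_ray_forall _ _ (fun p : bool * 'I_d => tame_unit p.1 p.2 beta0).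
move=> /along_ray_shift[dl [dl0 h]]; exists dl; split => //.
apply: along_ray_imp h => L y _ h w; move: w.
apply: l1_ind => [_|w b i l1E ih].
  by rewrite addr0; split; rewrite ler_peMl ?G_ge0// expR_ge1// mulr_ge0// ltW.
rewrite l1E => wL; have wL' : (l1 w)%:R <= dl * L.
  by apply: le_trans wL; rewrite ler_nat.
have [ih1 ih2] := ih wL'.
have h1 := h w wL' (b, i).
have h2 : G (y + w) <= expR beta * G (y + w + uvec b i).
  have := h (w + uvec b i); rewrite l1E => /(_ wL (~~ b, i)) /=.
  by rewrite uvecN addrA addrK.
rewrite -natr1 mulrDr mulr1 expRD addrA; split.
  by apply: (le_trans h1); rewrite (mulrC (expR _) (expR beta)) -mulrA ler_pM2l ?expR_gt0.
by apply: (le_trans ih2); rewrite -mulrA ler_pM2l ?expR_gt0.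
Qed.

(** The domination for the exit sum, uniform in all shifts. Short shifts use [G_local]; for long
    ones G(y + w) and G(y) are bounded separately. *)
Lemma G_uniform_ratio (s eps : R) : 0 < s -> 0 < eps ->
  along_ray (fun L y => forall w,
    `|G (y + w) - G y| <= eps * expR (s * (l1 w)%:R) * G y).
Proof.
move=> sgt0 eps0.
have s20 : 0 < s / 2 by rewrite divr_gt0.
(* For exp(x) - 1 <= x exp(x) with x = beta k: the bound eps s / 2 serves the prefactor, the bound s
   / 2 the exponential. *)
pose beta := Num.min (s / 2) (eps * s / 2).
have beta0 : 0 < beta by rewrite lt_min s20 divr_gt0// mulr_gt0.
have [dl [dl0 hloc]] := G_local beta0.
have [r0 [r00 hr]] := G_le_axis.
(* Beyond distance dl L one has s k >= 8 a L. Half of s k absorbs r k; the other half, at least 4 a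
   L, pays a L for 1 / G(y), 2 a L for D / eps, and a L for the growth exp(2 r L). *)
pose a := s * dl / 8.
have a0 : 0 < a by rewrite divr_gt0// mulr_gt0.
pose r := Num.min r0 (Num.min (s / 2) (a / 2)).
have rgt0 : 0 < r by rewrite !lt_min r00 s20 divr_gt0.
have rle : 0 < r <= r0 by rewrite rgt0 ge_min lexx.
have [D [D0 hD]] := hr r rle.
have a20 : 0 < 2 * a by rewrite mulr_gt0.
have a80 : 0 < 8 * a by rewrite mulr_gt0.
apply: along_ray_imp (along_ray_and (along_ray_and (G_lower_along a0) hloc)
  (along_ray_and (along_ray_and (along_ray_large D eps0 a20) (along_ray_large 1 eps0 a80))
  (along_ray_near ltr01))).
move=> L y L0 [[hG hl] [[hDL h1L] hnear]] w.
have Gy := G_ge0 y; have Gyw := G_ge0 (y + w).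
have [wL|wL] := lerP (l1 w)%:R (dl * L).
  have [h1 h2] := hl w wL.
  set k : R := (l1 w)%:R in wL h1 h2 *; have k0 : 0 <= k by rewrite ler0n.
  have e1 : expR (beta * k) - 1 <= eps * expR (s * k).
    have b1 : 1 - expR (- (beta * k)) <= beta * k.
      by have := expR_ge1Dx (- (beta * k)); lra.
    have b2 : expR (beta * k) - 1 <= beta * k * expR (beta * k).
      have -> : expR (beta * k) - 1 = (1 - expR (- (beta * k))) * expR (beta * k).
        by rewrite mulrBl mul1r -expRD addNr expR0.
      by rewrite ler_pM2r ?expR_gt0.
    have b3 : s / 2 * k <= expR (s / 2 * k) by have := expR_ge1Dx (s / 2 * k); lra.
    apply: (le_trans b2).
    have bs : beta <= s / 2 by rewrite ge_min lexx.
    have be : beta <= eps * s / 2 by rewrite ge_min lexx orbT.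
    have -> : s * k = s / 2 * k + s / 2 * k by field.
    rewrite expRD mulrA; apply: ler_pM; rewrite ?expR_ge0 ?mulr_ge0 ?(ltW beta0)//.
      apply: (@le_trans _ _ (eps * (s / 2 * k))).
        by rewrite mulrA mulrA ler_wpM2r.
      by rewrite ler_pM2l.
    by rewrite ler_expR ler_wpM2r.
  have e2 : (expR (beta * k) - 1) * G y <= eps * expR (s * k) * G y by rewrite ler_wpM2r.
  have E1 : 1 <= expR (beta * k) by rewrite expR_ge1// mulr_ge0// ltW.
  rewrite ler_norml; apply/andP; split; last by lra.
  have e3 : G y - G (y + w) <= (expR (beta * k) - 1) * G y.
    have [le|/ltW le] := lerP (G y) (G (y + w)).
      by apply: (@le_trans _ _ 0); [lra|rewrite mulr_ge0// subr_ge0].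
    have : (expR (beta * k) - 1) * G (y + w) <= (expR (beta * k) - 1) * G y.
      by rewrite ler_wpM2l// subr_ge0.
    lra.
  lra.
set k : R := (l1 w)%:R in wL *.
have skL : s * (dl * L) <= s * k by rewrite ler_pM2l// ltW.
have b1 : G y <= eps * expR (s * k) * G y.
  rewrite ler_peMl//; apply: (le_trans h1L); rewrite ler_pM2l// ler_expR.
  by move: skL; rewrite /a; lra.
have b2 : G (y + w) <= eps * expR (s * k) * G y.
  apply: (@le_trans _ _ (eps * expR (s * k) * expR (- a * L))); last first.
    by rewrite ler_wpM2l// mulr_ge0 ?expR_ge0// ltW.
  apply: (le_trans (hD (y + w) i0)).
  apply: (@le_trans _ _ (eps * expR (2 * a * L) * axis r i0 (y + w))).
    by rewrite ler_wpM2r ?axis_ge0.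
  rewrite -!mulrA ler_pM2l// /axis -!expRD ler_expR mxE rmorphD/= mulrDr.
  have n1 : r * (y 0 i0)%:~R <= r * (2 * L).
    rewrite ler_pM2l//; have := hnear i0; rewrite ler_norml => /andP[_].
    have : L * q i0 <= L * 1 by rewrite ler_pM2l.
    lra.
  have n2 : r * (w 0 i0)%:~R <= r * k.
    by rewrite ler_pM2l// (le_trans (ler_norm _))// norm_coord_le_l1.
  have n3 : r * k <= s / 2 * k.
    by rewrite ler_wpM2r ?ler0n// !ge_min lexx orbT.
  have n4 : r * (2 * L) <= a / 2 * (2 * L).
    by rewrite ler_wpM2r ?mulr_ge0 ?(ltW L0)// !ge_min lexx !orbT.
  move: skL n1 n2 n3 n4; rewrite /a; lra.
rewrite ler_norml; apply/andP; split; lra.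
Qed.

(** * Exit from the orthant *)

Definition posb (z : 'rV[int]_d) : bool := [forall i, 0 < z 0 i].

(** The exit law is bounded by the Green function, so a weight dominated outside the orthant by
    finitely many exponentials of tilted mass below 1 is summed by geometric series. *)
Lemma exit_weight_le (K : finType) (chi : K -> 'rV[int]_d -> R)
    (W : 'rV[int]_d -> R) (r : R) x : r < 1 ->
  (forall k z, 0 < chi k z) -> (forall k, chi k 0 = 1) ->
  (forall k x y, chi k (x + y) = chi k x * chi k y) ->
  (forall k, (\esum_(z in setT) (m z * chi k z)%:E <= r%:E)%E) ->
  (forall z, 0 <= W z) -> (forall b, ~~ posb b -> W b <= \sum_k chi k b) ->
  (\esum_(b in setT) (exit_law m posb x b * (W b)%:E) <=
     (\sum_k chi k x * (1 - r)^-1)%:E)%E.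
Proof.
move=> r1 chi0 chi1 chiD mr W0 hW.
have chi0' k z : 0 <= chi k z by exact: ltW.
have e0 b : (0 <= exit_law m posb x b)%E by exact: exit_law_ge0.
have g0 b : (0 <= cgreen m b)%E by exact: cgreen_ge0.
apply: (@le_trans _ _ (\esum_(b in setT) \sum_k (cgreen m (b - x) * (chi k b)%:E))%E).
  apply: esumT_le => b; case: (boolP (posb b)) => pb.
    rewrite exit_law_in// mul0e; apply: sume_ge0 => k _.
    by rewrite mule_ge0// lee_fin.
  rewrite -ge0_sume_distrr; last by move=> k _; rewrite lee_fin.
  apply: lee_pmul; rewrite ?lee_fin//; first exact: exit_law_le_cgreen.
  by rewrite sumEFin lee_fin; exact: hW.
rewrite esum_sum; last by move=> b k _ _; rewrite mule_ge0// lee_fin.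
rewrite -sumEFin; apply: lee_sum => k _.
rewrite EFinM.
apply: (@le_trans _ _ ((chi k x)%:E * \esum_(w in setT) (cgreen m w * (chi k w)%:E))%E); last first.
  apply: lee_wpmul2l; rewrite ?lee_fin//.
  exact: (cgreen_mass_sum_le m0 (chi0' k) (chi1 k) (chiD k) (mr k) r1).
rewrite -esumZl ?lee_fin//; last by move=> w; rewrite mule_ge0// lee_fin.
rewrite -(@esum_subr _ _ (fun w => ((chi k x)%:E * (cgreen m w * (chi k w)%:E))%E) x); last first.
  by move=> w; rewrite !mule_ge0// lee_fin.
apply: esumT_le => b; rewrite muleCA -EFinM -chiD (_ : x + (b - x) = b)//.
by rewrite addrC subrK.
Qed.

(** Union bound over the coordinate that is at most 0 at the exit point, where exp(-r b_i) >= 1. The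
    bound tends to 0 deep in the orthant. *)
Lemma exit_prob_le_axis : exists r D : R, [/\ 0 < r, 0 < D & forall x,
  (exit_prob m posb x <= (\sum_i axis (- r) i x * D)%:E)%E].
Proof.
have [r [c [r0 rs c0 h]]] := mgf_neg.
exists r, (c * r)^-1; have cr0 : 0 < c * r by rewrite mulr_gt0.
split => //; first by rewrite invr_gt0.
move=> x; rewrite /exit_prob.
rewrite (eq_esum (b := fun b => (exit_law m posb x b * 1%:E)%E)); last by move=> b _; rewrite mule1.
have -> : c * r = 1 - (1 - c * r) by rewrite subKr.
apply: (@exit_weight_le _ (fun i => axis (- r) i) (fun=> 1)) => //.
- by rewrite gtrBl.
- by move=> i z; exact: expR_gt0.
- by move=> i; exact: axis0.
- by move=> i y z; exact: axisD.
- by move=> i; apply: h; rewrite r0 lexx.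
move=> b; rewrite negb_forall => /existsP[i]; rewrite -leNgt => bi.
rewrite (bigD1 i)//= -[leLHS]addr0; apply: lerD.
  by rewrite /axis expR_ge1// mulr_le0// ?oppr_le0 ?(ltW r0)// lerz0.
by apply: sumr_ge0 => j _; exact: axis_ge0.
Qed.

(* A point b outside the orthant has some coordinate b_j <= 0, so exp(s |b|) is
   dominated by the tilts of directions -r e_j +- s e_i; their masses are < 1
   by AM-GM between the axis tilts of directions -2r e_j and +-2s e_i. *)
Lemma exit_exp_moment : exists s : R, 0 < s /\ forall x, exists M : R,
  (\esum_(b in setT) (exit_law m posb x b * (expR (s * (l1 b)%:R))%:E) <= M%:E)%E.
Proof.
have [r0 [c [r00 rs0 c0 h]]] := mgf_neg.
pose r := r0 / 2; have r0r : 0 < r by rewrite divr_gt0.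
have cr0 : 0 < c * r by rewrite mulr_gt0.
have min0 : 0 < Num.min (s0 / 2) 1 by rewrite lt_min divr_gt0 /=.
have [s [sgt0]] := exists_small (kap + 2 * C) cr0 min0.
rewrite le_min => /andP[ss0 s1] sK.
have d0 : 0 < d%:R :> R by rewrite ltr0n; case: (d) i0 => // -[].
(* The largest coordinate of b is at least its l1 norm over d, so a tilt [s] on that single axis
   suffices. *)
exists (s / d%:R); split; first by rewrite divr_gt0.
pose sg (b : bool) : R := if b then - s else s.
pose chi (p : 'I_d * ('I_d * bool)) z := axis (- r) p.1 z * axis (sg p.2.2) p.2.1 z.
pose rr := 1 - c * r + s * (kap + 2 * C).
move=> x; exists (\sum_p chi p x * (1 - rr)^-1).
apply: exit_weight_le.
- by rewrite /rr; lra.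
- by move=> p z; rewrite mulr_gt0 ?expR_gt0.
- by move=> p; rewrite /chi !axis0 mulr1.
- by move=> p y z; rewrite /chi !axisD; ring.
- move=> [j [i b]]; rewrite /chi/=.
  have r20 : 0 < r0 <= r0 by rewrite r00 lexx.
  have sg2 : `|2 * sg b| <= s0.
    have : `|2 * sg b| = 2 * s.
      rewrite /sg; case: b; rewrite normrM ?normrN !gtr0_norm//.
    lra.
  apply: (@le_trans _ _ (\esum_(z in setT) ((2^-1)%:E * ((m z * axis (- r0) j z)%:E
      + (m z * axis (2 * sg b) i z)%:E)))%E).
    apply: esumT_le => z; rewrite -EFinD -EFinM lee_fin -mulrDr [leRHS]mulrCA ler_wpM2l//.
    have -> : axis (- r0) j z = axis (- r) j z ^+ 2.
      by rewrite /axis -expRM_natl /r; congr expR; field.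
    have -> : axis (2 * sg b) i z = axis (sg b) i z ^+ 2.
      by rewrite /axis -expRM_natl mulrA.
    have := sqr_ge0 (axis (- r) j z - axis (sg b) i z); rewrite sqrrB; lra.
  have ma s' k z : (0 <= (m z * axis s' k z)%:E)%E by rewrite lee_fin mulr_ge0// axis_ge0.
  rewrite esumZl ?lee_fin//; last by move=> z; rewrite adde_ge0.
  rewrite esumD//.
  apply: (@le_trans _ _ ((2^-1)%:E * ((1 - c * r0)%:E +
      (1 + 2 * sg b * (kap * q i) + C * (2 * sg b) ^+ 2)%:E))%E).
    apply: lee_wpmul2l; rewrite ?lee_fin//; apply: leeD; [exact: h|exact: mgf].
  rewrite -EFinD -EFinM lee_fin /rr /r.
  have sgs : sg b <= s by rewrite /sg; case: b {sg2} => //; lra.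
  have sgsq : (2 * sg b) ^+ 2 = 4 * s ^+ 2 by rewrite /sg; case: b {sg2 sgs}; rewrite ?mulrN ?sqrrN exprMn; ring.
  have sk : sg b * (kap * q i) <= s * kap.
    apply: (@le_trans _ _ (s * (kap * q i))); first by rewrite ler_pM2r// mulr_gt0.
    by rewrite ler_pM2l// ler_piMr// ltW.
  have sC : C * (s * s) <= C * s by rewrite ler_wpM2l// ler_piMl// ltW.
  rewrite sgsq expr2; lra.
- by move=> z; exact: expR_ge0.
move=> b; rewrite negb_forall => /existsP[j]; rewrite -leNgt => bj.
have [i hi] : exists i, (l1 b)%:R <= d%:R * `|(b 0 i)%:~R| :> R.
  have [i _ hi] := @arg_maxnP 'I_d i0 predT (fun i => absz (b 0 i)) isT.
  exists i; apply: l1_le => k; rewrite -!intr_norm -!abszE.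
  by rewrite -![(Posz _)%:~R]/(_%:R) ler_nat; exact: hi.
pose p := (j, (i, b 0 i < 0)).
rewrite (bigD1 p)//= -[leLHS]addr0; apply: lerD; last first.
  by apply: sumr_ge0 => k _; rewrite mulr_ge0 ?axis_ge0.
rewrite -[leLHS]mul1r /chi /p/=; apply: ler_pM; rewrite ?expR_ge0//.
  by rewrite /axis expR_ge1// mulr_le0// ?oppr_le0 ?(ltW r0r)// lerz0.
rewrite /axis ler_expR mulrAC ler_pdivrMr// /sg.
have : s * (l1 b)%:R <= s * (d%:R * `|(b 0 i)%:~R|) by rewrite ler_pM2l.
case: ltP => hb.
  by rewrite ltr0_norm ?ltrz0//; lra.
by rewrite ger0_norm ?ler0z//; lra.
Qed.

(** For [x] in the orthant, the probability that the walk never exits. *)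
Definition escape x : R := 1 - fine (exit_prob m posb x).

Lemma exit_probE x : exit_prob m posb x = (1 - escape x)%:E.
Proof.
rewrite /escape subKr fineK// ge0_fin_numE ?exit_prob_ge0//.
by apply: (le_lt_trans (exit_prob_le1 posb m0 x m1)); rewrite ltry.
Qed.

Lemma escape_ge0 x : 0 <= escape x.
Proof. by have := exit_prob_le1 posb m0 x m1; rewrite exit_probE lee_fin; lra. Qed.

Lemma escape_le1 x : escape x <= 1.
Proof. by have := exit_prob_ge0 posb m0 x; rewrite exit_probE lee_fin; lra. Qed.

Lemma escape_harmonic x :
  \esum_(z in setT) (if posb z then (m (z - x) * escape z)%:E else 0%E) = (escape x)%:E.
Proof.
have := exit_prob_step posb m0 x; rewrite exit_probE => eqx.
have h0 z : (0 <= (if posb z then (m (z - x) * escape z)%:E else 0))%E.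
  by case: ifP => // _; rewrite lee_fin mulr_ge0 ?escape_ge0.
have h1 z : (0 <= (m (z - x))%:E * (if posb z then exit_prob m posb z else 1))%E.
  by case: ifP => _; rewrite mule_ge0 ?lee_fin ?exit_prob_ge0.
have tot : (\esum_(z in setT) (if posb z then (m (z - x) * escape z)%:E else 0%E)
   + (1 - escape x)%:E = 1)%E.
  rewrite eqx -esumD// -[RHS]m1.
  rewrite -(@esum_subr _ _ (fun w => (m w)%:E) x) => [|w]; last by rewrite lee_fin.
  apply: esumT_eq => z; case: ifP => _; last by rewrite add0e mule1.
  by rewrite exit_probE -EFinM -EFinD; congr (_%:E); ring.
have fin : \esum_(z in setT) (if posb z then (m (z - x) * escape z)%:E else 0%E) \is a fin_num.
  rewrite ge0_fin_numE ?esum_ge0//; apply: (@le_lt_trans _ _ 1%E); last by rewrite ltry.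
  by rewrite -tot leeDl// lee_fin subr_ge0 escape_le1.
move: tot; rewrite -(fineK fin) -EFinD => -[] tot; congr (_%:E); lra.
Qed.

Hypothesis irr_pos : forall x x', posb x -> posb x' -> exists s,
  [/\ path (fun y z => 0 < m (z - y)) x s, all posb s & last x s = x'].

(** Deep in the orthant the exit probability is at most 1/2; harmonicity carries positivity
    backwards along a path inside the orthant. *)
Lemma escape_gt0 x : posb x -> 0 < escape x.
Proof.
move=> px; have [r [D [r0 D0 hE]]] := exit_prob_le_axis.
have half : 0 < 2^-1 :> R by [].
have [N [N0 hN]] := exists_exp_large (d%:R * D) half r0.
have [n Nn] : exists n : nat, N <= n%:R by exists (Num.truncn N).+1; exact/ltW/truncnS_gt.
pose x' : 'rV[int]_d := \row_i (n.+1)%:Z.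
have px' : posb x' by apply/forallP => i; rewrite mxE.
have esc' : 0 < escape x'.
  have := hE x'; rewrite exit_probE lee_fin.
  have -> : \sum_i axis (- r) i x' * D = d%:R * D * expR (- (r * n.+1%:R)).
    rewrite (eq_bigr (fun=> D * expR (- (r * n.+1%:R)))) => [|i _].
      by rewrite sumr_const card_ord -(mulr_natl (D * _)) mulrA.
    by rewrite /axis mxE mulNr mulrC.
  have NSn : N <= n.+1%:R by rewrite (le_trans Nn)// ler_nat.
  have : d%:R * D * expR (- (r * n.+1%:R)) <= 2^-1.
    by rewrite expRN ler_pdivrMr ?expR_gt0//; exact: hN.
  lra.
have [s [ps alls lasts]] := irr_pos px px'.
elim: s x px ps alls lasts => [|y s ih] x px /=; first by move=> _ _ ->.
move=> /andP[my ps] /andP[py alls] lasts.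
have ey := ih y py ps alls lasts.
have := escape_harmonic x.
have h0 z : (0 <= (if posb z then (m (z - x) * escape z)%:E else 0))%E.
  by case: ifP => // _; rewrite lee_fin mulr_ge0 ?escape_ge0.
move=> eqx; have := ler_esumT y h0; rewrite eqx py lee_fin.
by apply: lt_le_trans; rewrite mulr_gt0.
Qed.

(** * The killed Green function near the ray *)

Definition KG x y : R := fine (kgreen m posb x y).

Lemma kgreenE x y : kgreen m posb x y = (KG x y)%:E.
Proof.
rewrite fineK// ge0_fin_numE ?kgreen_ge0//.
by apply: (le_lt_trans (kgreen_le_cgreen posb m0 x y)); rewrite cgreenE ltry.
Qed.

(** The first exit decomposition divided by G(y). Each G(y - b) / G(y) is 1 up to an error
    proportional to exp(s|b|), which the exit law integrates. *)
Lemma KG_along x (eps : R) : 0 < eps ->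
  along_ray (fun L y => `|KG x y / G y - escape x| <= eps).
Proof.
move=> eps0; have [s [sgt0 hM]] := exit_exp_moment.
have [M leM] := hM x.
have e0 b : (0 <= exit_law m posb x b)%E by exact: exit_law_ge0.
have eW0 b : (0 <= exit_law m posb x b * (expR (s * (l1 b)%:R))%:E)%E.
  by rewrite mule_ge0 ?lee_fin ?expR_ge0.
have M0 : 0 <= M by rewrite -lee_fin (le_trans _ leM)// esum_ge0.
(* The total error weight: the first term for the shift by the starting point, [M] for the exit
   points. *)
pose B := expR (s * (l1 x)%:R) + M.
have B0 : 0 < B by rewrite ltr_pwDl ?expR_gt0.
have e10 : 0 < eps / B by rewrite divr_gt0.
apply: along_ray_imp (G_uniform_ratio sgt0 e10) => L y _ h.
set e1 := eps / B in e10 h.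
have Gy0 := G_gt0 y.
have hb b : `|G (y - b) - G y| <= e1 * expR (s * (l1 b)%:R) * G y.
  by have := h (- b); rewrite l1N.
have G0 w : 0 <= G w by exact: G_ge0.
have eG0 b : (0 <= exit_law m posb x b * (G (y - b))%:E)%E by rewrite mule_ge0 ?lee_fin.
have k1 : 0 <= e1 * G y by rewrite mulr_ge0// ltW.
have eWG b : (0 <= exit_law m posb x b * (expR (s * (l1 b)%:R))%:E * (e1 * G y)%:E)%E.
  by rewrite mule_ge0 ?lee_fin.
have eWG' b : 0 <= expR (s * (l1 b)%:R) * (e1 * G y).
  by rewrite mulr_ge0 ?expR_ge0.
have upper : (\esum_(b in setT) (exit_law m posb x b * (G (y - b))%:E) <=
   ((1 - escape x) * G y + M * (e1 * G y))%:E)%E.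
  apply: (@le_trans _ _ (\esum_(b in setT) (exit_law m posb x b * (G y)%:E +
     exit_law m posb x b * (expR (s * (l1 b)%:R))%:E * (e1 * G y)%:E))%E).
    apply: esumT_le => b; rewrite -muleA -ge0_muleDr ?lee_fin//.
    apply: lee_wpmul2l => //; rewrite -EFinM -EFinD lee_fin.
    by have := hb b; rewrite ler_norml => /andP[_]; lra.
  rewrite esumD//; last by move=> b _; rewrite mule_ge0 ?lee_fin.
  rewrite esumZr ?lee_fin// esumZr ?lee_fin// EFinD; apply: leeD.
    by rewrite -/(exit_prob m posb x) exit_probE.
  by rewrite (EFinM M); apply: lee_wpmul2r; rewrite ?lee_fin.
have lower : (((1 - escape x) * G y)%:E <=
   \esum_(b in setT) (exit_law m posb x b * (G (y - b))%:E) + (M * (e1 * G y))%:E)%E.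
  apply: (@le_trans _ _ (\esum_(b in setT) (exit_law m posb x b * (G (y - b))%:E +
     exit_law m posb x b * (expR (s * (l1 b)%:R))%:E * (e1 * G y)%:E))%E).
    rewrite EFinM -exit_probE -esumZr ?lee_fin//.
    apply: esumT_le => b; rewrite -muleA -ge0_muleDr ?lee_fin//.
    apply: lee_wpmul2l => //; rewrite -EFinM -EFinD lee_fin.
    by have := hb b; rewrite ler_norml => /andP[+ _]; lra.
  rewrite esumD//; apply: leeD => //; rewrite esumZr ?lee_fin// (EFinM M).
  by apply: lee_wpmul2r; rewrite ?lee_fin.
have := cgreen_first_exit posb m0 x y; rewrite cgreenE kgreenE.
rewrite (eq_esum (b := fun b => (exit_law m posb x b * (G (y - b))%:E)%E)); last first.
  by move=> b _; rewrite cgreenE.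
move: upper lower; set S := esum _ _ => upper lower.
have Sfin : S \is a fin_num.
  by rewrite ge0_fin_numE ?esum_ge0//; apply: (le_lt_trans upper); rewrite ltry.
move: upper lower; rewrite -(fineK Sfin) -!EFinD !lee_fin => upper lower -[] eqG.
have hx := hb x.
have epsE : eps = e1 * B by rewrite /e1 divfK// gt_eqF.
have -> : KG x y / G y - escape x = (KG x y - escape x * G y) / G y.
  by field; rewrite gt_eqF.
rewrite normrM normfV (gtr0_norm Gy0) ler_pdivrMr// epsE /B.
move: hx; rewrite !ler_norml => /andP[hx1 hx2]; apply/andP; split; lra.
Qed.

Lemma KG_cvg x (u : nat -> 'rV[int]_d) (L : nat -> R) :
  (forall dl, 0 < dl -> \forall n \near \oo, 1 <= dl * L n /\ near_ray dl (L n) (u n)) ->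
  KG x (u n) / G (u n) @[n --> \oo] --> escape x.
Proof.
move=> hu; apply/cvgrPdist_le => eps eps0.
have [dl [dl0 h]] := KG_along x eps0.
near=> n; rewrite distrC; apply: (h (L n)).
  by have [] : 1 <= dl * L n /\ near_ray dl (L n) (u n) by near: n; exact: hu.
by have [] : 1 <= dl * L n /\ near_ray dl (L n) (u n) by near: n; exact: hu.
Unshelve. all: by end_near.
Qed.

Lemma KG_ratio_cvg x x0 (u : nat -> 'rV[int]_d) (L : nat -> R) :
  (forall dl, 0 < dl -> \forall n \near \oo, 1 <= dl * L n /\ near_ray dl (L n) (u n)) ->
  posb x0 ->
  KG x (u n) / KG x0 (u n) @[n --> \oo] --> escape x / escape x0.
Proof.
move=> hu px0.
rewrite (_ : (fun n => KG x (u n) / KG x0 (u n)) =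
  fun n => (KG x (u n) / G (u n)) * (KG x0 (u n) / G (u n))^-1); last first.
  apply/funext => n; rewrite invf_div mulrA; congr (_ / _).
  by rewrite divfK// gt_eqF// G_gt0.
apply: cvgM; first exact: KG_cvg hu.
apply: cvgV; first by rewrite gt_eqF// escape_gt0.
exact: KG_cvg hu.
Qed.

End drifting_walk.

(** * The Laplace transform *)

Section signed_sums.
Context {R : realType} {d : nat}.
Local Notation T := 'rV[int]_d.
Implicit Types f g h : T -> R.

Definition abssum f : Prop := (\esum_(z in setT) `|f z|%:E < +oo)%E.

Definition ppart f z : R := Num.max (f z) 0.
Definition npart f z : R := Num.max (- f z) 0.

Lemma ppart_ge0 f z : 0 <= ppart f z. Proof. by rewrite le_max lexx orbT. Qed.
Lemma npart_ge0 f z : 0 <= npart f z. Proof. by rewrite le_max lexx orbT. Qed.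

Lemma partE f z : f z = ppart f z - npart f z.
Proof. by rewrite /ppart /npart; case: (lerP (f z) 0) => ?; case: lerP => ?; lra. Qed.

Lemma ppart_le f z : ppart f z <= `|f z|.
Proof. by rewrite ge_max ler_norm normr_ge0. Qed.
Lemma npart_le f z : npart f z <= `|f z|.
Proof. by rewrite ge_max normr_ge0 -normrN ler_norm. Qed.

Lemma esum_fin_le f g : (forall z, 0 <= f z) -> (forall z, f z <= g z) ->
  (\esum_(z in setT) (g z)%:E < +oo)%E ->
  \esum_(z in setT) (f z)%:E \is a fin_num.
Proof.
move=> f0 fg gfin; rewrite ge0_fin_numE; last by apply: esum_ge0 => z _; rewrite lee_fin.
by apply: le_lt_trans gfin; apply: esumT_le => z; rewrite lee_fin.
Qed.

Lemma esum_fineD f g : (forall z, 0 <= f z) -> (forall z, 0 <= g z) ->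
  \esum_(z in setT) (f z)%:E \is a fin_num -> \esum_(z in setT) (g z)%:E \is a fin_num ->
  fine (\esum_(z in setT) (f z + g z)%:E) =
  fine (\esum_(z in setT) (f z)%:E) + fine (\esum_(z in setT) (g z)%:E).
Proof.
move=> f0 g0 ff gf; rewrite -fineD//; congr fine.
by rewrite -esumD// => z _; rewrite lee_fin.
Qed.

(** Any decomposition into summable nonnegative parts gives the same value, because f^+ + h = f^- +
    g. Linearity then avoids computing positive parts of sums. *)
Lemma zsum_dec f g h : (forall z, 0 <= g z) -> (forall z, 0 <= h z) ->
  (forall z, f z = g z - h z) ->
  (\esum_(z in setT) (g z)%:E < +oo)%E -> (\esum_(z in setT) (h z)%:E < +oo)%E ->
  zsum setT f = fine (\esum_(z in setT) (g z)%:E) - fine (\esum_(z in setT) (h z)%:E).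
Proof.
move=> g0 h0 fgh gfin hfin.
have -> : zsum setT f = fine (\esum_(z in setT) (ppart f z)%:E - \esum_(z in setT) (npart f z)%:E)%E.
  rewrite /zsum; congr (fine (_ - _)%E); apply: esumT_eq => z.
    by rewrite funeposE /ppart EFin_max.
  by rewrite funenegE /npart EFin_max.
have pg z : ppart f z <= g z.
  by rewrite ge_max g0 andbT fgh; have := h0 z; lra.
have nh z : npart f z <= h z.
  by rewrite ge_max h0 andbT fgh; have := g0 z; lra.
have pf := esum_fin_le (ppart_ge0 f) pg gfin.
have nf := esum_fin_le (npart_ge0 f) nh hfin.
have gf : \esum_(z in setT) (g z)%:E \is a fin_num by exact: esum_fin_le gfin.
have hf : \esum_(z in setT) (h z)%:E \is a fin_num by exact: esum_fin_le hfin.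
rewrite fineB//.
have := esum_fineD (ppart_ge0 f) h0 pf hf.
rewrite (_ : (fun z => (ppart f z + h z)%:E) = fun z => (npart f z + g z)%:E); last first.
  by apply/funext => z; congr (_%:E); have := partE f z; rewrite fgh; lra.
rewrite esum_fineD//; last exact: npart_ge0.
by move=> eq1; lra.
Qed.

Lemma abssum_ppart f : abssum f -> (\esum_(z in setT) (ppart f z)%:E < +oo)%E.
Proof. by apply: le_lt_trans; apply: esumT_le => z; rewrite lee_fin ppart_le. Qed.

Lemma abssum_npart f : abssum f -> (\esum_(z in setT) (npart f z)%:E < +oo)%E.
Proof. by apply: le_lt_trans; apply: esumT_le => z; rewrite lee_fin npart_le. Qed.

Lemma zsum_parts f : abssum f ->
  zsum setT f = fine (\esum_(z in setT) (ppart f z)%:E) - fine (\esum_(z in setT) (npart f z)%:E).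
Proof.
move=> af; apply: zsum_dec; [exact: ppart_ge0|exact: npart_ge0|exact: partE|
  exact: abssum_ppart|exact: abssum_npart].
Qed.

Lemma abssum_le f g : (forall z, `|f z| <= `|g z|) -> abssum g -> abssum f.
Proof. by move=> fg; apply: le_lt_trans; apply: esumT_le => z; rewrite lee_fin. Qed.

Lemma abssumD f g : abssum f -> abssum g -> abssum (fun z => f z + g z).
Proof.
move=> af ag; rewrite /abssum.
apply: (@le_lt_trans _ _ (\esum_(z in setT) (`|f z|%:E + `|g z|%:E))%E).
  by apply: esumT_le => z; rewrite -EFinD lee_fin ler_normD.
by rewrite esumD ?lte_add_pinfty// => z _; rewrite lee_fin.
Qed.

Lemma abssumZ c f : abssum f -> abssum (fun z => c * f z).
Proof.
move=> af; rewrite /abssum.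
rewrite (eq_esum (b := fun z => (`|c|%:E * `|f z|%:E)%E)); last by move=> z _; rewrite normrM.
rewrite esumZl ?lee_fin//; apply: lte_mul_pinfty; rewrite ?lee_fin//.
Qed.

Lemma zsum_ge0 f : (forall z, 0 <= f z) -> abssum f ->
  zsum setT f = fine (\esum_(z in setT) (f z)%:E).
Proof.
move=> f0 af; rewrite (@zsum_dec f f (fun=> 0))//.
- by rewrite [X in _ - fine X]esum1// subr0.
- by move=> z; rewrite subr0.
- by apply: le_lt_trans af; apply: esumT_le => z; rewrite ger0_norm.
- by rewrite esum1.
Qed.

Lemma zsumD f g : abssum f -> abssum g ->
  zsum setT (fun z => f z + g z) = zsum setT f + zsum setT g.
Proof.
move=> af ag.
have pf := abssum_ppart af; have nf := abssum_npart af.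
have pg := abssum_ppart ag; have ng := abssum_npart ag.
have fin (k : T -> R) : (forall z, 0 <= k z) -> (\esum_(z in setT) (k z)%:E < +oo)%E ->
  \esum_(z in setT) (k z)%:E \is a fin_num by move=> k0; exact: esum_fin_le.
rewrite (@zsum_dec _ (fun z => ppart f z + ppart g z) (fun z => npart f z + npart g z)).
- have P0 := @ppart_ge0; have N0 := @npart_ge0.
  rewrite (esum_fineD (P0 f) (P0 g) (fin _ (P0 f) pf) (fin _ (P0 g) pg)).
  rewrite (esum_fineD (N0 f) (N0 g) (fin _ (N0 f) nf) (fin _ (N0 g) ng)).
  by rewrite !zsum_parts//; lra.
- by move=> z; rewrite addr_ge0 ?ppart_ge0.
- by move=> z; rewrite addr_ge0 ?npart_ge0.
- by move=> z; rewrite (partE f) (partE g); lra.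
- rewrite (eq_esum (b := fun z => ((ppart f z)%:E + (ppart g z)%:E)%E))//.
  by rewrite esumD ?lte_add_pinfty// => z _; rewrite lee_fin ppart_ge0.
- rewrite (eq_esum (b := fun z => ((npart f z)%:E + (npart g z)%:E)%E))//.
  by rewrite esumD ?lte_add_pinfty// => z _; rewrite lee_fin npart_ge0.
Qed.

Lemma zsumZ c f : abssum f -> zsum setT (fun z => c * f z) = c * zsum setT f.
Proof.
move=> af; have pf := abssum_ppart af; have nf := abssum_npart af.
have fz (k : T -> R) (b : R) : 0 <= b -> (forall z, 0 <= k z) -> (\esum_(z in setT) (k z)%:E < +oo)%E ->
  fine (\esum_(z in setT) (b * k z)%:E) = b * fine (\esum_(z in setT) (k z)%:E) /\
  (\esum_(z in setT) (b * k z)%:E < +oo)%E.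
  move=> b0 k0 kfin; rewrite (eq_esum (b := fun z => (b%:E * (k z)%:E)%E))//.
  rewrite esumZl ?lee_fin//; split; last exact: lte_mul_pinfty.
  have kf : \esum_(z in setT) (k z)%:E \is a fin_num by apply: (esum_fin_le (g := k)).
  by rewrite fineM.
have [c0|c0] := lerP 0 c.
  have [e1 l1] := fz _ c c0 (ppart_ge0 f) pf.
  have [e2 l2] := fz _ c c0 (npart_ge0 f) nf.
  rewrite (@zsum_dec _ (fun z => c * ppart f z) (fun z => c * npart f z))//.
  - by rewrite e1 e2 zsum_parts// mulrBr.
  - by move=> z; rewrite mulr_ge0 ?ppart_ge0.
  - by move=> z; rewrite mulr_ge0 ?npart_ge0.
  - by move=> z; rewrite {1}(partE f) mulrBr.
have c0' : 0 <= - c by rewrite oppr_ge0 ltW.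
have [e1 l1] := fz _ (- c) c0' (ppart_ge0 f) pf.
have [e2 l2] := fz _ (- c) c0' (npart_ge0 f) nf.
rewrite (@zsum_dec _ (fun z => - c * npart f z) (fun z => - c * ppart f z))//.
- by rewrite e1 e2 zsum_parts//; lra.
- by move=> z; rewrite mulr_ge0 ?npart_ge0.
- by move=> z; rewrite mulr_ge0 ?ppart_ge0.
- by move=> z; rewrite {1}(partE f); lra.
Qed.

Lemma zsum_sum (I : Type) (r : seq I) (f : I -> T -> R) :
  (forall i, abssum (f i)) ->
  abssum (fun z => \sum_(i <- r) f i z) /\
  zsum setT (fun z => \sum_(i <- r) f i z) = \sum_(i <- r) zsum setT (f i).
Proof.
move=> af; elim: r => [|i r [ih1 ih2]].
  have a0 : abssum (fun z : T => \sum_(i <- [::]) f i z).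
    by rewrite /abssum esum1// => z _; rewrite big_nil normr0.
  split => //; rewrite zsum_ge0//; last by move=> z; rewrite big_nil.
  by rewrite esum1 ?big_nil// => z _; rewrite big_nil.
have -> : (fun z => \sum_(j <- i :: r) f j z) = fun z => f i z + \sum_(j <- r) f j z.
  by apply/funext => z; rewrite big_cons.
by split; [exact: abssumD|rewrite zsumD// ih2 big_cons].
Qed.

End signed_sums.

(** * Second-order expansion of the Laplace transform *)

Section laplace_transform.
Context {R : realType} {d : nat}.
Local Notation T := 'rV[int]_d.
Variable mu : T -> R.
Hypothesis mu0 : forall z, 0 <= mu z.
Implicit Types a v : 'rV[R]_d.

Lemma dotD a v z : dot (a + v) z = dot a z + dot v z.
Proof. by rewrite /dot -big_split; apply: eq_bigr => i _; rewrite mxE mulrDl. Qed.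

Lemma dotZ (s : R) v z : dot (s *: v) z = s * dot v z.
Proof. by rewrite /dot mulr_sumr; apply: eq_bigr => i _; rewrite mxE mulrA. Qed.

Lemma dot_delta i (z : 'rV[R]_d) : dot (delta_mx 0 i) z = z 0 i.
Proof.
rewrite /dot (bigD1 i)//= mxE !eqxx mul1r big1 ?addr0// => j ji.
by rewrite mxE (negPf ji) andbF mul0r.
Qed.

Definition tilt a z : R := mu z * expR (dot a (zvec z)).

Lemma tilt_ge0 a z : 0 <= tilt a z.
Proof. by rewrite mulr_ge0 ?expR_ge0. Qed.

Lemma tiltDZ a (s : R) v z : tilt (a + s *: v) z = tilt a z * expR (s * dot v (zvec z)).
Proof. by rewrite /tilt dotD dotZ expRD mulrA. Qed.

Lemma phiE a : phi mu a = \esum_(z in setT) (tilt a z)%:E. Proof. by []. Qed.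

(** The directional derivative of [phi] as a sum, so that linearity and convexity are statements on
    series. *)
Definition dphi a v : R := zsum setT (fun z => tilt a z * dot v (zvec z)).

Lemma expR_taylor2 (y : R) : 0 <= expR y - 1 - y <= y ^+ 2 * expR `|y|.
Proof.
apply/andP; split; first by have := expR_ge1Dx y; lra.
have h : expR y - 1 <= y * expR y.
  have -> : expR y - 1 = (1 - expR (- y)) * expR y.
    by rewrite mulrBl mul1r -expRD addNr expR0.
  by rewrite ler_pM2r ?expR_gt0//; have := expR_ge1Dx (- y); lra.
have h2 : expR y - 1 - y <= y * (expR y - 1) by lra.
apply: (le_trans h2); rewrite expr2 -mulrA; have [y0|y0] := lerP 0 y.
  by rewrite ger0_norm// ler_wpM2l//; lra.
rewrite ltr0_norm// -mulrNN -(mulrNN y) ler_wpM2l ?oppr_ge0 ?(ltW y0)//.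
have := expR_ge1Dx y => h3.
have : - y * 1 <= - y * expR (- y).
  by rewrite ler_wpM2l ?oppr_ge0 ?(ltW y0)// expR_ge1// oppr_ge0 ltW.
lra.
Qed.

(** Half of the exponent 2 r |x| absorbs the square, through r |x| / 2 <= exp(r |x| / 2). The two
    exponentials replace |x| so that the bound is again a sum of tilts. *)
Lemma sqr_expR_le (r x : R) : 0 < r ->
  x ^+ 2 * expR (r * `|x|) <= 4 / r ^+ 2 * (expR (2 * r * x) + expR (- (2 * r) * x)).
Proof.
move=> r0.
have h : expR (2 * r * `|x|) <= expR (2 * r * x) + expR (- (2 * r) * x).
  have [x0|x0] := lerP 0 x; first by rewrite ger0_norm// lerDl expR_ge0.
  by rewrite ltr0_norm// mulrN mulNr lerDr expR_ge0.
apply: le_trans (_ : 4 / r ^+ 2 * expR (2 * r * `|x|) <= _); last first.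
  by rewrite ler_wpM2l// divr_ge0// exprn_ge0// ltW.
have -> : 2 * r * `|x| = r * `|x| + r * `|x| by ring.
rewrite expRD mulrA ler_pM2r ?expR_gt0//.
have h1 : r * `|x| / 2 <= expR (r * `|x| / 2) by have := expR_ge1Dx (r * `|x| / 2); lra.
have rx0 : 0 <= r * `|x| / 2 by rewrite divr_ge0// mulr_ge0// ltW.
have -> : expR (r * `|x|) = expR (r * `|x| / 2) * expR (r * `|x| / 2).
  by rewrite -expRD; congr expR; field.
have h2 := ler_pM rx0 rx0 h1 h1.
have xE : x ^+ 2 = 4 / r ^+ 2 * (r * `|x| / 2 * (r * `|x| / 2)).
  by rewrite -(real_normK (num_real x)); field; rewrite gt_eqF.
by rewrite xE ler_wpM2l// divr_ge0// exprn_ge0// ltW.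
Qed.

(** Finiteness of [phi] at two opposite points dominates the remainder by s^2 times the tilts there.
    The remainder is nonnegative term by term, which gives the lower bound. *)
Lemma phi_taylor a v (r : R) : 0 < r ->
  (phi mu (a + (2 * r) *: v) < +oo)%E -> (phi mu (a + (- (2 * r)) *: v) < +oo)%E ->
  (phi mu a < +oo)%E ->
  abssum (fun z => tilt a z * dot v (zvec z)) /\
  exists C : R, 0 <= C /\ forall s, `|s| <= r ->
    exists2 x : R, phi mu (a + s *: v) = x%:E &
    fine (phi mu a) + s * dphi a v <= x <= fine (phi mu a) + s * dphi a v + C * s ^+ 2.
Proof.
move=> r0 fp fn fa.
pose X z : R := dot v (zvec z).
pose K : R := 4 / r ^+ 2.
pose B z : R := tilt (a + (2 * r) *: v) z + tilt (a + (- (2 * r)) *: v) z.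
have B0 z : 0 <= B z by rewrite addr_ge0 ?tilt_ge0.
have K0 : 0 <= K by rewrite divr_ge0// exprn_ge0// ltW.
have Bfin : (\esum_(z in setT) (B z)%:E < +oo)%E.
  have t0 b z : (0 <= (tilt b z)%:E)%E by rewrite lee_fin tilt_ge0.
  have := lte_add_pinfty fp fn; rewrite !phiE -esumD => [|z _|z _]; try exact: t0.
  by apply: le_lt_trans; apply: esumT_le => z; rewrite EFinD.
have aB : abssum B.
  by apply: le_lt_trans Bfin; apply: esumT_le => z; rewrite ger0_norm.
have aT : abssum (tilt a).
  by apply: le_lt_trans fa; apply: esumT_le => z; rewrite ger0_norm ?tilt_ge0.
have Rle s z : `|s| <= r ->
    tilt a z * (expR (s * X z) - 1 - s * X z) <= s ^+ 2 * (K * B z).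
  move=> sr; have /andP[_ h] := expR_taylor2 (s * X z).
  rewrite /B !tiltDZ -mulrDr (mulrCA K) (mulrCA (s ^+ 2)) ler_wpM2l ?tilt_ge0//.
  apply: (le_trans h); rewrite exprMn -(mulrA (s ^+ 2)) ler_wpM2l ?sqr_ge0//.
  apply: le_trans (sqr_expR_le (X z) r0); rewrite ler_wpM2l ?sqr_ge0//.
  by rewrite ler_expR normrM ler_wpM2r.
have aX : abssum (fun z => tilt a z * X z).
  apply: (abssum_le (g := fun z => tilt a z + 1 * (K * B z))); last first.
    by apply: abssumD => //; do 2 apply: abssumZ.
  move=> z; rewrite normrM (ger0_norm (tilt_ge0 _ _)) [leRHS]ger0_norm; last first.
    by apply: addr_ge0; [exact: tilt_ge0|rewrite mul1r; exact: mulr_ge0].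
  have h : X z ^+ 2 <= K * (expR (2 * r * X z) + expR (- (2 * r) * X z)).
    apply: le_trans (sqr_expR_le (X z) r0).
    by rewrite ler_peMr ?sqr_ge0// expR_ge1// mulr_ge0// ltW.
  have h2 : `|X z| <= 1 + X z ^+ 2.
    rewrite -real_normK ?num_real//; have := sqr_ge0 (`|X z| - 2^-1); rewrite sqrrB; lra.
  have h3 : tilt a z * `|X z| <= tilt a z * (1 + K * (expR (2 * r * X z) + expR (- (2 * r) * X z))).
    by rewrite ler_wpM2l ?tilt_ge0//; lra.
  apply: (le_trans h3); rewrite /B !tiltDZ -/(X z); lra.
split => //.
exists (K * fine (\esum_(z in setT) (B z)%:E)); split.
  by rewrite mulr_ge0// fine_ge0// esum_ge0// => z _; rewrite lee_fin.
move=> s sr.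
pose Rm z := tilt a z * (expR (s * X z) - 1 - s * X z).
have Rm0 z : 0 <= Rm z by rewrite mulr_ge0 ?tilt_ge0//; have /andP[] := expR_taylor2 (s * X z).
have aR : abssum Rm.
  apply: (abssum_le (g := fun z => s ^+ 2 * (K * B z))); last by do 2 apply: abssumZ.
  move=> z; rewrite !ger0_norm//; first exact: Rle.
  by rewrite mulr_ge0 ?sqr_ge0// mulr_ge0.
have eqT : tilt (a + s *: v) = fun z => tilt a z + (s * (tilt a z * X z) + Rm z).
  by apply/funext => z; rewrite tiltDZ /Rm -/(X z); ring.
have aTs : abssum (tilt (a + s *: v)).
  by rewrite eqT; apply: abssumD => //; apply: abssumD => //; apply: abssumZ.
have Tfin : phi mu (a + s *: v) \is a fin_num.
  rewrite phiE ge0_fin_numE; last by apply: esum_ge0 => z _; rewrite lee_fin tilt_ge0.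
  by apply: le_lt_trans aTs; apply: esumT_le => z; rewrite lee_fin ler_norm.
exists (fine (phi mu (a + s *: v))); first by rewrite fineK.
have -> : fine (phi mu (a + s *: v)) = fine (phi mu a) + s * dphi a v + fine (\esum_(z in setT) (Rm z)%:E).
  rewrite -(zsum_ge0 Rm0 aR) phiE -zsum_ge0//; last exact: tilt_ge0.
  rewrite phiE -zsum_ge0//; last exact: tilt_ge0.
  rewrite eqT zsumD//; last by apply: abssumD => //; apply: abssumZ.
  by rewrite zsumD//; [rewrite zsumZ// addrA|exact: abssumZ].
have S0 : 0 <= fine (\esum_(z in setT) (Rm z)%:E).
  by rewrite fine_ge0// esum_ge0// => z _; rewrite lee_fin.
rewrite lerDl S0/= lerD2l.
have eqB : \esum_(z in setT) (s ^+ 2 * (K * B z))%:E = ((s ^+ 2 * K)%:E * \esum_(z in setT) (B z)%:E)%E.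
  have sK0 : 0 <= s ^+ 2 * K by apply: mulr_ge0 => //; exact: sqr_ge0.
  rewrite -esumZl ?lee_fin//.
  by apply: esumT_eq => z; rewrite -EFinM mulrA.
have Bf : \esum_(z in setT) (B z)%:E \is a fin_num by apply: (esum_fin_le (g := B)).
have -> : K * fine (\esum_(z in setT) (B z)%:E) * s ^+ 2 = fine (\esum_(z in setT) (s ^+ 2 * (K * B z))%:E).
  by rewrite eqB fineM//=; ring.
apply: fine_le.
- apply: (esum_fin_le (g := fun z => `|Rm z|)) => //.
  by move=> z; exact: ler_norm.
- by rewrite eqB fin_numM.
by apply: esumT_le => z; rewrite lee_fin; exact: Rle.
Qed.

End laplace_transform.

(** * The exponent a(q) *)

Lemma continuous_sumr (R : realType) (U : topologicalType) (I : Type) (r : seq I)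
    (f : I -> U -> R) : (forall i, continuous (f i)) ->
  continuous (fun x => \sum_(i <- r) f i x).
Proof.
move=> cf x; elim: r => [|i r ih].
  by rewrite (_ : (fun _ => _) = fun=> 0); [exact: cvg_cst|apply/funext => y; rewrite big_nil].
rewrite (_ : (fun _ => _) = fun y => f i y + \sum_(j <- r) f j y).
  by apply: cvgD; [exact: cf|exact: ih].
by apply/funext => y; rewrite big_cons.
Qed.

Section exponent.
Context {R : realType} {d : nat}.
Local Notation T := 'rV[int]_d.
Variable mu : T -> R.
Hypothesis hmu : is_prob mu.
Hypothesis fin_phi : finite_near_Dset mu.
Hypothesis irr : forall b (i : 'I_d), exists s,
  path (fun y z => 0 < mu (z - y)) 0 s /\ last 0 s = uvec b i.
Implicit Types a v q : 'rV[R]_d.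

Let mu0 : forall z, 0 <= mu z := hmu.1.

Lemma phi_ray a v : Dset mu a -> exists r : R, [/\ 0 < r,
  (phi mu (a + (2 * r) *: v) < +oo)%E, (phi mu (a + (- (2 * r)) *: v) < +oo)%E &
  (phi mu a < +oo)%E].
Proof.
have [U [oU DU Ufin]] := fin_phi; move=> /DU Ua.
have near0 : \forall t \near (0 : R), U (a + t *: v).
  have : (fun t : R => a + t *: v) @ (0 : R) --> a + (0 : R) *: v.
    by apply: cvgD; [exact: cvg_cst|apply: cvgZr_tmp; exact: cvg_id].
  by rewrite scale0r addr0; apply; exact: open_nbhs_nbhs.
have [e /= e0 he] := near0.
exists (e / 4); split; rewrite ?divr_gt0//; try apply: Ufin => //.
  by apply: he; rewrite /= sub0r normrN gtr0_norm; lra.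
by apply: he; rewrite /= sub0r opprK gtr0_norm; lra.
Qed.

Lemma abssum_tilt a v : Dset mu a -> abssum (fun z => tilt mu a z * dot v (zvec z)).
Proof. by move=> /(phi_ray v)[r [r0 f1 f2 f3]]; have [] := phi_taylor mu0 r0 f1 f2 f3. Qed.

Lemma dphi_linear a v : Dset mu a ->
  dphi mu a v = \sum_i v 0 i * dphi mu a (delta_mx 0 i).
Proof.
move=> Da; rewrite /dphi.
have -> : (fun z => tilt mu a z * dot v (zvec z)) =
   fun z => \sum_i v 0 i * (tilt mu a z * dot (delta_mx 0 i) (zvec z)).
  apply/funext => z; rewrite [dot v _]/dot mulr_sumr; apply: eq_bigr => i _.
  by rewrite dot_delta mulrCA.
have af i : abssum (fun z => v 0 i * (tilt mu a z * dot (delta_mx 0 i) (zvec z))).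
  by apply: abssumZ; exact: abssum_tilt.
have [_ ->] := zsum_sum (index_enum _) af.
by apply: eq_bigr => i _; rewrite zsumZ//; exact: abssum_tilt.
Qed.

(** The remainder, at most C s^2, divided by s tends to 0; thus the derivative in [grad_phi] is a
    genuine limit and not a default value. *)
Lemma grad_phiE a i : Dset mu a -> grad_phi mu a 0 i = dphi mu a (delta_mx 0 i).
Proof.
move=> Da; rewrite mxE.
have [r [r0 f1 f2 f3]] := phi_ray (delta_mx 0 i) Da.
have [_ [C [C0 h]]] := phi_taylor mu0 r0 f1 f2 f3.
set L := dphi mu a _ in h *.
apply/cvg_lim => //; apply/cvgrPdist_le => eps eps0.
have CC : 0 < C + 1 by rewrite ltr_wpDl.
near=> s.
have s0 : s != 0 by near: s; exact: nbhs_dnbhs_neq.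
have sr : `|s| <= r.
  near: s; apply: dnbhs0_le => //.
have se : `|s| <= eps / (C + 1).
  by near: s; apply: dnbhs0_le; rewrite divr_gt0.
have [x xE /andP[x1 x2]] := h s sr.
rewrite /= /shift/= [s *: _ + a]addrC xE /=.
rewrite [s^-1 *: _]/(s^-1 * _).
have -> : L - s^-1 * (x - fine (phi mu a)) = - (s^-1 * (x - (fine (phi mu a) + s * L))).
  by field.
rewrite normrN normrM normfV ler_pdivrMl ?normr_gt0//.
rewrite ger0_norm; last by rewrite subr_ge0.
have hs : `|s| * `|s| <= `|s| * (eps / (C + 1)) by rewrite ler_wpM2l.
have s2 : s ^+ 2 = `|s| * `|s| by rewrite -expr2 real_normK ?num_real.
have h3 : C * (`|s| * `|s|) <= (C + 1) * (`|s| * (eps / (C + 1))).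
  by apply: ler_pM => //; rewrite ?mulr_ge0// lerDl.
have h4 : (C + 1) * (`|s| * (eps / (C + 1))) = `|s| * eps.
  by field; rewrite gt_eqF.
by move: x2; rewrite s2 -h4; lra.
Unshelve. all: by end_near.
Qed.

(** The inequality exp(y) >= 1 + y, summed against the tilted law at [a]. *)
Lemma phi_convex a b : Dset mu a ->
  ((fine (phi mu a) + dphi mu a (b - a))%:E <= phi mu b)%E.
Proof.
move=> Da.
have phib0 : (0 <= phi mu b)%E by apply: esum_ge0 => z _; rewrite lee_fin tilt_ge0.
have [bfin|] := boolP (phi mu b \is a fin_num); last first.
  by rewrite ge0_fin_numE// -leNgt leye_eq => /eqP ->; rewrite leey.
have [r [r0 f1 f2 f3]] := phi_ray 0 Da.
have aT c : (phi mu c < +oo)%E -> abssum (tilt mu c).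
  by apply: le_lt_trans; apply: esumT_le => z; rewrite ger0_norm ?tilt_ge0.
have aTa := aT _ f3.
have bfin' : (phi mu b < +oo)%E by rewrite -ge0_fin_numE.
have aTb := aT _ bfin'.
have aX := abssum_tilt (b - a) Da.
rewrite -(fineK bfin) lee_fin !phiE -!zsum_ge0//; try exact: tilt_ge0.
rewrite /dphi -zsumD//.
pose D z := tilt mu b z + (-1) * (tilt mu a z + tilt mu a z * dot (b - a) (zvec z)).
have D0 z : 0 <= D z.
  have -> : D z = tilt mu a z * (expR (1 * dot (b - a) (zvec z)) - 1 - dot (b - a) (zvec z)).
    by rewrite /D -(subrK a b) (addrC (b - a)) -{1}(scale1r (b - a)) tiltDZ addrC subrK; ring.
  rewrite mulr_ge0 ?tilt_ge0// mul1r.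
  by have /andP[] := expR_taylor2 (dot (b - a) (zvec z)).
have aS : abssum (fun z => tilt mu a z + tilt mu a z * dot (b - a) (zvec z)) by exact: abssumD.
have aD : abssum D by apply: abssumD => //; exact: abssumZ.
have : 0 <= zsum setT D.
  by rewrite zsum_ge0// fine_ge0// esum_ge0// => z _; rewrite lee_fin.
rewrite /D zsumD//; last exact: abssumZ.
by rewrite zsumZ//; lra.
Qed.

Lemma phi0 : phi mu 0 = 1%E.
Proof.
rewrite phiE -[RHS]hmu.2; apply: esumT_eq => z; congr (_%:E).
rewrite /tilt (_ : dot 0 _ = 0) ?expR0 ?mulr1// /dot big1// => i _.
by rewrite mxE mul0r.
Qed.

Lemma Dset0 : Dset mu 0.
Proof. by rewrite /Dset/= phi0. Qed.

Lemma driftE i : drift mu 0 i = dphi mu 0 (delta_mx 0 i).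
Proof.
rewrite mxE /dphi; congr zsum; apply/funext => z.
rewrite dot_delta /tilt (_ : dot 0 _ = 0) ?expR0 ?mulr1 ?mxE// /dot big1// => j _.
by rewrite mxE mul0r.
Qed.

(** [phi] is a supremum of continuous finite subsums, hence lower semicontinuous. *)
Lemma Dset_closed : closed (Dset mu).
Proof.
pose f (F : set T) a : R := \sum_(z <- finmap.enum_fset (fset_set F)) tilt mu a z.
have -> : Dset mu = \bigcap_(F in [set F : set T | finite_set F]) (f F @^-1` [set x | x <= 1]).
  apply/seteqP; split => a /=.
    move=> Da F Ffin /=; rewrite -lee_fin; apply: le_trans Da.
    by apply: ereal_sup_ubound; exists F => //; rewrite fsbig_finite//= sumEFin.
  move=> h; apply: ge_ereal_sup => _ [F [Ffin _] <-].
  by rewrite fsbig_finite//= sumEFin lee_fin; exact: h.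
apply: closed_bigI => F _; apply: preimage_closed; last exact: closed_le.
move=> a _; apply: continuous_sumr => z {}a.
have cdot : continuous (fun x : 'rV[R]_d => dot x (zvec z)).
  apply: continuous_sumr => i b.
  have h := @coord_continuous R 1 d 0 i b.
  exact: (continuousM h (@cst_continuous _ _ (zvec z 0 i) b)).
have cexp := continuous_comp (cdot a) (@continuous_expR R _).
exact: (continuousM (@cst_continuous _ _ (mu z) a) cexp).
Qed.

(** A single term of [phi] gives a . z <= -ln mu(z) for each step z; adding along paths to e_i and
    -e_i bounds the coordinate on both sides. *)
Lemma Dset_coord_bound : exists B : R, forall a i, Dset mu a -> `|a 0 i| <= B.
Proof.
have step b i : exists B : R, forall a, Dset mu a -> dot a (zvec (uvec b i)) <= B.
  have [s [ps <-]] := irr b i.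
  have gen : forall y, path (fun y z => 0 < mu (z - y)) y s ->
     exists B : R, forall a, Dset mu a -> dot a (zvec (last y s)) <= dot a (zvec y) + B.
    elim: s {ps} => [|x s ih] y /=; first by move=> _; exists 0 => a _; rewrite addr0.
    move=> /andP[mx /ih[B hB]]; exists (B - ln (mu (x - y))) => a Da.
    apply: (le_trans (hB a Da)).
    have dotx : dot a (zvec x) = dot a (zvec (x - y)) + dot a (zvec y).
      rewrite /dot -big_split/=; apply: eq_bigr => j _.
      by rewrite -mulrDr !mxE -rmorphD subrK.
    have : ((tilt mu a (x - y))%:E <= 1%:E)%E.
      apply: le_trans Da; apply: (@ler_esumT R T (fun z => (tilt mu a z)%:E)) => z.
      by rewrite lee_fin tilt_ge0.
    rewrite lee_fin /tilt -ler_pdivlMl// mulr1 -[leRHS]lnK ?posrE ?invr_gt0//.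
    by rewrite ler_expR lnV ?posrE// dotx; lra.
  have [B hB] := gen 0 ps; exists B => a /hB.
  rewrite [dot a (zvec 0)](_ : _ = 0) ?add0r// /dot big1// => j _.
  by rewrite !mxE mulr0.
have stepc (p : bool * 'I_d) := step p.1 p.2.
have [f fP] := choice stepc.
exists (\sum_p `|f p|) => a i Da.
have fle p : f p <= \sum_p `|f p|.
  by rewrite (bigD1 p)//= -[leLHS]addr0 lerD ?ler_norm// sumr_ge0.
have dotu b : dot a (zvec (uvec b i)) = (if b then -1 else 1) * a 0 i.
  rewrite /dot (bigD1 i)//= big1 ?addr0 => [|j ji].
    by rewrite !mxE !eqxx/= mulr1 mulrC; case: b.
  by rewrite !mxE (negPf ji) mulr0 mulr0.
have h1 := fP (true, i) a Da; have h2 := fP (false, i) a Da.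
rewrite !dotu/= in h1 h2.
have := fle (true, i); have := fle (false, i).
by move=> g1 g2; rewrite ler_norml; apply/andP; split; lra.
Qed.

Lemma Dset_compact : compact (Dset mu).
Proof.
apply: bounded_closed_compact; last exact: Dset_closed.
have [B hB] := Dset_coord_bound.
exists `|B|; split; first by rewrite num_real.
move=> x Bx a Da.
rewrite /= [leLHS]/Num.norm /= mx_normrE; apply: bigmax_le => [|[j i] _ /=].
  by rewrite ltW// (le_lt_trans _ Bx).
rewrite (ord1 j); apply: (le_trans (hB a i Da)).
by rewrite ltW// (le_lt_trans (ler_norm _)).
Qed.

Hypothesis drift_neq0 : drift mu <> 0.

Lemma dot_self q : dot q q = enorm q ^+ 2.
Proof.
rewrite /enorm sqr_sqrtr; first by apply: eq_bigr => i _; rewrite expr2.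
by apply: sumr_ge0 => i _; rewrite sqr_ge0.
Qed.

Lemma dotC (v w : 'rV[R]_d) : dot v w = dot w v.
Proof. by apply: eq_bigr => i _; rewrite mulrC. Qed.

Lemma dphi_neq0 a : Dset mu a -> phi mu a = 1%E -> exists i, dphi mu a (delta_mx 0 i) != 0.
Proof.
move=> Da phia; apply/existsP; rewrite -negb_forall; apply/negP => /forallP g0.
have L0 v : dphi mu a v = 0.
  rewrite dphi_linear// big1// => i _.
  by have := g0 i; move=> /eqP ->; rewrite mulr0.
have min1 b : (1%:E <= phi mu b)%E.
  by have := phi_convex b Da; rewrite L0 phia addr0.
apply: drift_neq0; apply/rowP => i; rewrite driftE mxE.
have [r [r0 f1 f2 f3]] := phi_ray (delta_mx 0 i) Dset0.
have [_ [C [C0 h]]] := phi_taylor mu0 r0 f1 f2 f3.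
set L := dphi mu 0 _ in h *.
have LC s : `|s| <= r -> 0 <= s * L + C * s ^+ 2.
  move=> /h[x xE /andP[_ hx]]; have := min1 (0 + s *: delta_mx 0 i).
  by rewrite xE lee_fin => x1; move: hx; rewrite phi0 /=; lra.
apply/eqP/negPn/negP => Ln0.
have L20 : 0 < `|L| by rewrite normr_gt0.
have [s [s0 sr sC]] := exists_small C L20 r0.
have sC' : s * (s * C) < s * `|L| by rewrite ltr_pM2l.
have [Lp|Lp] := lerP 0 L.
  have := LC (- s); rewrite normrN gtr0_norm// => /(_ sr).
  by move: sC'; rewrite ger0_norm// expr2; lra.
have := LC s; rewrite gtr0_norm// => /(_ sr).
by move: sC'; rewrite ltr0_norm// expr2; lra.
Qed.

Lemma exponent_exists q : enorm q = 1 ->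
  exists a, phi mu a = 1%E /\ (enorm (grad_phi mu a))^-1 *: grad_phi mu a = q.
Proof.
move=> hq; have qq : dot q q = 1 by rewrite dot_self hq expr1n.
have cdot : continuous (fun x : 'rV[R]_d => dot x q).
  apply: continuous_sumr => i b.
  have h := @coord_continuous R 1 d 0 i b.
  exact: (continuousM h (@cst_continuous _ _ (q 0 i) b)).
have D0 : Dset mu !=set0 by exists 0; exact: Dset0.
have [a] := @EVT_max_rV R d (fun x => dot x q) (Dset mu) D0 Dset_compact
  (continuous_subspaceT cdot).
rewrite inE => Da amax.
pose g i := dphi mu a (delta_mx 0 i).
(* moving from the maximizer in a direction with v . q > 0 leaves {phi <= 1} *)
have key v : 0 < dot v q -> phi mu a = 1%E /\ 0 <= dphi mu a v.
  move=> vq; have [r [r0 f1 f2 f3]] := phi_ray v Da.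
  have [_ [C [C0 h]]] := phi_taylor mu0 r0 f1 f2 f3.
  have phi_fin : phi mu a = (fine (phi mu a))%:E.
    rewrite fineK// ge0_fin_numE//; apply: esum_ge0 => z _.
    by rewrite lee_fin (tilt_ge0 mu0).
  set F := fine (phi mu a) in phi_fin h.
  have F1 : F <= 1 by have := Da; rewrite /Dset/= phi_fin lee_fin.
  have out s : 0 < s -> s <= r -> 1 < F + s * dphi mu a v + C * s ^+ 2.
    move=> s0 sr; have := h s; rewrite gtr0_norm// => /(_ sr)[x xE /andP[_ hx]].
    apply: lt_le_trans hx; rewrite ltNge; apply/negP => x1.
    have Ds : Dset mu (a + s *: v) by rewrite /Dset/= xE lee_fin.
    have := amax (a + s *: v); rewrite inE => /(_ Ds).
    by rewrite dotD dotZ gerDl leNgt mulr_gt0.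
  set L := dphi mu a v in out *.
  have FE : F = 1.
    apply/eqP; rewrite eq_le F1/= leNgt; apply/negP => F1'.
    have gap : 0 < 1 - F by rewrite subr_gt0.
    have m0' : 0 < Num.min r 1 by rewrite lt_min r0 ltr01.
    have [s [s0]] := exists_small (`|L| + C) gap m0'.
    rewrite le_min => /andP[sr s1] hs.
    have := out s s0 sr.
    have : s * L <= s * `|L| by rewrite ler_pM2l// ler_norm.
    have : C * (s * s) <= C * (s * 1) by rewrite ler_wpM2l// ler_pM2l.
    by rewrite expr2; lra.
  split; first by rewrite phi_fin FE.
  rewrite leNgt; apply/negP => Lneg.
  have gap : 0 < - L by rewrite oppr_gt0.
  have [s [s0 sr hs]] := exists_small C gap r0.
  have : s * (s * C) < s * - L by rewrite ltr_pM2l.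
  by have := out s s0 sr; rewrite FE expr2; lra.
have [phia gq] : phi mu a = 1%E /\ 0 <= dphi mu a q by apply: key; rewrite qq.
exists a; split => //.
pose G := grad_phi mu a.
have GE i : G 0 i = dphi mu a (delta_mx 0 i) by rewrite /G grad_phiE.
have dphiG v : dphi mu a v = dot v G.
  by rewrite dphi_linear//; apply: eq_bigr => i _; rewrite GE.
have gq' : 0 <= dot q G by rewrite -dphiG.
(* [w] is the part of the gradient orthogonal to q. Testing [key] with c q - w gives |w|^2 <= c q .
   G for every c > 0, hence w = 0. *)
pose w := G - dot q G *: q.
have wq : dot w q = 0.
  by rewrite /w -scaleNr dotD dotZ qq (dotC G); lra.
have ww : dot w G = dot w w.
  by rewrite {3}/w -scaleNr (dotC w (_ + _)) dotD dotZ (dotC q w) wq mulr0 addr0 dotC.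
have w0 : dot w w <= 0.
  apply/ler_addgt0Pr => e e0.
  have den : 0 < dot q G + 1 by rewrite ltr_wpDl.
  pose c := e / (dot q G + 1).
  have c0 : 0 < c by rewrite divr_gt0.
  have vq : 0 < dot (c *: q + (-1) *: w) q by rewrite dotD !dotZ wq qq; lra.
  have [_] := key _ vq; rewrite dphiG dotD !dotZ ww.
  have : c * dot q G <= e.
    rewrite /c mulrAC ler_pdivrMr// ler_pM2l//; lra.
  lra.
have wE : w = 0.
  apply/rowP => i; rewrite [RHS]mxE; apply/eqP; rewrite -sqrf_eq0; apply/eqP.
  have s0 : \sum_i w 0 i ^+ 2 == 0.
    rewrite eq_le sumr_ge0 ?andbT => [|j _]; last exact: sqr_ge0.
    by apply: le_trans w0; rewrite /dot; apply: ler_sum => j _; rewrite expr2.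
  move: s0; rewrite psumr_eq0 => [/allP/(_ i)|j _]; last exact: sqr_ge0.
  by rewrite mem_index_enum => /(_ isT)/eqP.
have Gq : G = dot q G *: q by apply/eqP; rewrite -subr_eq0 -/w wE.
have qGn0 : dot q G != 0.
  apply/eqP => h0; have [i] := dphi_neq0 Da phia.
  by rewrite -GE Gq h0 scale0r mxE eqxx.
have enG : enorm G = dot q G.
  have : enorm G ^+ 2 = dot q G ^+ 2.
    by rewrite -dot_self {1}Gq dotZ expr2.
  by move=> /eqP; rewrite eqrXn2// ?sqrtr_ge0// => /eqP.
by rewrite -/G enG {2}Gq scalerA mulVf// scale1r.
Qed.

(** Supplies the hypothesis [mgf] of the drifting walk for the tilted law: [kap] is the norm of the
    gradient at a(q), and finitely many axes allow common constants. *)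
Lemma a_of_spec q : enorm q = 1 -> (forall i, 0 < q 0 i) ->
  phi mu (a_of mu q) = 1%E /\
  exists kap C s0 : R, [/\ 0 < kap, 0 <= C, 0 < s0 & forall i s, `|s| <= s0 ->
  (\esum_(z in setT) (tilt mu (a_of mu q) z * axis s i z)%:E <=
     (1 + s * (kap * q 0 i) + C * s ^+ 2)%:E)%E].
Proof.
move=> hq q0; have [phia gradE] := xgetPex 0 (exponent_exists hq).
rewrite -/(a_of mu q) in phia gradE; set a := a_of mu q in phia gradE *.
split => //.
have Da : Dset mu a by rewrite /Dset/= phia.
pose kap := enorm (grad_phi mu a).
have kap0 : 0 < kap.
  rewrite lt_def sqrtr_ge0 andbT; apply/eqP => k0.
  move: gradE; rewrite -/kap k0 invr0 scale0r => qE.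
  by move: hq; rewrite -qE /enorm big1 ?sqrtr0 => [/eqP|i _]; rewrite ?mxE ?expr0n// eq_sym oner_eq0.
have gE i : dphi mu a (delta_mx 0 i) = kap * q 0 i.
  have -> : q 0 i = kap^-1 * grad_phi mu a 0 i by rewrite -[in LHS]gradE [LHS]mxE.
  by rewrite -grad_phiE// mulrA divff ?mul1r// gt_eqF.
have hi i : exists p : R * R, [/\ 0 < p.1, 0 <= p.2 & forall s, `|s| <= p.1 ->
  (\esum_(z in setT) (tilt mu a z * axis s i z)%:E <=
     (1 + s * (kap * q 0 i) + p.2 * s ^+ 2)%:E)%E].
  have [r [r0 f1 f2 f3]] := phi_ray (delta_mx 0 i) Da.
  have [_ [C [C0 h]]] := phi_taylor mu0 r0 f1 f2 f3.
  exists (r, C); split => //= s /h[x xE /andP[_ hx]].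
  rewrite (_ : \esum_(z in setT) _ = phi mu (a + s *: delta_mx 0 i)).
    by rewrite xE lee_fin (le_trans hx)// phia gE.
  by apply: esumT_eq => z; rewrite -/(tilt _ _ _) tiltDZ dot_delta /axis mxE.
have [f fP] := choice hi.
have f10 i : 0 < (f i).1 by have [] := fP i.
have f20 i : 0 <= (f i).2 by have [] := fP i.
have [s0 [s00 _ s0f]] := exists_pos_lower f10.
exists kap, (\sum_i (f i).2), s0; split => //; first exact: sumr_ge0.
move=> i s ss0; have [_ _ h] := fP i.
apply: (le_trans (h s (le_trans ss0 (s0f i)))).
rewrite lee_fin lerD2l ler_wpM2r ?sqr_ge0//.
by rewrite (bigD1 i)//= lerDl sumr_ge0.
Qed.

End exponent.

(** * Events of the random walk *)

Section countable_partitions.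
Context {R : realType} {dO : measure_display} {Om : measurableType dO} {I : countType}.

(** Transfers sums to series over nat through the codes of elements of [I]; numbers that code
    nothing contribute 0. *)
Lemma esum_pickle (f : I -> \bar R) : (forall i, 0 <= f i)%E ->
  (\sum_(k <oo) (if pickle_inv k is Some i then f i else 0) = \esum_(i in setT) f i)%E.
Proof.
move=> f0.
rewrite nneseries_esumT; last by move=> n; case: pickle_inv.
transitivity (\esum_(k in [set (pickle i : nat) | i in [set: I]])
    (if pickle_inv k is Some i then f i else 0))%E.
  rewrite [RHS]esum_mkcond; apply: esumT_eq => k.
  case: ifPn => //; rewrite notin_setE => kn.
  case E : (pickle_inv k) => [i|//].
  by exfalso; apply: kn; exists i => //; have := @pickle_invK I k; rewrite E.
rewrite esum_image; last by move=> i j _ _; exact: (pcan_inj pickleK).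
by apply: esumT_eq => i; rewrite pickleK_inv.
Qed.

Lemma measurable_bigcup_count (F : I -> set Om) :
  (forall i, measurable (F i)) -> measurable (\bigcup_i F i).
Proof.
move=> mF.
have -> : \bigcup_i F i = \bigcup_k (if @pickle_inv I k is Some i then F i else set0).
  apply/seteqP; split => w [i _ Fw].
    by exists (pickle i) => //; rewrite pickleK_inv.
  by case E : (pickle_inv i) Fw => [j|//] Fw; exists j.
by apply: bigcup_measurable => k _; case: pickle_inv => //.
Qed.

Lemma measure_partition (mP : probability Om R) (A : set Om) (F : I -> set Om) :
  measurable A -> (forall i, measurable (F i)) ->
  (forall w, exists i, F i w) -> (forall i j w, F i w -> F j w -> i = j) ->
  mP A = \esum_(i in setT) mP (A `&` F i).
Proof.
move=> mA mF covF disjF.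
rewrite -esum_pickle; last by move=> i; exact: measure_ge0.
pose B k := if @pickle_inv I k is Some i then A `&` F i else set0.
have AE : A = \bigcup_k B k.
  apply/seteqP; split => w.
    move=> Aw; have [i Fi] := covF w; exists (pickle i) => //.
    by rewrite /B pickleK_inv.
  by move=> [k _]; rewrite /B; case: pickle_inv => // i [].
rewrite [in LHS]AE (measure_bigcup mP setT B).
- rewrite (eq_eseriesl (Q := xpredT)); last by move=> k; rewrite in_setT.
  by apply: eq_eseriesr => k _ /=; rewrite /B; case: pickle_inv => [i|]//; rewrite measure0.
- by move=> k _; rewrite /B; case: pickle_inv => // i; exact: measurableI.
- move=> j k _ _ [w []]; rewrite /B.
  case Ej : (pickle_inv j) => [i|//] [_ Fi]; case Ek : (pickle_inv k) => [i'|//] [_ Fi'].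
  have ii := disjF _ _ _ Fi Fi'.
  have := @pickle_invK I j; have := @pickle_invK I k; rewrite Ej Ek /= ii.
  by move=> <- <-.
Qed.

Lemma integral_count_cst (mP : probability Om R) (F : I -> set Om)
    (c : I -> R) (f : Om -> \bar R) :
  (forall i, measurable (F i)) -> (forall i, 0 <= c i) ->
  (forall i j w, F i w -> F j w -> i = j) ->
  (forall i w, F i w -> f w = (c i)%:E) -> (forall w, (forall i, ~ F i w) -> f w = 0%E) ->
  (\int[mP]_w f w = \esum_(i in setT) ((c i)%:E * mP (F i)))%E.
Proof.
move=> mF c0 disjF fF f0.
have g0 i w : (0 <= (c i * \1_(F i) w)%:E)%E by rewrite lee_fin mulr_ge0.
pose g k w : \bar R := if @pickle_inv I k is Some i then (c i * \1_(F i) w)%:E else 0%E.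
have gg0 k w : (0 <= g k w)%E by rewrite /g; case: pickle_inv.
have -> : f = fun w => (\sum_(k <oo) g k w)%E.
  apply/funext => w; rewrite esum_pickle//.
  have [[i Fi]|none] := pselect (exists i, F i w).
    rewrite (fF i w Fi) (@esum_supp1 _ _ _ i)//.
      by rewrite indicE mem_set// mulr1.
    move=> j ji; rewrite indicE memNset ?mulr0// => Fj.
    by move: ji; rewrite (disjF _ _ _ Fj Fi) eqxx.
  rewrite f0; last by move=> i Fi; apply: none; exists i.
  rewrite esum1// => i _; rewrite indicE memNset ?mulr0// => Fi.
  by apply: none; exists i.
rewrite integral_nneseries//; last first.
  move=> k; rewrite /g; case: pickle_inv => [i|]; last exact: measurable_cst.
  by apply/measurable_EFinP; apply: measurable_funM => //; exact: measurable_indic.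
rewrite -esum_pickle; last by move=> i; rewrite mule_ge0 ?lee_fin.
apply: eq_eseriesr => k _; rewrite /g; case: pickle_inv => [i|]; last first.
  by rewrite integral0.
rewrite (integralZl_indic measurableT (fun=> F i))//; last first.
  by move=> ci; have := c0 i; rewrite leNgt ci.
by rewrite integral_indic// setIT.
Qed.

End countable_partitions.

(** * Path probabilities and the killed kernels *)

Section walk_kernels.
Context {R : realType} {d : nat} {dO : measure_display} {Om : measurableType dO}.
Local Notation T := 'rV[int]_d.
Variables (mu : T -> R) (P : T -> probability Om R) (S : nat -> Om -> T).
Hypothesis mu0 : forall z, 0 <= mu z.
Hypothesis hS : random_walk P S mu.

Lemma measurable_state n (Q : set T) : measurable [set w | Q (S n w)].
Proof.
have -> : [set w | Q (S n w)] = \bigcup_(z : T) (if `[< Q z >] then [set w | S n w = z] else set0).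
  apply/seteqP; split => w /=.
    by move=> Qw; exists (S n w) => //; rewrite asboolT.
  by move=> [z _]; case: ifPn => // /asboolP Qz /= ->.
by apply: measurable_bigcup_count => z; case: ifP => // _; exact: hS.1.
Qed.

Definition alive n : set Om := [set w | forall k, (k <= n)%N -> posb (S k w)].

Lemma measurable_alive n : measurable (alive n).
Proof.
have -> : alive n = \bigcap_(k in [set k | (k <= n)%N]) [set w | posb (S k w)].
  by apply/seteqP; split => w h k /= kn; apply: h.
apply: bigcap_measurable; first by exists 0%N.
by move=> k _; exact: (measurable_state k (fun z => posb z)).
Qed.

Lemma alive0 w : alive 0 w <-> posb (S 0 w).
Proof. by split => [/(_ 0%N (leqnn _))//|h k]; rewrite leqn0 => /eqP ->. Qed.

Lemma aliveS n w : alive n.+1 w <-> alive n w /\ posb (S n.+1 w).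
Proof.
split => [h|[h hn] k].
  by split => [k kn|]; [apply: h; exact: leq_trans kn _|exact: h].
by rewrite leq_eqVlt => /orP[/eqP -> //|]; rewrite ltnS => /h.
Qed.

(** Paths are tuples rather than functions on nat, so that the cylinders form a countable
    partition. *)
Definition cyl n (p : n.+1.-tuple T) : set Om :=
  [set w | forall k, (k <= n)%N -> S k w = nth 0 p k].

Lemma cylP x n p : P x (@cyl n p) =
  ((nth 0 p 0 == x)%:R * \prod_(k < n) mu (nth 0 p k.+1 - nth 0 p k))%:E.
Proof. exact: (hS.2 x n (nth 0 p)). Qed.

Lemma measurable_cyl n p : measurable (@cyl n p).
Proof.
have -> : cyl p = \bigcap_(k in [set k | (k <= n)%N]) [set w | S k w = nth 0 p k].
  by apply/seteqP; split => w h k /= kn; apply: h.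
by apply: bigcap_measurable; [exists 0%N|move=> k _; exact: hS.1].
Qed.

Lemma cyl_cover n w : exists p, @cyl n p w.
Proof.
have sz : size (mkseq (fun k => S k w) n.+1) == n.+1 by rewrite size_mkseq.
by exists (Tuple sz) => k kn /=; rewrite nth_mkseq.
Qed.

Lemma cyl_disj n (p p' : n.+1.-tuple T) w : cyl p w -> cyl p' w -> p = p'.
Proof.
move=> h h'; apply: val_inj; apply: (@eq_from_nth _ 0); rewrite !size_tuple// => k kn.
by rewrite -h// h'.
Qed.

(** The Markov property at time n: both events are cut along the paths up to time n, and appending
    [z] multiplies the mass of a cylinder by mu(z - y). *)
Lemma alive_step x n y z :
  P x [set w | [/\ S n w = y, alive n w & S n.+1 w = z]] =
  (P x [set w | S n w = y /\ alive n w] * (mu (z - y))%:E)%E.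
Proof.
have mA : measurable [set w | S n w = y /\ alive n w].
  by apply: measurableI; [exact: hS.1|exact: measurable_alive].
have mB : measurable [set w | [/\ S n w = y, alive n w & S n.+1 w = z]].
  rewrite (_ : [set w | _] = [set w | S n w = y /\ alive n w] `&` [set w | S n.+1 w = z]).
    by apply: measurableI => //; exact: hS.1.
  by apply/seteqP; split => w /=; [move=> []|move=> [[]]].
rewrite (measure_partition (P x) mB (@measurable_cyl n) (@cyl_cover n) (@cyl_disj n)).
rewrite (measure_partition (P x) mA (@measurable_cyl n) (@cyl_cover n) (@cyl_disj n)).
rewrite -esumZr ?lee_fin//.
apply: esumT_eq => p.
have [[py pa]|no] := pselect (nth 0 p n = y /\ forall k, (k <= n)%N -> posb (nth 0 p k)); last first.
  have -> : [set w | [/\ S n w = y, alive n w & S n.+1 w = z]] `&` cyl p = set0.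
    apply/seteqP; split => w //= [[Sy Sa _] cw]; apply: no; split.
      by rewrite -cw.
    by move=> k kn; rewrite -cw//; exact: Sa.
  have -> : [set w | S n w = y /\ alive n w] `&` cyl p = set0.
    apply/seteqP; split => w //= [[Sy Sa] cw]; apply: no; split.
      by rewrite -cw.
    by move=> k kn; rewrite -cw//; exact: Sa.
  by rewrite measure0 mul0e.
have -> : [set w | S n w = y /\ alive n w] `&` cyl p = cyl p.
  apply: setIidr => w cw; split; first by rewrite cw.
  by move=> k kn; rewrite cw//; exact: pa.
have -> : [set w | [/\ S n w = y, alive n w & S n.+1 w = z]] `&` cyl p = cyl (rcons_tuple p z).
  apply/seteqP; split => w /=.
    move=> [[Sy Sa Sz] cw] k; rewrite leq_eqVlt => /orP[/eqP ->|].
      by rewrite nth_rcons size_tuple ltnn eqxx.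
    by rewrite ltnS => kn; rewrite nth_rcons size_tuple ltnS kn cw.
  move=> cw; have cw' : cyl p w.
    by move=> k kn; rewrite cw ?(leq_trans kn)// nth_rcons size_tuple ltnS kn.
  split => //; split; first by rewrite cw'.
    by move=> k kn; rewrite cw'//; exact: pa.
  by rewrite cw// nth_rcons size_tuple ltnn eqxx.
rewrite !cylP -EFinM; congr (_%:E).
rewrite big_ord_recr/= !nth_rcons size_tuple/= ltnn eqxx ltnSn py mulrA.
congr (_ * _ * _); apply: eq_bigr => k _.
by rewrite !nth_rcons size_tuple !ltnS ltn_ord (ltnW (ltn_ord k)).
Qed.

(** [posb x] reconciles [alive], which includes time 0, with [kpow], which leaves the starting point
    free. *)
Lemma walk_kpow x n y : posb x ->
  P x [set w | S n w = y /\ alive n w] = kpow mu posb n x y.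
Proof.
move=> px; elim: n y => [|n ih] y.
  have := hS.2 x 0%N (fun=> y); rewrite big_ord0 mulr1 => h0.
  rewrite [RHS]/=; case: (boolP (posb y)) => py.
    rewrite (_ : [set w | _] = [set w | forall k, (k <= 0)%N -> S k w = y]) ?h0 1?eq_sym//.
    apply/seteqP; split => w /=.
      by move=> [Sy _] k; rewrite leqn0 => /eqP ->.
    move=> h; have Sy := h 0%N (leqnn _); split => //.
    by apply/alive0; rewrite Sy.
  rewrite (_ : [set w | _] = set0) ?measure0.
    by case: eqP => // xy; move: py; rewrite -xy px.
  by apply/seteqP; split => w //= -[Sy /alive0]; rewrite Sy (negPf py).
rewrite kpow_forward//; case: ifPn => py; last first.
  rewrite (_ : [set w | _] = set0) ?measure0//.
  by apply/seteqP; split => w //= -[Sy /aliveS[_]]; rewrite Sy (negPf py).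
have mE : measurable [set w | S n.+1 w = y /\ alive n.+1 w].
  by apply: measurableI; [exact: hS.1|exact: measurable_alive].
rewrite (measure_partition (F := fun z => [set w | S n w = z]) (P x) mE).
- apply: esumT_eq => z; rewrite -ih -alive_step; congr (P x _).
  apply/seteqP; split => w /=.
    by move=> [[Sy /aliveS[ha _]] Sz].
  by move=> [Sz ha Sy]; split => //; split => //; apply/aliveS; rewrite Sy.
- by move=> z; exact: hS.1.
- by move=> w; exists (S n w).
- by move=> i j w /= <- <-.
Qed.

Lemma walk_kexit x n b : posb x -> ~~ posb b ->
  P x [set w | alive n w /\ S n.+1 w = b] = kexit mu posb n x b.
Proof.
move=> px pb; rewrite /kexit (negPf pb).
have mE : measurable [set w | alive n w /\ S n.+1 w = b].
  by apply: measurableI; [exact: measurable_alive|exact: hS.1].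
rewrite (measure_partition (F := fun z => [set w | S n w = z]) (P x) mE).
- apply: esumT_eq => z; rewrite -walk_kpow// -alive_step; congr (P x _).
  by apply/seteqP; split => w /=; [move=> [[]]|move=> []].
- by move=> z; exact: hS.1.
- by move=> w; exists (S n w).
- by move=> i j w /= <- <-.
Qed.

Lemma exitedE w n : exited S w n = ~~ posb (S n w).
Proof.
rewrite /exited /posb negb_forall; apply: eq_existsb => i.
by rewrite leNgt.
Qed.

Lemma tau_gtE n w : tau_gt S n w <-> alive n w.
Proof.
rewrite /tau_gt /tau; case: pselect => [ex|none].
  case: ex_minnP => t ext mint; split => [nt k kn|h].
    apply: contraT => npk; have := mint k; rewrite exitedE npk => /(_ isT).
    by rewrite leqNgt (leq_ltn_trans kn nt).
  by rewrite ltnNge; apply/negP => tn; move: ext; rewrite exitedE h.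
split => // _ k kn; apply: contraT => npk; exfalso; apply: none.
by exists k; rewrite exitedE.
Qed.

Lemma tau_someE n w : tau S w = Some n <-> ~~ posb (S n w) /\ forall k, (k < n)%N -> posb (S k w).
Proof.
rewrite /tau; case: pselect => [ex|none].
  case: ex_minnP => t ext mint; split.
    move=> [<-]; split; first by rewrite -exitedE.
    move=> k kt; apply: contraT => npk; have := mint k.
    by rewrite exitedE npk leqNgt kt => /(_ isT).
  move=> [npn hn]; congr Some; apply/eqP; rewrite eqn_leq mint ?exitedE//=.
  by rewrite leqNgt; apply/negP => /hn; apply/negP; rewrite -exitedE.
by split => // -[npn _]; exfalso; apply: none; exists n; rewrite exitedE.
Qed.

Lemma greenE x x' : posb x -> green P S x x' = kgreen mu posb x x'.
Proof.
move=> px; rewrite /green /kgreen nneseries_esumT.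
  apply: esumT_eq => n; rewrite -walk_kpow//; congr (P x _).
  by apply/seteqP; split => w /= -[Sx /tau_gtE h]; split => //; exact/tau_gtE.
by move=> n; exact: measure_ge0.
Qed.

Lemma exit_expectationE a x : posb x ->
  (exit_expectation P S a x = \esum_(n in setT) \esum_(b in setT)
    (kexit mu posb n x b * (expR (dot a (zvec b)))%:E))%E.
Proof.
move=> px; rewrite /exit_expectation.
pose F (p : nat * T) := [set w | tau S w = Some p.1 /\ S p.1 w = p.2].
have tau0 : measurable [set w | tau S w = Some 0%N].
  rewrite (_ : [set w | _] = [set w | (fun z => ~~ posb z) (S 0 w)]).
    exact: (measurable_state 0 (fun z => ~~ posb z)).
  by apply/seteqP; split => w /= => [/tau_someE[]//|h]; apply/tau_someE.
have tauS n : [set w | tau S w = Some n.+1] = alive n `&` [set w | ~~ posb (S n.+1 w)].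
  apply/seteqP; split => w /=.
    by move=> /tau_someE[h1 h2]; split => // k kn; exact: h2.
  by move=> [h1 h2]; apply/tau_someE; split => // k kn; exact: h1.
have mtau n : measurable [set w | tau S w = Some n].
  case: n => [//|n]; rewrite tauS; apply: measurableI; first exact: measurable_alive.
  exact: (measurable_state n.+1 (fun z => ~~ posb z)).
have mF p : measurable (F p) by apply: measurableI; [exact: mtau|exact: hS.1].
rewrite (@integral_count_cst _ _ _ _ (P x) F (fun p => expR (dot a (zvec p.2)))).
- transitivity (\esum_(p in setT `*`` (fun=> setT)) ((expR (dot a (zvec p.2)))%:E * P x (F p)))%E.
    by congr esum; apply/seteqP; split.
  rewrite -(@esum_esum R _ _ setT (fun=> setT)
      (fun n b => ((expR (dot a (zvec b)))%:E * P x (F (n, b)))%E)); last first.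
    by move=> n b _ _; rewrite mule_ge0 ?lee_fin ?expR_ge0.
  (* Exit at time 0 is null when the start lies in the orthant, and tau = n + 1 corresponds to
     [kexit] at index n. *)
  rewrite esum_nat_recl; last by move=> n; apply: esum_ge0 => b _; rewrite mule_ge0 ?lee_fin ?expR_ge0.
  rewrite esum1 ?add0e; last first.
    move=> b _; rewrite (_ : P x (F (0%N, b)) = 0%E) ?mule0//.
    have := hS.2 x 0%N (fun=> b); rewrite big_ord0 mulr1.
    case: (eqVneq b x) => [->|bx] /= h0.
      rewrite (_ : F _ = set0) ?measure0//; apply/seteqP; split => w //=.
      by rewrite /F/= => -[/tau_someE[+ _] Sx]; rewrite Sx px.
    apply/eqP; rewrite eq_le measure_ge0 andbT.
    apply: (@le_trans _ _ (P x [set w | forall k, (k <= 0)%N -> S k w = b])); last by rewrite h0.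
    apply: le_measure; rewrite ?inE//.
      rewrite (_ : [set w | _] = [set w | S 0 w = b]); first exact: hS.1.
      by apply/seteqP; split => w /= => [h|h k]; [exact: h|rewrite leqn0 => /eqP ->].
    by move=> w [_ Sb] k; rewrite leqn0 => /eqP ->.
  apply: esumT_eq => n; apply: esumT_eq => b; rewrite muleC; congr (_ * _)%E.
  case: (boolP (posb b)) => pb.
    rewrite /kexit pb (_ : F _ = set0) ?measure0//; apply/seteqP; split => w //=.
    by rewrite /F/= => -[/tau_someE[+ _] Sx]; rewrite Sx pb.
  rewrite -walk_kexit//; congr (P x _); apply/seteqP; split => w; rewrite /F/=.
    by move=> [h Sb]; split => //; have : [set w | tau S w = Some n.+1] w by []; rewrite tauS => -[].
  move=> [h Sb]; split => //; suff : [set w | tau S w = Some n.+1] w by [].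
  by rewrite tauS; split => //=; rewrite Sb.
- exact: mF.
- by move=> p; exact: expR_ge0.
- by move=> [n b] [n' b'] w [/= h1 h2] [/= h3 h4]; move: h3 h4; rewrite h1 => -[<-]; rewrite h2 => ->.
- by move=> [n b] w [/= -> ->].
move=> w hw; case E : (tau S w) => [n|//].
by exfalso; apply: (hw (n, S n w)).
Qed.

(** The exponential factors telescope along a path, so only its endpoints remain. *)
Lemma kpow_tilt a n x y : kpow (tilt mu a) posb n x y =
  (kpow mu posb n x y * (expR (dot a (zvec (y - x))))%:E)%E.
Proof.
have zB (u v : T) : zvec (u - v) = zvec u - zvec v :> 'rV[R]_d.
  by apply/rowP => i; rewrite !mxE rmorphB.
elim: n x => [|n ih] x /=.
  case: eqP => [->|]; last by rewrite !mul0e.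
  rewrite subrr mul1e (_ : dot a _ = 0) ?expR0// /dot big1// => i _.
  by rewrite !mxE mulr0.
rewrite -esumZr ?lee_fin ?expR_ge0//; last first.
  by move=> z; case: ifP => // _; rewrite mule_ge0 ?lee_fin// kpow_ge0.
apply: esumT_eq => z; case: ifP => _; last by rewrite mul0e.
rewrite ih /tilt EFinM -!muleA; congr (_ * _)%E.
rewrite muleCA; congr (_ * _)%E; rewrite -EFinM -expRD; congr (expR _)%:E.
by rewrite /dot -big_split/=; apply: eq_bigr => i _; rewrite !mxE !rmorphB -mulrDr/=; congr (_ * _); ring.
Qed.

Lemma kexit_tilt a n x b : kexit (tilt mu a) posb n x b =
  (kexit mu posb n x b * (expR (dot a (zvec (b - x))))%:E)%E.
Proof.
rewrite /kexit; case: ifP => _; first by rewrite mul0e.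
rewrite -esumZr ?lee_fin ?expR_ge0//; last first.
  by move=> z; rewrite mule_ge0 ?lee_fin// kpow_ge0.
apply: esumT_eq => y; rewrite kpow_tilt /tilt EFinM -!muleA; congr (_ * _)%E.
rewrite muleCA; congr (_ * _)%E; rewrite -EFinM -expRD; congr (expR _)%:E.
by rewrite /dot -big_split/=; apply: eq_bigr => i _; rewrite !mxE !rmorphB -mulrDr/=; congr (_ * _); ring.
Qed.

End walk_kernels.

(** * The killed walk in a positive direction *)

Section positive_direction.
Context {R : realType} {d : nat} {dO : measure_display} {Om : measurableType dO}.
Local Notation T := 'rV[int]_d.
Variables (mu : T -> R) (P : T -> probability Om R) (S : nat -> Om -> T).
Hypothesis hd : (1 <= d)%N.
Hypothesis hmu : is_prob mu.
Hypothesis hS : random_walk P S mu.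
Hypothesis irr : forall L : {set 'I_d}, irreducible_on mu L.
Hypothesis fin_phi : finite_near_Dset mu.
Hypothesis drift_neq0 : drift mu <> 0.
Variable q : 'rV[R]_d.
Hypothesis hq : enorm q = 1.
Hypothesis q_gt0 : forall i, 0 < q 0 i.

Let mu0 : forall z, 0 <= mu z := hmu.1.
Let a := a_of mu q.
Let m := tilt mu a.

Let m_ge0 z : 0 <= m z. Proof. exact: tilt_ge0. Qed.

Lemma posbP (x : T) : reflect (pos_orthant x) (posb x).
Proof. exact: forallP. Qed.

(** Full index set: paths inside the orthant. The empty set, just below, gives paths in the whole
    lattice. *)
Lemma orthantT (x : T) : orthant [set: 'I_d]%SET x = posb x.
Proof. by apply: eq_forallb => i; rewrite finset.in_setT. Qed.

Lemma orthant0 (x : T) : orthant (finset.set0 : {set 'I_d}) x.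
Proof. by apply/forallP => i; rewrite finset.in_set0. Qed.

Lemma tilt_gt0 (z : T) : (0 < m z) = (0 < mu z).
Proof. by rewrite /m /tilt pmulr_lgt0 ?expR_gt0. Qed.

Lemma unit_paths b (i : 'I_d) : exists s,
  path (fun y z => 0 < mu (z - y)) 0 s /\ last 0 s = uvec b i.
Proof.
by have [s [ps _ ls]] := irr (orthant0 0) (orthant0 (uvec b i)); exists s.
Qed.

Lemma tilt_unit_paths b (i : 'I_d) : exists s,
  path (fun y z => 0 < m (z - y)) 0 s /\ last 0 s = uvec b i.
Proof.
have [s [ps ls]] := unit_paths b i; exists s; split => //.
by apply: sub_path ps => y z; rewrite tilt_gt0.
Qed.

Lemma tilt_pos_paths (x x' : T) : posb x -> posb x' -> exists s,
  [/\ path (fun y z => 0 < m (z - y)) x s, all (@posb d) s & last x s = x'].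
Proof.
rewrite -!orthantT => px px'; have [s [ps alls ls]] := irr px px'; exists s; split => //.
  by apply: sub_path ps => y z; rewrite tilt_gt0.
by apply: sub_all alls => z; rewrite orthantT.
Qed.

Lemma direction_le1 i : q 0 i <= 1.
Proof.
have q0 := ltW (q_gt0 i).
rewrite -(ler_pXn2r (n := 2))// ?nnegrE//.
rewrite expr1n -[leRHS](expr1n _ 2) -hq /enorm sqr_sqrtr; last first.
  by apply: sumr_ge0 => j _; rewrite sqr_ge0.
by rewrite (bigD1 i)//= lerDl sumr_ge0// => j _; rewrite sqr_ge0.
Qed.

Let spec := a_of_spec hmu fin_phi unit_paths drift_neq0 hq q_gt0.

Let m1 : \esum_(z in setT) (m z)%:E = 1%E.
Proof. by have [h _] := spec; rewrite -h. Qed.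

Let i0 : 'I_d := Ordinal hd.

Let esc := escape m.

Lemma tilted_escape_gt0 (x : T) : posb x -> 0 < esc x.
Proof.
have [_ [kap [C [s0 [kap0 C0 s00 mgf]]]]] := spec.
exact: (escape_gt0 m_ge0 m1 kap0 C0 s00 q_gt0 mgf tilt_pos_paths).
Qed.

Lemma zvecB (u v : T) : zvec (u - v) = zvec u - zvec v :> 'rV[R]_d.
Proof. by apply/rowP => i; rewrite !mxE rmorphB. Qed.

Lemma dotB (u v : T) : dot a (zvec (u - v)) = dot a (zvec u) - dot a (zvec v).
Proof.
rewrite zvecB (dotC a) -scaleN1r dotD dotZ !(dotC _ a); lra.
Qed.

Lemma h_E (x : T) : posb x -> h_ P S mu q x = expR (dot a (zvec x)) * esc x.
Proof.
move=> px; rewrite /h_ -/a (exit_expectationE mu0 hS)//.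
have e0 n b : (0 <= kexit m (@posb d) n x b)%E by exact: kexit_ge0.
have -> : (\esum_(n in setT) \esum_(b in setT) (kexit mu (@posb d) n x b * (expR (dot a (zvec b)))%:E) =
  (expR (dot a (zvec x)))%:E * exit_prob m (@posb d) x)%E.
  rewrite /exit_prob /exit_law esum_exchange; last first.
    by move=> n b; rewrite mule_ge0 ?lee_fin ?expR_ge0// kexit_ge0.
  have ex0 : (0 <= (expR (dot a (zvec x)))%:E)%E by rewrite lee_fin expR_ge0.
  rewrite -esumZl//; last by move=> b; apply: esum_ge0.
  apply: esumT_eq => b; rewrite -(esumZl setT ex0 (e0^~ b)).
  apply: esumT_eq => n; rewrite kexit_tilt// muleCA; congr (_ * _)%E.
  by rewrite -EFinM -expRD dotB addrC subrK.
rewrite exit_probE// -EFinM /= /esc; lra.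
Qed.

Lemma h_gt0 (x : T) : posb x -> 0 < h_ P S mu q x.
Proof. by move=> px; rewrite h_E// mulr_gt0 ?expR_gt0// tilted_escape_gt0. Qed.

(** Harmonicity of the escape probability, conjugated by exp(a . x). All terms on the orthant are
    nonnegative, so [zsum] reduces to one sum. *)
Lemma h_harmonic : harmonic_killed mu (h_ P S mu q).
Proof.
move=> x /posbP px.
have h0 z : posb z -> 0 <= mu (z - x) * h_ P S mu q z.
  by move=> pz; rewrite mulr_ge0// ltW// h_gt0.
have eqS : \esum_(z in (pos_orthant : set T)) (mu (z - x) * h_ P S mu q z)%:E = (h_ P S mu q x)%:E.
  rewrite h_E// EFinM -(escape_harmonic m_ge0 m1 x).
  rewrite -esumZl ?lee_fin ?expR_ge0//; last first.
    by move=> z; case: ifP => // pz; rewrite lee_fin mulr_ge0// escape_ge0.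
  rewrite esum_mkcond; apply: esumT_eq => z.
  have -> : (z \in (pos_orthant : set T)) = posb z by apply/idP/idP => [/set_mem/posbP|/posbP/mem_set].
  case: ifP => pz; last by rewrite mule0.
  rewrite -EFinM h_E// /m /tilt dotB expRB; congr (_%:E).
  by rewrite /esc; field; rewrite gt_eqF// expR_gt0.
split.
  rewrite /summable (eq_esum (b := fun z => (mu (z - x) * h_ P S mu q z)%:E)); first by rewrite eqS ltry.
  by move=> z /posbP pz; rewrite gee0_abs// lee_fin h0.
rewrite /zsum (eq_esum (b := fun z => (mu (z - x) * h_ P S mu q z)%:E)); last first.
  by move=> z /posbP pz; rewrite funeposE max_l// lee_fin h0.
rewrite [X in (_ - X)%E]esum1; last first.
  by move=> z /posbP pz; rewrite funenegE max_r// -EFinN lee_fin oppr_le0 h0.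
by rewrite sube0 eqS.
Qed.

Lemma green_ratioE (x x0 y : T) : posb x -> posb x0 ->
  green_ratio P S x0 x y =
  expR (dot a (zvec x)) / expR (dot a (zvec x0)) * (KG m x y / KG m x0 y).
Proof.
have kE (w : T) : posb w -> fine (green P S w y) =
    expR (dot a (zvec w)) * KG m w y / expR (dot a (zvec y)).
  move=> pw; rewrite (greenE mu0 hS)//.
  have -> : kgreen mu (@posb d) w y =
      ((expR (dot a (zvec w)) / expR (dot a (zvec y)))%:E * kgreen m (@posb d) w y)%E.
    have ex0 : 0 <= expR (dot a (zvec w)) / expR (dot a (zvec y)) by rewrite divr_ge0 ?expR_ge0.
    rewrite /kgreen -esumZl ?lee_fin//; last by move=> n; exact: kpow_ge0.
    apply: esumT_eq => n; rewrite kpow_tilt// muleCA -EFinM dotB expRB.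
    rewrite (_ : _ / _ * _ = 1) ?mule1//.
    by field; rewrite !gt_eqF ?expR_gt0.
  have [_ [kap [C [s0 [kap0 C0 s00 mgf]]]]] := spec.
  rewrite (kgreenE i0 m_ge0 kap0 C0 s00 q_gt0 mgf) -EFinM /=; ring.
move=> px px0; rewrite /green_ratio !kE//.
set X := expR (dot a (zvec y)).
have X0 : X != 0 by rewrite gt_eqF// expR_gt0.
(* Generalizing this inverse spares [field] a proof that [KG m x0 y] is nonzero. *)
rewrite !invfM invrK; move: (KG m x0 y)^-1 => k.
by field; rewrite X0 gt_eqF// expR_gt0.
Qed.

Lemma green_ratio_cvg (x x0 : T) (u : nat -> T) : posb x -> posb x0 ->
  enorm (zvec (u n) : 'rV[R]_d) @[n --> \oo] --> +oo ->
  (enorm (zvec (u n)))^-1 *: zvec (u n) @[n --> \oo] --> q ->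
  green_ratio P S x0 x (u n) @[n --> \oo] --> h_ P S mu q x / h_ P S mu q x0.
Proof.
move=> px px0 uoo uq.
have [_ [kap [C [s0 [kap0 C0 s00 mgf]]]]] := spec.
pose L n : R := enorm (zvec (u n)).
(* Translation of the hypotheses on the sequence: with L the Euclidean norm, it eventually enters
   every neighborhood used in [along_ray]. *)
have hu (dl : R) : 0 < dl -> \forall n \near \oo, 1 <= dl * L n /\ near_ray (fun i => q 0 i) dl (L n) (u n).
  move=> dl0.
  have Lbig : \forall n \near \oo, dl^-1 <= L n by have /cvgryPge/(_ dl^-1) := uoo.
  have coord (i : 'I_d) : \forall n \near \oo, `|q 0 i - (L n)^-1 * (u n 0 i)%:~R| <= dl.
    have ci : ((enorm (zvec (u n)))^-1 *: zvec (u n) : 'rV[R]_d) 0 i @[n --> \oo] --> q 0 i.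
      apply: (cvg_comp _ (fun M : 'rV[R]_d => M 0 i) uq).
      exact: (@coord_continuous R 1 d 0 i q).
    have /cvgrPdist_le/(_ _ dl0) h := ci.
    by apply: filterS h => n; rewrite !mxE.
  have coords : \forall n \near \oo, forall i : 'I_d, `|q 0 i - (L n)^-1 * (u n 0 i)%:~R| <= dl.
    exact: filter_forall.
  near=> n.
  have Ln : dl^-1 <= L n by near: n.
  have L0 : 0 < L n by rewrite (lt_le_trans _ Ln)// invr_gt0.
  split; first by rewrite -ler_pdivrMl// mulr1.
  move=> i; have cn : forall i : 'I_d, `|q 0 i - (L n)^-1 * (u n 0 i)%:~R| <= dl by near: n.
  have -> : (u n 0 i)%:~R - L n * q 0 i = - (L n * (q 0 i - (L n)^-1 * (u n 0 i)%:~R)).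
    by field; rewrite gt_eqF.
  by rewrite normrN normrM (gtr0_norm L0) mulrC ler_pM2r.
rewrite (_ : (fun n => green_ratio P S x0 x (u n)) = fun n =>
  expR (dot a (zvec x)) / expR (dot a (zvec x0)) * (KG m x (u n) / KG m x0 (u n))); last first.
  by apply/funext => n; exact: green_ratioE.
have -> : h_ P S mu q x / h_ P S mu q x0 =
  expR (dot a (zvec x)) / expR (dot a (zvec x0)) * (esc x / esc x0).
  rewrite !h_E//; have e0 := tilted_escape_gt0 px0.
  by field; rewrite !gt_eqF// expR_gt0.
apply: cvgM; first exact: cvg_cst.
exact: (KG_ratio_cvg i0 m_ge0 m1 kap0 C0 s00 q_gt0 direction_le1 mgf tilt_unit_paths
  tilt_pos_paths hu px0).
Unshelve. all: by end_near.
Qed.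

End positive_direction.

Theorem corollary1p2 (R : realType) (d : nat) (hd : (1 <= d)%N)
    (mu : 'rV[int]_d -> R) (hmu : is_prob mu)
    (dO : measure_display) (Om : measurableType dO)
    (P : 'rV[int]_d -> probability Om R) (S : nat -> Om -> 'rV[int]_d)
    (hS : random_walk P S mu)
    (x0 : 'rV[int]_d) (hx0 : pos_orthant x0)
    (irr : forall L : {set 'I_d}, irreducible_on mu L)
    (fin_phi : finite_near_Dset mu)
    (drift_neq0 : drift mu <> 0)
    (q : 'rV[R]_d) (hq : enorm q = 1) (q_gt0 : forall i, 0 < q 0 i) :
  ((forall x, pos_orthant x -> 0 < h_ P S mu q x) /\
   harmonic_killed mu (h_ P S mu q)) /\
  (forall u : nat -> 'rV[int]_d,
     (forall n, pos_orthant (u n)) ->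
     enorm (zvec (u n) : 'rV[R]_d) @[n --> \oo] --> +oo ->
     (enorm (zvec (u n)))^-1 *: zvec (u n) @[n --> \oo] --> q ->
     fundamental P S x0 u /\
     forall x, pos_orthant x ->
       green_ratio P S x0 x (u n) @[n --> \oo] -->
         h_ P S mu q x / h_ P S mu q x0).
Proof.
split; first split.
- by move=> x /posbP px; exact: (h_gt0 hmu hS irr fin_phi drift_neq0 hq q_gt0 px).
- exact: (h_harmonic hmu hS irr fin_phi drift_neq0 hq q_gt0).
move=> u upos uoo uq.
have cv x : pos_orthant x -> green_ratio P S x0 x (u n) @[n --> \oo] -->
    h_ P S mu q x / h_ P S mu q x0.
  move=> /posbP px; move/posbP: hx0 => px0.
  exact: (green_ratio_cvg hd hmu hS irr fin_phi drift_neq0 hq q_gt0 px px0 uoo uq).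
by split; [split => // x /cv; exact: cvgP|exact: cv].
Qed.
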